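(* Let $\Gamma=R_{2n}(n+2,n+1)$ be a Rose Window graph with $n\ge3$. Then $\Gamma$ is the underlying graph of a map of class $2_{\{0,1\}}$ if and only if $\gcd(n,12)>2$. Moreover, letting $n_0\in\{0,3,4,6,8,9\}$ be the residue of $n$ modulo $12$: (i) if $n=4$, $\Gamma$ is the underlying graph of a unique map of class $2_{\{0,1\}}$, with face lengths $4$ and $8$; (ii) if $n_0\in\{3,9\}$, $\Gamma$ is the underlying graph of exactly three nonisomorphic maps of class $2_{\{0,1\}}$: one with faces of lengths $4$ and $n$, one with faces of lengths $4$ and $2n$, and one with faces of lengths $n$ and $2n$; (iii) if $n_0\in\{4,6,8\}$ and $n\ne4$, $\Gamma$ is the underlying graph of exactly two nonisomorphic maps of class $2_{\{0,1\}}$: one with faces of lengths $4$ and $n$, the other with faces of lengths $4$ and $2n$; (iv) if $n_0=0$, $\Gamma$ is the underlying graph of exactly four nonisomorphic maps of class $2_{\{0,1\}}$: two with faces of lengths $4$ and $n$, and two with faces of lengths $4$ and $2n$.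
   Context: For $m\ge3$, $1\le r\le m-1$ with $r\ne m/2$, and $0\le a\le m-1$, the Rose Window graph $R_m(a,r)$ has vertex set $\{x_i,y_i: i\in\mathbb Z_m\}$ and edges $x_ix_{i+1}$, $y_iy_{i+r}$, $x_iy_i$, $x_iy_{i-a}$ for $i\in\mathbb Z_m$ (indices mod $m$). A map is a $2$-cell embedding of a connected simple graph (its underlying graph) in a closed surface; the components of the complement are the faces, and the length of a face is the length of its boundary walk. All maps considered are polytopal: flags correspond bijectively to incident triples (vertex, edge, face). For a flag $\Phi$ and $i\in\{0,1,2\}$, $\Phi^i$ is the unique flag differing from $\Phi$ exactly in its vertex ($i=0$), edge ($i=1$) or face ($i=2$). $\mathrm{Aut}(\mathcal M)$ is the group of automorphisms of the underlying graph preserving the set of faces. A map is in class $2_{\{0,1\}}$ if $\mathrm{Aut}(\mathcal M)$ has exactly two orbits on flags and for every flag $\Phi$, the flags $\Phi^0,\Phi^1$ lie in the orbit of $\Phi$ while $\Phi^2$ does not. Maps are counted up to map isomorphism. *)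

(* Defs.v *)
From mathcomp Require Import all_boot all_order all_fingroup.
Set Implicit Arguments. Unset Strict Implicit. Unset Printing Implicit Defensive.

(* Combinatorial description of (polytopal) maps on a fixed simple graph.
   The graph has vertex set a finType V and (symmetric, irreflexive) adjacency adj.
   An edge is the 2-element vertex set {x,y} with adj x y.
   A face is represented by its boundary, the set of its edges; in a polytopal
   map every face boundary is a simple cycle.  A map with underlying graph adj
   is a set F of faces such that every face is a cycle, every edge lies in
   exactly two faces, and at each vertex the faces around it form a single
   cycle (connected vertex link); these are exactly the polytopal 2-cell
   embeddings of the graph in closed surfaces. *)

Section Maps.
Variable V : finType.
Variable adj : rel V.

Definition is_edge (e : {set V}) : bool :=
  [exists x, exists y, adj x y && (e == [set x; y])].

Definition is_cycle (f : {set {set V}}) : Prop :=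
  [/\ f != set0,
      {in f, forall e, is_edge e},
      forall v : V, #|[set e in f | v \in e]| \in [:: 0; 2] &
      forall S : {set {set V}}, S \subset f -> S != set0 -> S != f ->
        exists e, exists e', [/\ e \in S, e' \in f :\: S & ~~ [disjoint e & e']]].

Definition is_map (F : {set {set {set V}}}) : Prop :=
  [/\ {in F, forall f, is_cycle f},
      forall e, is_edge e -> #|[set f in F | e \in f]| = 2 &
      forall v : V, forall S : {set {set V}},
        S \subset [set e | is_edge e & v \in e] -> S != set0 ->
        S != [set e | is_edge e & v \in e] ->
        exists e, exists e', exists f,
          [/\ e \in S, e' \in [set e | is_edge e & v \in e] :\: S,
              f \in F, e \in f & e' \in f]].

Definition graph_aut (s : {perm V}) : bool :=
  [forall x, forall y, adj (s x) (s y) == adj x y].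

Definition edge_img (s : {perm V}) (e : {set V}) : {set V} := [set s x | x in e].
Definition face_img (s : {perm V}) (f : {set {set V}}) : {set {set V}} :=
  [set edge_img s e | e in f].
Definition faces_img (s : {perm V}) (F : {set {set {set V}}}) :
  {set {set {set V}}} := [set face_img s f | f in F].

Definition map_aut (F : {set {set {set V}}}) (s : {perm V}) : Prop :=
  graph_aut s /\ faces_img s F = F.

Definition map_iso (F F' : {set {set {set V}}}) : Prop :=
  exists s : {perm V}, graph_aut s /\ faces_img s F = F'.

Definition flag := (V * {set V} * {set {set V}})%type.
Definition fv (p : flag) : V := p.1.1.
Definition fe (p : flag) : {set V} := p.1.2.
Definition ff (p : flag) : {set {set V}} := p.2.

Definition is_flag (F : {set {set {set V}}}) (p : flag) : Prop :=
  [/\ ff p \in F, fe p \in ff p & fv p \in fe p].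

Definition flag_act (s : {perm V}) (p : flag) : flag :=
  (s (fv p), edge_img s (fe p), face_img s (ff p)).

Definition same_orbit (F : {set {set {set V}}}) (p q : flag) : Prop :=
  exists s, map_aut F s /\ flag_act s p = q.

(* class 2_{0,1}: exactly two flag orbits; Phi^0, Phi^1 in the orbit of Phi,
   Phi^2 not. *)
Definition class2_01 (F : {set {set {set V}}}) : Prop :=
  is_map F /\
  (exists p, exists q, [/\ is_flag F p, is_flag F q, ~ same_orbit F p q &
      forall r, is_flag F r -> same_orbit F p r \/ same_orbit F q r]) /\
  (forall p q, is_flag F p -> is_flag F q ->
     [/\ (fe p = fe q /\ ff p = ff q /\ fv p <> fv q) -> same_orbit F p q,
         (fv p = fv q /\ ff p = ff q /\ fe p <> fe q) -> same_orbit F p q &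
         (fv p = fv q /\ fe p = fe q /\ ff p <> ff q) -> ~ same_orbit F p q]).

Definition has_face_lengths (F : {set {set {set V}}}) (a b : nat) : Prop :=
  [/\ forall f, f \in F -> #|f| = a \/ #|f| = b,
      exists2 f, f \in F & #|f| = a &
      exists2 f, f \in F & #|f| = b].

Definition class2_01_maps_are (L : seq (nat * nat)) : Prop :=
  exists Fs : seq {set {set {set V}}},
    [/\ size Fs = size L,
        forall i, i < size L ->
          class2_01 (nth set0 Fs i) /\
          has_face_lengths (nth set0 Fs i) (nth (0, 0) L i).1 (nth (0, 0) L i).2,
        forall i j, i < size L -> j < size L -> i <> j ->
          ~ map_iso (nth set0 Fs i) (nth set0 Fs j) &
        forall F, class2_01 F -> exists2 i, i < size L & map_iso F (nth set0 Fs i)].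

End Maps.

(* Rose Window graph R_m(a,r): x_i = (false, i), y_i = (true, i), i in Z_m;
   edges x_i x_{i+1}, y_i y_{i+r}, x_i y_i, x_i y_{i-a}. *)
Definition rose_adj (m a r : nat) : rel (bool * 'I_m) := fun u w =>
  match u, w with
  | (false, i), (false, j) => ((i + 1) %% m == j) || ((j + 1) %% m == i)
  | (true, i), (true, j) => ((i + r) %% m == j) || ((j + r) %% m == i)
  | (false, i), (true, j) => (nat_of_ord j == i) || ((j + a) %% m == i)
  | (true, j), (false, i) => (nat_of_ord j == i) || ((j + a) %% m == i)
  end.
Arguments rose_adj : clear implicits.

(* Main.v *)
Require Import Defs.
From mathcomp Require Import all_boot all_order all_fingroup.
From mathcomp Require Import zify.
(* Write D for the wreath digraph with vertex set Z_n x F_2 and arcs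
   (j, a) -> (j + 1, b).  The graph R_{2n}(n+2, n+1) is the Praeger-Xu graph
   PX(n, 2), whose vertices are the arcs of D, two arcs being adjacent when the
   head of one is the tail of the other.

   In a map of class 2_{0,1} the two orbits colour the faces so that every edge
   lies on one face of each colour.  The map is therefore given by two disjoint
   perfect matchings mA, mB of the edges at each vertex, the faces being the
   orbits of (v, w) |-> (w, m w v); its automorphism group is transitive on
   darts, and no automorphism of the graph exchanges mA and mB.

   For n <> 4 the automorphisms of PX(n, 2) are the maps
   (j, a) |-> (+-j + c, a + t_j) of D.  Hence a matching either turns back at
   every vertex (4-cycles) or goes straight at every vertex, and then its faces
   are the orbits of a shift register x_{i+3} = x_i + g_i(x_{i+1}, x_{i+2}).
   Dart-transitivity forces g_i(a, b) = be (a + b) + al_i with be constant, and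
   produces shears by n-periodic solutions of the homogeneous recurrence, so
   3 | n when be = 0 and 4 | n when be = 1.  A solution X of the inhomogeneous
   recurrence satisfies X_{i+n} = X_i + u with u constant, and using X as new
   coordinates removes al at the price of the twist u, which decides between
   face lengths n and 2n.  If both matchings go straight, they are exchanged by
   an automorphism unless be = 0 and n is odd.

   For n = 4 the graph is the 4-cube, where the matching at a vertex is a
   translation of the set F_2^2 of directions that depends only on the parity of
   the vertex; of the four possible pairs of matchings, two admit an
   automorphism exchanging them and the others give the map with u = be = 1. *)
Set Implicit Arguments. Unset Strict Implicit. Unset Printing Implicit Defensive.

(** * Maps given by corner matchings *)

Section Corners.
Variables (V : finType) (adj : rel V).
Hypothesis adj_sym : symmetric adj.
Hypothesis adj_irr : irreflexive adj.
Implicit Types (m : V -> V -> V) (x y z : V * V) (s : {perm V}).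

(* [m v w] is the other end of the edge that follows [vw] around [v] in the face of
   the given colour, so the orbits of [step m] are the oriented facial walks. *)
Definition step m x := (x.2, m x.2 x.1).
Definition flip x := (x.2, x.1).
(* Locked, as are the definitions below, to keep unification from unfolding
   finite sets. *)
Definition ed := locked (fun x => [set x.1; x.2]).
Definition dart x := adj x.1 x.2.

(** Each [m v] is an involution of all of [V], which makes [step m] injective on all pairs; only its
    values on the neighbours of [v] have a geometric meaning. *)
Definition matching m :=
  [/\ forall v, involutive (m v), forall v w, adj v (m v w) = adj v w
    & forall v w, adj v w -> m v w != w].

Definition face m x : {set {set V}} := [set ed y | y in fingraph.orbit (step m) x].
Definition faces m : {set {set {set V}}} := [set face m x | x in dart].

Definition simple m :=
  forall x y, dart x -> fconnect (step m) x y -> y.1 = x.1 -> y = x.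

Definition comm s m m' := forall v w, adj v w -> s (m v w) = m' (s v) (s w).

Definition dart_transitive mA mB := forall x y, dart x -> dart y ->
  exists s, [/\ graph_aut adj s, comm s mA mA, comm s mB mB & (s x.1, s x.2) = y].

Lemma flipK : involutive flip. Proof. by case. Qed.

Lemma edE x : ed x = [set x.1; x.2].
Proof. by rewrite /ed -lock. Qed.

Lemma mem_ed v x : (v \in ed x) = (v == x.1) || (v == x.2).
Proof. by rewrite edE !inE. Qed.

Lemma ed_l x : x.1 \in ed x. Proof. by rewrite mem_ed eqxx. Qed.

Lemma ed_r x : x.2 \in ed x. Proof. by rewrite mem_ed eqxx orbT. Qed.

Lemma ed_flip x : ed (flip x) = ed x.
Proof. by rewrite !edE setUC. Qed.

Lemma dart_flip x : dart (flip x) = dart x.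
Proof. exact: adj_sym. Qed.

Lemma ed_inj x y : ed x = ed y -> y = x \/ y = flip x.
Proof.
case: x y => [a b] [c d]; rewrite !edE /flip /= => E.
have Hc : c \in [set a; b] by rewrite E !inE eqxx.
have Hd : d \in [set a; b] by rewrite E !inE eqxx orbT.
have Ha : a \in [set c; d] by rewrite -E !inE eqxx.
have Hb : b \in [set c; d] by rewrite -E !inE eqxx orbT.
move: Hc Hd Ha Hb; rewrite !inE.
by do 4!(case/orP=> /eqP ?); subst; auto.
Qed.

Lemma is_edgeP e : reflect (exists2 x, dart x & e = ed x) (is_edge adj e).
Proof.
apply: (iffP existsP) => [[a /existsP[b /andP[ab /eqP->]]]|[[a b] ab ->]].
  by exists (a, b); rewrite ?edE.
by exists a; rewrite edE; apply/existsP; exists b; rewrite (ab : adj a b) eqxx.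
Qed.

Lemma ed_at x v : v \in ed x -> dart x -> exists2 w, adj v w & ed x = ed (v, w).
Proof.
case: x => a b; rewrite mem_ed /dart /= => /orP[] /eqP -> ab; first by exists b.
by exists a; rewrite 1?adj_sym // -[LHS]ed_flip.
Qed.

Section OneMatching.
Variable m : V -> V -> V.
Hypothesis Mm : matching m.
Let inv v : involutive (m v). Proof. by case: Mm. Qed.

Lemma step_inj : injective (step m).
Proof. by move=> [a b] [c d] [-> /(can_inj (inv _)) ->]. Qed.

Lemma dart_step x : dart (step m x) = dart x.
Proof. by case: Mm => _ H _; rewrite /dart H adj_sym. Qed.

(** Reversal conjugates [step m] to its inverse, so a facial walk read backwards is again a facial
    walk, along the same edges. *)
Lemma step_flip x : step m (flip (step m x)) = flip x.
Proof. by rewrite /step /flip /= inv. Qed.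

Lemma dart_fconnect x y : fconnect (step m) x y -> dart y = dart x.
Proof.
by move=> /iter_findex <-; elim: (findex _ _ _) => //= k <-; rewrite dart_step.
Qed.

Lemma fconnect_flip x y :
  fconnect (step m) x y -> fconnect (step m) (flip x) (flip y).
Proof.
move=> /iter_findex <-; elim: (findex _ _ _) => [|k IH] //=.
apply: connect_trans IH _; rewrite (fconnect_sym step_inj).
by rewrite -{2}[iter k _ x]flipK -[flip (iter k _ x)]step_flip flipK fconnect1.
Qed.

Lemma face_eq x y : fconnect (step m) x y -> face m y = face m x.
Proof.
move=> xy; apply/setP=> e; apply/imsetP/imsetP => -[z];
  rewrite -fconnect_orbit => H ->; exists z => //; rewrite -fconnect_orbit.
  exact: connect_trans xy H.
by apply: connect_trans H; rewrite (fconnect_sym step_inj).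
Qed.

Lemma face_flip x : face m (flip x) = face m x.
Proof.
have H z e : e \in face m z -> e \in face m (flip z).
  case/imsetP=> y; rewrite -fconnect_orbit => /fconnect_flip zy ->.
  by rewrite -ed_flip; apply: imset_f; rewrite -fconnect_orbit.
by apply/setP=> e; apply/idP/idP => /H //; rewrite flipK.
Qed.

Lemma mem_face x : ed x \in face m x.
Proof. by apply: imset_f; rewrite in_orbit. Qed.

(** An edge determines its dart up to reversal, and both orientations give the same face; hence each
    edge lies on one face of a given colour. *)
Lemma mem_face_eq x y : ed y \in face m x -> face m y = face m x.
Proof.
case/imsetP=> z; rewrite -fconnect_orbit => xz /ed_inj[] ?; subst.
  exact: face_eq.
by rewrite -(face_eq xz) face_flip.
Qed.

Lemma mem_face_step x : ed (x.1, m x.1 x.2) \in face m x.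
Proof.
by rewrite -face_flip; apply: imset_f; rewrite -fconnect_orbit; apply: fconnect1.
Qed.

Lemma face_edge x e : dart x -> e \in face m x -> is_edge adj e.
Proof.
move=> dx /imsetP[y]; rewrite -fconnect_orbit => xy ->; apply/is_edgeP.
by exists y; rewrite // (dart_fconnect xy).
Qed.

Hypothesis Sm : simple m.

(** Simplicity lets the walk leave [v] only along [vw]; a dart of the walk that enters [v] is
    followed by that one, so it comes from [m v w]. *)
Lemma face_at v w e : adj v w -> e \in face m (v, w) -> v \in e ->
  e = ed (v, w) \/ e = ed (v, m v w).
Proof.
move=> vw /imsetP[y]; rewrite -fconnect_orbit => xy ->; rewrite mem_ed.
case/orP => /eqP E; first by left; rewrite [y](@Sm (v, w) y vw xy (esym E)).
right; have: step m y = (v, w).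
  by apply: Sm => //; apply: connect_trans xy (fconnect1 _ _).
by case: y xy E => a b /= _ -> [<-]; rewrite inv -ed_flip.
Qed.

Lemma face_degree v w : adj v w ->
  [set e in face m (v, w) | v \in e] = [set ed (v, w); ed (v, m v w)].
Proof.
move=> vw; apply/setP=> e; rewrite !inE; apply/andP/orP.
  by case=> /(face_at vw) H /H[] ->; [left | right].
case=> /eqP->; rewrite (ed_l (v, _)); split=> //; first exact: mem_face.
exact: (mem_face_step (v, w)).
Qed.

(** Edges could be fewer than darts only if the walk ran along an edge in both directions. Then
    [flip y] and [step m y] leave the same vertex, simplicity identifies them, and [m] fixes a
    neighbour. *)
Lemma card_face x : dart x -> #|face m x| = fingraph.order (step m) x.
Proof.
move=> dx; rewrite /face card_in_imset .
  by rewrite (card_uniqP (orbit_uniq _ _)) size_orbit.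
move=> y z; rewrite -!fconnect_orbit => xy xz /ed_inj[] // E; subst z.
have dy : dart (flip y) by rewrite (dart_fconnect xz).
have yz : fconnect (step m) (flip y) (step m y).
  apply: connect_trans (fconnect1 _ y); apply: connect_trans xy.
  by rewrite (fconnect_sym step_inj).
have /(_ erefl) := Sm dy yz; case: y dy {xy xz yz} => a b /= d [] E.
by case: Mm => _ _ /(_ _ _ d); rewrite E eqxx.
Qed.

Lemma face_cycle x : dart x -> is_cycle adj (face m x).
Proof.
move=> dx; split.
- by apply/set0Pn; exists (ed x); apply: mem_face.
- by move=> e; apply: face_edge.
- move=> v; rewrite !inE -!leqn0.
  case: (set_0Vmem [set e in face m x | v \in e]) => [->|[e]]; first by rewrite cards0.
  rewrite inE => /andP[ef ve]; apply/orP; right.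
  have /is_edgeP[y dy Ey] := face_edge dx ef.
  move: ve; rewrite Ey => /ed_at /(_ dy)[w vw Ew].
  have -> : face m x = face m (v, w) by rewrite (@mem_face_eq x (v, w)) // -Ew -Ey.
  rewrite face_degree // cards2 eqSS eqb1; apply/eqP=> /ed_inj[] [] => [E|/esym E _].
    by case: Mm => _ _ /(_ _ _ vw); rewrite E eqxx.
  by move: vw; rewrite E adj_irr.
- move=> S Sf /set0Pn[e eS] Sneq.
  have [y xy Ey] : exists2 y, fconnect (step m) x y & e = ed y.
    by move/subsetP: Sf => /(_ _ eS) /imsetP[y]; rewrite -fconnect_orbit; exists y.
  have Fy := face_eq xy.
  have [k Hk] : exists k, ed (iter k (step m) y) \notin S.
    suff /existsP[k] : [exists k : 'I_(fingraph.order (step m) y),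
        ed (iter k (step m) y) \notin S] by exists k.
    apply: contraNT Sneq => /existsPn H; rewrite eqEsubset Sf /=.
    apply/subsetP=> e'; rewrite -Fy => /imsetP[z]; rewrite -fconnect_orbit.
    move=> yz ->; have := H (Ordinal (findex_max yz)).
    by rewrite negbK /= iter_findex.
  (* The walk starts in [S] and meets an edge outside [S], so two consecutive edges lie on different
     sides; they share a vertex. *)
  have [j [Hj Hj']] : exists j, ed (iter j (step m) y) \in S /\
        ed (iter j.+1 (step m) y) \notin S.
    elim: k Hk => [|k IH] H; first by rewrite /= -Ey eS in H.
    case: (boolP (ed (iter k (step m) y) \in S)) => H'; last exact: IH.
    by exists k.
  exists (ed (iter j (step m) y)), (ed (iter j.+1 (step m) y)); split=> //.
    by rewrite inE Hj' -Fy; apply: imset_f; rewrite -fconnect_orbit fconnect_iter.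
  apply/pred0Pn; exists (iter j (step m) y).2.
  by rewrite /= ed_r (ed_l (step m _)).
Qed.

End OneMatching.

(** * Transport of faces by automorphisms *)

Definition dmap s x := (s x.1, s x.2).

Lemma graph_autE s : graph_aut adj s -> forall v w, adj (s v) (s w) = adj v w.
Proof. by move=> /forallP H v w; apply/eqP; move/forallP: (H v); apply. Qed.

Lemma dart_dmap s x : graph_aut adj s -> dart (dmap s x) = dart x.
Proof. by move=> /graph_autE H; apply: H. Qed.

Lemma edge_img_ed s x : edge_img s (ed x) = ed (dmap s x).
Proof. by rewrite !edE /edge_img imsetU1 imset_set1. Qed.

Lemma edge_img_inj s : injective (edge_img s).
Proof. exact/imset_inj/perm_inj. Qed.

Lemma card_face_img s f : #|face_img s f| = #|f|.
Proof. exact/card_imset/edge_img_inj. Qed.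

Section Transport.
Variables (s : {perm V}) (m m' : V -> V -> V).
Hypotheses (Gs : graph_aut adj s) (Mm : matching m) (C : comm s m m').

Lemma iter_step_dmap k x : dart x ->
  iter k (step m') (dmap s x) = dmap s (iter k (step m) x).
Proof.
move=> dx; elim: k => //= k ->; rewrite /step /dmap /= C // adj_sym.
elim: k => //= k IH; move: (dart_step Mm (iter k (step m) x)).
by rewrite /dart /= => ->.
Qed.

Lemma face_img_face x : dart x -> face_img s (face m x) = face m' (dmap s x).
Proof.
move=> dx; apply/setP=> e; apply/imsetP/imsetP => [[e' /imsetP[y]]|[y]];
  rewrite -fconnect_orbit => /iter_findex E.
  move=> -> ->; exists (dmap s y); last exact: edge_img_ed.
  by rewrite -fconnect_orbit -E -iter_step_dmap // fconnect_iter.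
move=> ->; rewrite -E iter_step_dmap // -edge_img_ed.
by eexists; last reflexivity; apply: imset_f; rewrite -fconnect_orbit fconnect_iter.
Qed.

Lemma faces_img_faces : faces_img s (faces m) = faces m'.
Proof.
apply/setP=> f; apply/imsetP/imsetP => [[f' /imsetP[x dx ->] ->]|[x dx ->]].
  by exists (dmap s x); [rewrite -[_ \in _]/(dart _) dart_dmap | apply: face_img_face].
have E : x = dmap s (dmap s^-1%g x) by case: x {dx} => a b; rewrite /dmap !permKV.
have dx' : dart (dmap s^-1%g x) by rewrite -(dart_dmap _ Gs) -E.
exists (face m (dmap s^-1%g x)); first by apply: imset_f.
by rewrite face_img_face -?E.
Qed.

End Transport.

Lemma comm_map_iso s mA mB mA' mB' : graph_aut adj s ->
  matching mA -> matching mB -> comm s mA mA' -> comm s mB mB' ->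
  map_iso adj (faces mA :|: faces mB) (faces mA' :|: faces mB').
Proof.
move=> Gs MA MB CA CB; exists s; split=> //.
by rewrite /faces_img imsetU -!/(faces_img _ _) (faces_img_faces Gs MA CA)
  (faces_img_faces Gs MB CB).
Qed.

(** * From two matchings to a map of class 2_{0,1} *)

Section FromMatchings.
Variables (mA mB : V -> V -> V) (a b : nat).
Hypotheses (MA : matching mA) (MB : matching mB) (SA : simple mA) (SB : simple mB).
Hypothesis nbrs : forall v w w', adj v w -> adj v w' ->
  w' \in [:: w; mA v w; mB v w; mA v (mB v w)].
Hypotheses (cA : forall x, dart x -> #|face mA x| = a)
           (cB : forall x, dart x -> #|face mB x| = b).
Hypothesis ab : a != b.

Local Notation F := (faces mA :|: faces mB).

Lemma card_facesA (f : {set {set V}}) : f \in faces mA -> #|f| = a.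
Proof. by case/imsetP=> x dx ->; apply: cA. Qed.

Lemma card_facesB (f : {set {set V}}) : f \in faces mB -> #|f| = b.
Proof. by case/imsetP=> x dx ->; apply: cB. Qed.

Lemma faces_through v w (f : {set {set V}}) : adj v w -> ed (v, w) \in f -> f \in F ->
  f = face mA (v, w) \/ f = face mB (v, w).
Proof.
move=> vw ef; rewrite inE => /orP[] /imsetP[x dx Ef]; move: ef; rewrite Ef.
  by move/(mem_face_eq MA); left.
by move/(mem_face_eq MB); right.
Qed.

Lemma faceA_in x : dart x -> face mA x \in F.
Proof. by move=> dx; rewrite inE imset_f. Qed.

Lemma faceB_in x : dart x -> face mB x \in F.
Proof. by move=> dx; rewrite inE orbC imset_f. Qed.

Lemma faceAB_neq x : dart x -> face mA x != face mB x.
Proof. by move=> dx; apply: contraNneq ab => E; rewrite -(cA dx) E cB. Qed.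

(** Each edge has one face of each colour, distinct since the lengths [a] and [b] differ. The link
    of a vertex is connected because, by [nbrs], the two matchings carry any neighbour to all the
    others. *)
Lemma matchings_map : is_map adj F.
Proof.
split.
- by move=> f; rewrite inE => /orP[] /imsetP[x dx ->]; apply: face_cycle.
- move=> e /is_edgeP[x dx ->].
  have -> : [set f in F | ed x \in f] = [set face mA x; face mB x].
    apply/setP=> f; rewrite [LHS]inE in_set2; apply/andP/orP.
      case: x dx => v w dx [fF ef].
      by case: (faces_through dx ef fF) => ->; rewrite eqxx; auto.
    case=> /eqP->; split; try exact: mem_face; [exact: faceA_in | exact: faceB_in].
  by rewrite cards2 faceAB_neq.
- move=> v S Sv /set0Pn[e eS] Sneq.
  set N := [set e | is_edge adj e & v \in e] in Sv Sneq *.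
  have inN w : adj v w -> ed (v, w) \in N.
    by move=> vw; rewrite inE (ed_l (v, w)) andbT; apply/is_edgeP; exists (v, w).
  have [w vw Ee] : exists2 w, adj v w & e = ed (v, w).
    move/subsetP: Sv => /(_ _ eS); rewrite inE => /andP[/is_edgeP[x dx ->]].
    by move=> /ed_at /(_ dx).
  have aA u : adj v (mA v u) = adj v u by case: MA.
  have aB u : adj v (mB v u) = adj v u by case: MB.
  have jump (u : V) : adj v u -> ed (v, u) \in S ->
      ed (v, mA v u) \notin S \/ ed (v, mB v u) \notin S ->
      exists e e' f, [/\ e \in S, e' \in N :\: S, f \in F, e \in f & e' \in f].
    move=> vu uS [] H.
      exists (ed (v, u)), (ed (v, mA v u)), (face mA (v, u)); split=> //.
      + by rewrite inE H inN ?aA.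
      + exact: faceA_in.
      + exact: mem_face.
      + exact: (mem_face_step MA (v, u)).
    exists (ed (v, u)), (ed (v, mB v u)), (face mB (v, u)); split=> //.
    + by rewrite inE H inN ?aB.
    + exact: faceB_in.
    + exact: mem_face.
    + exact: (mem_face_step MB (v, u)).
  case: (boolP (ed (v, mA v w) \in S)) => HA; last by apply: (jump w); auto; rewrite -Ee.
  case: (boolP (ed (v, mB v w) \in S)) => HB; last by apply: (jump w); auto; rewrite -Ee.
  case: (boolP (ed (v, mA v (mB v w)) \in S)) => HAB; last first.
    by apply: (jump (mB v w)); rewrite ?aB; auto.
  case/eqP: Sneq; apply/eqP; rewrite eqEsubset Sv; apply/subsetP=> e'.
  rewrite inE => /andP[/is_edgeP[x dx ->]] /ed_at /(_ dx)[w' vw' ->].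
  by have := nbrs vw vw'; rewrite !inE => /or4P[] /eqP-> //; rewrite -Ee.
Qed.

Hypothesis DT : dart_transitive mA mB.
Hypothesis inhabited : exists x, dart x.

Lemma comm_map_aut s : graph_aut adj s -> comm s mA mA -> comm s mB mB -> map_aut adj F s.
Proof.
move=> Gs CA CB; split=> //.
by rewrite /faces_img imsetU -!/(faces_img _ _) (faces_img_faces Gs MA CA)
  (faces_img_faces Gs MB CB).
Qed.

Lemma flagP p : is_flag F p -> exists x, [/\ dart x, fv p = x.1, fe p = ed x
  & ff p = face mA x \/ ff p = face mB x].
Proof.
case=> fF ef ve.
have [x dx Ex] : exists2 x, dart x & fe p = ed x.
  by apply/is_edgeP; move: fF; rewrite inE => /orP[] /imsetP[x dx E];
    move: ef; rewrite E => /face_edge; apply.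
move: ve ef; rewrite Ex => /ed_at /(_ dx)[w vw ->] ef.
by exists (fv p, w); split=> //; apply: faces_through.
Qed.

Lemma same_orbitA x y : dart x -> dart y ->
  same_orbit adj F (x.1, ed x, face mA x) (y.1, ed y, face mA y).
Proof.
move=> dx dy; have [s [Gs CA CB E]] := DT dx dy; exists s; split.
  exact: comm_map_aut.
by rewrite /flag_act /fv /fe /ff /= edge_img_ed (face_img_face MA CA) // /dmap E -E.
Qed.

Lemma same_orbitB x y : dart x -> dart y ->
  same_orbit adj F (x.1, ed x, face mB x) (y.1, ed y, face mB y).
Proof.
move=> dx dy; have [s [Gs CA CB E]] := DT dx dy; exists s; split.
  exact: comm_map_aut.
by rewrite /flag_act /fv /fe /ff /= edge_img_ed (face_img_face MB CB) // /dmap E -E.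
Qed.

Lemma same_orbit_card p q : same_orbit adj F p q -> #|ff p| = #|ff q|.
Proof. by case=> s [_ <-]; rewrite /ff /= card_face_img. Qed.

(** A flag is a dart with one of its two faces, so colour-preserving dart-transitivity makes the
    flags of each colour one orbit; the different face lengths keep the two orbits apart. *)
Lemma matchings_class2 : class2_01 adj F.
Proof.
split; first exact: matchings_map.
have E (p : flag V) v e f : fv p = v -> fe p = e -> ff p = f -> p = (v, e, f).
  by case: p => [[? ?] ?]; rewrite /fv /fe /ff /= => -> -> ->.
split.
  have [x dx] := inhabited.
  exists (x.1, ed x, face mA x), (x.1, ed x, face mB x); split.
  - by split; [exact: faceA_in | exact: mem_face | exact: ed_l].
  - by split; [exact: faceB_in | exact: mem_face | exact: ed_l].
  - by move/same_orbit_card/eqP; rewrite /ff /= cA // cB // (negbTE ab).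
  - move=> r /flagP[y [dy Ev Ee []] /(E _ _ _ _ Ev Ee) ->]; [left|right].
      exact: same_orbitA.
    exact: same_orbitB.
move=> p q /flagP[x [dx Ev Ee Ef]] /flagP[y [dy Ev' Ee' Ef']].
have same : ff p = ff q -> same_orbit adj F p q.
  move: (E p _ _ _ Ev Ee erefl) (E q _ _ _ Ev' Ee' erefl).
  case: Ef => ->; case: Ef' => -> -> -> EF.
  - exact: same_orbitA.
  - by case/eqP: ab; rewrite -(cA dx) EF cB.
  - by case/eqP: ab; rewrite -(cB dx) EF cA.
  - exact: same_orbitB.
split=> [[_ [/same]]|[_ [/same]]|[Evv [Eee Nff]] /same_orbit_card] //.
have Exy : face mA x = face mA y /\ face mB x = face mB y.
  have := mem_face mA x; have := mem_face mB x; rewrite -Ee Eee Ee'.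
  by move=> /(mem_face_eq MB) -> /(mem_face_eq MA) ->.
case: Ef Ef' Nff => -> [] ->.
- by rewrite Exy.1.
- by move=> _ /eqP; rewrite cA // cB // (negbTE ab).
- by move=> _ /eqP; rewrite cA // cB // eq_sym (negbTE ab).
- by rewrite Exy.2.
Qed.

Lemma matchings_lengths : has_face_lengths F a b.
Proof.
have [x dx] := inhabited; split.
- by move=> f; rewrite inE => /orP[/card_facesA|/card_facesB]; auto.
- by exists (face mA x); [apply: faceA_in | apply: cA].
- by exists (face mB x); [apply: faceB_in | apply: cB].
Qed.

End FromMatchings.

(** A simple face has only two edges at a vertex, so an automorphism that maps faces to faces also
    maps corners to corners. *)
Lemma img_comm s m m' :
  graph_aut adj s -> matching m -> matching m' -> simple m' ->
  (forall x, dart x -> exists2 y, dart y & face_img s (face m x) = face m' y) ->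
  comm s m m'.
Proof.
move=> Gs Mm Mm' Sm' H v w vw; have [y dy Ey] := H (v, w) vw.
have svw : adj (s v) (s w) by rewrite graph_autE.
have Es : face_img s (face m (v, w)) = face m' (s v, s w).
  rewrite Ey; apply/esym/(mem_face_eq Mm'); rewrite -Ey -/(dmap s (v, w)) -edge_img_ed.
  exact/imset_f/mem_face.
have : edge_img s (ed (v, m v w)) \in face m' (s v, s w).
  by rewrite -Es; apply/imset_f/(mem_face_step Mm (v, w)).
rewrite edge_img_ed /dmap /= => /(face_at Mm' Sm' svw).
case; first exact: (ed_l (s v, _)).
  case/ed_inj=> [[E]|[E _]].
    by case: Mm => _ _ /(_ _ _ vw); rewrite -(perm_inj E) eqxx.
  by have := vw; case: Mm => _ <- _; rewrite -(perm_inj E) adj_irr.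
case/ed_inj=> [[->]|[E1 E2]] //.
have : adj (s v) (s (m v w)) by rewrite graph_autE //; case: Mm => _ -> _.
by rewrite -E1 adj_irr.
Qed.

Hypothesis degree_ge3 : forall v w w', exists w'', [/\ adj v w'', w'' != w & w'' != w'].

(** * Corner matchings of a map of class 2_{0,1} *)

Section FromClass2.
Variable F : {set {set {set V}}}.

Definition orb (r t : flag V) :=
  [exists s : {perm V}, [&& graph_aut adj s, faces_img s F == F & flag_act s r == t]].

Lemma orbP r t : reflect (same_orbit adj F r t) (orb r t).
Proof.
rewrite /orb; unlock; apply: (iffP existsP) => [[s /and3P[Gs /eqP Fs /eqP E]]|[s [[Gs Fs] E]]].
  by exists s; split.
by exists s; rewrite Gs Fs E !eqxx.
Qed.

Lemma edge_imgM s s' e : edge_img (s * s')%g e = edge_img s' (edge_img s e).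
Proof. by rewrite /edge_img -imset_comp; apply: eq_imset => v; rewrite /= permM. Qed.

Lemma face_imgM s s' f : face_img (s * s')%g f = face_img s' (face_img s f).
Proof.
by rewrite /face_img -imset_comp; apply: eq_imset => e; rewrite /= edge_imgM.
Qed.

Lemma faces_imgM s s' (G : {set {set {set V}}}) :
  faces_img (s * s')%g G = faces_img s' (faces_img s G).
Proof.
by rewrite /faces_img -imset_comp; apply: eq_imset => f; rewrite /= face_imgM.
Qed.

Lemma edge_img1 e : edge_img (1%g : {perm V}) e = e.
Proof. by rewrite -[RHS]imset_id; apply: eq_imset => v; rewrite perm1. Qed.

Lemma face_img1 f : face_img (1%g : {perm V}) f = f.
Proof. by rewrite -[RHS]imset_id; apply: eq_imset => v; rewrite edge_img1. Qed.

Lemma faces_img1 (G : {set {set {set V}}}) : faces_img (1%g : {perm V}) G = G.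
Proof. by rewrite -[RHS]imset_id; apply: eq_imset => v; rewrite face_img1. Qed.

Lemma flag_actM s s' r : flag_act (s * s')%g r = flag_act s' (flag_act s r).
Proof. by rewrite /flag_act permM edge_imgM face_imgM. Qed.

Lemma flag_act1 r : flag_act (1%g : {perm V}) r = r.
Proof.
by case: r => [[v e] f]; rewrite /flag_act /fv /fe /ff perm1 edge_img1 face_img1.
Qed.

Lemma graph_autM s s' : graph_aut adj s -> graph_aut adj s' -> graph_aut adj (s * s')%g.
Proof.
move=> /graph_autE H /graph_autE H'; apply/forallP => v; apply/forallP => w.
by rewrite !permM H' H.
Qed.

Lemma graph_autV s : graph_aut adj s -> graph_aut adj s^-1%g.
Proof.
move=> /graph_autE H; apply/forallP => v; apply/forallP => w.
by rewrite -H !permKV.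
Qed.

Lemma orb_sym r t : orb r t -> orb t r.
Proof.
rewrite /orb; unlock => /existsP[s /and3P[Gs /eqP Fs /eqP <-]]; apply/existsP; exists s^-1%g.
rewrite graph_autV // -{1}Fs -faces_imgM mulgV faces_img1 eqxx.
by rewrite -flag_actM mulgV flag_act1 eqxx.
Qed.

Lemma orb_trans t r u : orb r t -> orb t u -> orb r u.
Proof.
rewrite /orb; unlock => /existsP[s /and3P[Gs /eqP Fs /eqP <-]].
move=> /existsP[s' /and3P[Gs' /eqP Fs' /eqP <-]].
apply/existsP; exists (s * s')%g.
by rewrite graph_autM // faces_imgM Fs Fs' flag_actM !eqxx.
Qed.

Hypothesis CF : class2_01 adj F.
Let MF : is_map adj F. Proof. by case: CF. Qed.

Lemma orb_vertex r v v' e f : is_flag F (v, e, f) -> v' \in e ->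
  orb r (v, e, f) -> orb r (v', e, f).
Proof.
move=> fl ve' o; have [<- //|/eqP N] := eqVneq v v'.
apply: (orb_trans o); apply/orbP; case: CF => _ [_ /(_ (v, e, f) (v', e, f) fl)].
have fl' : is_flag F (v', e, f) by case: fl.
by move=> /(_ fl')[H _ _]; apply: H.
Qed.

(** This gives each face a single colour. The edges of [f] all of whose flags on [f] lie in the
    orbit of [r] form a set closed under passing to an edge with a common vertex, since changing the
    vertex or the edge keeps the orbit; a cycle is connected. *)
Lemma orb_face r v v' e e' f : is_flag F (v, e, f) -> is_flag F (v', e', f) ->
  orb r (v, e, f) -> orb r (v', e', f).
Proof.
move=> fl fl' o; have [fF ef ve] := fl; have [_ ef' ve'] := fl';
  rewrite /fv /fe /ff /= in ef ef' ve ve' fF.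
pose S := [set d in f | [forall (u | u \in d), orb r (u, d, f)]].
suff : e' \in S by rewrite inE => /andP[_ /forall_inP]; apply.
have eS : e \in S.
  by rewrite inE ef /=; apply/forall_inP=> u ue; apply: orb_vertex o.
suff -> : S = f by [].
apply/eqP; apply: contraT => Sf.
have Ssub : S \subset f by apply/subsetP=> d; rewrite inE => /andP[].
have [_ _ _ /(_ S Ssub)] := (let: And3 H _ _ := MF in H f fF).
case=> //; first by apply/set0Pn; exists e.
move=> d [d' [dS]]; rewrite inE => /andP[dS' df'] /pred0Pn[u /= /andP[ud ud']].
case/negP: dS'; rewrite inE df' /=; apply/forall_inP=> w wd'.
have fd : is_flag F (u, d, f) by move: dS; rewrite inE => /andP[? _].
have fd' : is_flag F (u, d', f) by [].
apply: (orb_vertex fd' wd').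
have od : orb r (u, d, f).
  by move: dS; rewrite inE => /andP[_ /forall_inP/(_ u ud)].
have [<-|/eqP N] := eqVneq d d'; first exact: od.
apply: (orb_trans od); apply/orbP.
by case: CF => _ [_ /(_ _ _ fd fd')[_ H _]]; apply: H.
Qed.

Variables p q : flag V.
Hypotheses (Np : ~ same_orbit adj F p q)
  (Opq : forall r, is_flag F r -> same_orbit adj F p r \/ same_orbit adj F q r).

(** Flags that differ only in their face lie in different orbits, and there are only two orbits. *)
Lemma edge_faces v e : is_edge adj e -> v \in e -> exists fp fq,
  [/\ [set f in F | e \in f] = [set fp; fq], orb p (v, e, fp), orb q (v, e, fq),
      ~~ orb p (v, e, fq) & ~~ orb q (v, e, fp)].
Proof.
move=> ee ve; case: MF => _ /(_ e ee) /eqP/cards2P[f [g [N E]]] _.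
have [fF ef] : f \in F /\ e \in f by have := set21 f g; rewrite -E inE => /andP.
have [gF eg] : g \in F /\ e \in g by have := set22 f g; rewrite -E inE => /andP.
have fl : is_flag F (v, e, f) by [].
have gl : is_flag F (v, e, g) by [].
have no : ~ orb (v, e, f) (v, e, g).
  move/orbP; case: CF => _ [_ /(_ _ _ fl gl)[_ _ H]]; apply: H.
  by do 2!split=> //; apply/eqP.
have npq u : orb p u -> orb q u -> False.
  by move=> pu /orb_sym qu; apply: Np; apply/orbP; apply: orb_trans qu.
case: (Opq fl) (Opq gl) => /orbP of_ [] /orbP og.
- by case: no; apply: orb_trans og; apply: orb_sym.
- exists f, g; split=> //; apply/negP; first by move/npq; apply.
  by move=> H; apply: npq of_ H.
- exists g, f; split=> //; first by rewrite setUC.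
    by apply/negP=> H; apply: npq H of_.
  by apply/negP=> H; apply: npq og H.
- by case: no; apply: orb_trans og; apply: orb_sym.
Qed.

(** The face of colour [r] on the edge [ed x]. The default [set0] is not reached on darts when [r]
    is [p] or [q]. *)
Definition orbit_face := locked (fun r x =>
  odflt set0 [pick f in F | (ed x \in f) && orb r (x.1, ed x, f)]).

Section OneColour.
Variable r : flag V.
Hypothesis rpq : r = p \/ r = q.

Lemma orbit_face_spec x : dart x -> [/\ orbit_face r x \in F, ed x \in orbit_face r x,
  orb r (x.1, ed x, orbit_face r x) & forall f, f \in F -> ed x \in f ->
    orb r (x.1, ed x, f) -> f = orbit_face r x].
Proof.
move=> dx; have ex : is_edge adj (ed x) by apply/is_edgeP; exists x.
have [fp [fq [E op oq np nq]]] := edge_faces ex (ed_l x).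
have inF f : f \in [set fp; fq] -> f \in F /\ ed x \in f.
  by rewrite -E inE => /andP.
have cov f : f \in F -> ed x \in f -> f = fp \/ f = fq.
  move=> fF ef; have : f \in [set fp; fq] by rewrite -E inE fF.
  by rewrite !inE => /orP[] /eqP; auto.
have [e [eF xe oe ue]] : exists e, [/\ e \in F, ed x \in e, orb r (x.1, ed x, e)
    & forall f, f \in F -> ed x \in f -> orb r (x.1, ed x, f) -> f = e].
  case: rpq => ->; [exists fp | exists fq].
    have [? ?] := inF fp (set21 _ _); split=> // f fF xf; case: (cov f fF xf) => -> //.
    by rewrite (negbTE np).
  have [? ?] := inF fq (set22 _ _); split=> // f fF xf; case: (cov f fF xf) => -> //.
  by rewrite (negbTE nq).
rewrite /orbit_face; unlock; case: pickP => [g /and3P[gF xg og]|/(_ e)] /=;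
  last by rewrite eF xe oe.
by split=> // f fF xf of_; rewrite (ue f) // (ue g).
Qed.

Lemma flag_orbit_face x v e : dart x -> e \in orbit_face r x -> v \in e ->
  is_flag F (v, e, orbit_face r x).
Proof. by move=> /orbit_face_spec[? _ _ _]. Qed.

Lemma orbit_face_eq x y : dart x -> dart y -> ed y \in orbit_face r x ->
  orbit_face r y = orbit_face r x.
Proof.
move=> dx dy yx; have [xF xx ox _] := orbit_face_spec dx; have [_ _ _ u] := orbit_face_spec dy.
apply/esym; apply: (u _ xF yx).
exact: orb_face (flag_orbit_face dx xx (ed_l x)) (flag_orbit_face dx yx (ed_l y)) ox.
Qed.

(** The corner at [v] of the face of colour [r] on [vw]. Off the neighbours it is the identity, so
    as to be an involution of all of [V]. *)
Definition partner := locked (fun v w =>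
  if adj v w then odflt w [pick w' | (w' != w) && (ed (v, w') \in orbit_face r (v, w))] else w).

Lemma partner_spec v w : adj v w ->
  [/\ adj v (partner v w), partner v w != w, ed (v, partner v w) \in orbit_face r (v, w)
    & forall u, ed (v, u) \in orbit_face r (v, w) -> u = w \/ u = partner v w].
Proof.
move=> vw; have [fF ef _ _] := orbit_face_spec (vw : dart (v, w)).
have [_ Fe Fd _] := (let: And3 H _ _ := MF in H _ fF).
have edgeP u : ed (v, u) \in orbit_face r (v, w) -> adj v u.
  move=> /Fe /is_edgeP[y dy /ed_inj[] E]; first by rewrite E in dy.
  by move: dy; rewrite E -/(dart (flip (v, u))) dart_flip.
have : #|[set e in orbit_face r (v, w) | v \in e]| = 2.
  have := Fd v; rewrite !inE => /orP[/eqP/cards0_eq E|/eqP] //.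
  by have := in_set0 (ed (v, w)); rewrite -E inE ef (ed_l (v, w)).
move/eqP/cards2P=> [e1 [e2 [N E]]].
have two u : ed (v, u) \in orbit_face r (v, w) -> ed (v, u) = e1 \/ ed (v, u) = e2.
  move=> H; have : ed (v, u) \in [set e1; e2] by rewrite -E inE H (ed_l (v, u)).
  by rewrite !inE => /orP[] /eqP; auto.
have ex e : e \in [set e1; e2] -> exists2 u, ed (v, u) \in orbit_face r (v, w) & e = ed (v, u).
  rewrite -E inE => /andP[ef' ve]; have /is_edgeP[y dy Ey] := Fe _ ef'.
  by move: ve ef'; rewrite Ey => /ed_at /(_ dy)[u _ ->]; exists u.
have edv u u' : ed (v, u) = ed (v, u') -> u = u'.
  by case/ed_inj=> [[]|[-> ->]].
rewrite /partner; unlock; rewrite vw; case: pickP => [w' /andP[N' ef']|H] /=.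
  split=> //; first exact: edgeP.
  move=> u eu; case: (two u eu) (two w ef) (two w' ef') => E1 [] E2 [] E3;
    try (by left; apply: edv; rewrite E1 E2); try (by right; apply: edv; rewrite E1 E3);
    by case/eqP: N'; apply: edv; rewrite E2 E3.
have [u1 f1 E1] := ex e1 (set21 _ _); have [u2 f2 E2] := ex e2 (set22 _ _).
have H' u : ed (v, u) \in orbit_face r (v, w) -> u = w.
  by move=> fu; have := H u; rewrite fu andbT => /negbFE/eqP.
by move: N; rewrite E1 E2 (H' _ f1) (H' _ f2) eqxx.
Qed.

Lemma partner_nonadj v w : adj v w = false -> partner v w = w.
Proof. by rewrite /partner; unlock => ->. Qed.

Lemma orbit_face_partner v w : adj v w -> orbit_face r (v, partner v w) = orbit_face r (v, w).
Proof. by move=> vw; have [? _ ? _] := partner_spec vw; apply: orbit_face_eq. Qed.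

Lemma orbit_face_flip x : dart x -> orbit_face r (flip x) = orbit_face r x.
Proof.
move=> dx; apply: orbit_face_eq => //; rewrite ?dart_flip //.
by rewrite ed_flip; case: (orbit_face_spec dx).
Qed.

Lemma partner_matching : matching partner.
Proof.
have pA v w : adj v (partner v w) = adj v w.
  case vw: (adj v w); first by have [-> _ _ _] := partner_spec vw.
  by rewrite partner_nonadj.
split=> // v w; last by move/partner_spec=> [].
case vw: (adj v w); last by rewrite !partner_nonadj.
have [a n e _] := partner_spec vw; have [_ n' _ /(_ w)] := partner_spec a.
rewrite orbit_face_partner //; case; first by case: (orbit_face_spec (vw : dart (v, w))).
  by move=> E; rewrite -E eqxx in n.
by move=> <-.
Qed.

(** The walk never leaves [orbit_face r x]. If it missed an edge, connectedness would give a missed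
    edge meeting a visited one at some [u]; but the face has only two edges at [u], and the walk
    uses both. *)
Lemma face_partner x : dart x -> face partner x = orbit_face r x.
Proof.
move=> dx; have Mp := partner_matching.
have sub y : fconnect (step partner) x y -> orbit_face r y = orbit_face r x.
  move=> /iter_findex <-; elim: (findex _ _ _) => //= k <-.
  set z := iter k _ _; have dz : dart z.
    by rewrite /z (dart_fconnect Mp (fconnect_iter (step partner) k x)).
  have dz' : adj z.2 z.1 by rewrite adj_sym.
  by rewrite /step orbit_face_partner // -(orbit_face_flip dz).
have [fF _ _ _] := orbit_face_spec dx.
have [_ Fe _ Fc] := (let: And3 H _ _ := MF in H _ fF).
have S : face partner x \subset orbit_face r x.
  apply/subsetP=> e /imsetP[y]; rewrite -fconnect_orbit => xy ->.
  rewrite -(sub _ xy); have dy : dart y by rewrite (dart_fconnect Mp xy).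
  by case: (orbit_face_spec dy).
apply/eqP; apply: contraT => N; case: (Fc _ S _ N) => [|e [e' [eS]]].
  by apply/set0Pn; exists (ed x); apply: mem_face.
rewrite inE => /andP[neS /[dup] e'F /Fe /is_edgeP[y dy Ey]].
case/pred0Pn=> u /= /andP[ue]; rewrite Ey => /ed_at /(_ dy)[w' uw' E'].
have [z dz Ez] := is_edgeP _ (face_edge Mp dx eS).
move: ue; rewrite Ez => /ed_at /(_ dz)[w uw Ew].
have Fuw : face partner (u, w) = face partner x.
  by apply: mem_face_eq; rewrite // -Ew -Ez.
have fuw : orbit_face r (u, w) = orbit_face r x.
  by apply: orbit_face_eq => //; rewrite -Ew -Ez; apply: (subsetP S).
have [_ _ _ /(_ w')] := partner_spec uw; rewrite fuw -E' -Ey => /(_ e'F)[] ?; subst w'.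
  by move: neS; rewrite Ey E' -Ew -Ez eS.
by move: neS; rewrite Ey E' -Fuw; have /= -> := mem_face_step Mp (u, w).
Qed.

Lemma map_aut_orbit_face s x : map_aut adj F s -> dart x ->
  face_img s (orbit_face r x) = orbit_face r (dmap s x).
Proof.
move=> [Gs Fs] dx; have dsx : dart (dmap s x) by rewrite dart_dmap.
have [fF ef of_ _] := orbit_face_spec dx; have [_ _ _ u] := orbit_face_spec dsx; apply: u.
- by rewrite -Fs; apply: imset_f.
- by rewrite -edge_img_ed; apply: imset_f.
- apply: (orb_trans of_); apply/orbP; exists s; split=> //.
  by rewrite /flag_act /fv /fe /ff /= edge_img_ed.
Qed.

Lemma map_aut_comm s : map_aut adj F s -> comm s partner partner.
Proof.
move=> As v w vw; have [a n e _] := partner_spec vw.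
have svw : adj (s v) (s w) by rewrite graph_autE //; case: As.
have [_ _ _ /(_ (s (partner v w)))] := partner_spec svw.
rewrite -/(dmap s (v, w)) -map_aut_orbit_face // -[ed (_, _)](edge_img_ed s (v, partner v w)).
case; [exact: imset_f| | by []].
by move/perm_inj=> E; rewrite E eqxx in n.
Qed.

End OneColour.

Lemma orbit_face_cover x f : dart x -> f \in F -> ed x \in f ->
  f = orbit_face p x \/ f = orbit_face q x.
Proof.
move=> dx fF ef; have fl : is_flag F (x.1, ed x, f) by split=> //; exact: ed_l.
have [_ _ _ up] := orbit_face_spec (or_introl erefl) dx.
have [_ _ _ uq] := orbit_face_spec (or_intror erefl) dx.
by case: (Opq fl) => /orbP o; [left; apply: up | right; apply: uq].
Qed.

(** If both colours paired [w] with the same [w'], the edges to [w] and [w'] would be closed under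
    passing through a face at [v]; with the third neighbour from [degree_ge3] the link would be
    disconnected. *)
Lemma partner_neq v w : adj v w -> partner p v w != partner q v w.
Proof.
move=> vw; apply/eqP=> E; set w' := partner p v w in E.
have Hp := partner_spec (or_introl erefl : p = p \/ p = q).
have Hq := partner_spec (or_intror erefl : q = p \/ q = q).
have [aw' _ _ _] := Hp _ _ vw; rewrite -/w' in aw'.
have [w'' [vw'' n n']] := degree_ge3 v w w'.
have inN u : adj v u -> ed (v, u) \in [set e | is_edge adj e & v \in e].
  by move=> vu; rewrite inE (ed_l (v, u)) andbT; apply/is_edgeP; exists (v, u).
have edv u u' : ed (v, u) = ed (v, u') -> u = u'.
  by case/ed_inj=> [[]|[-> ->]].
case: MF => _ _ /(_ v [set ed (v, w); ed (v, w')]) [].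
- by apply/subsetP=> e; rewrite in_set2 => /orP[] /eqP->; apply: inN.
- by apply/set0Pn; exists (ed (v, w)); apply: set21.
- apply/eqP=> /setP/(_ (ed (v, w''))); rewrite (inN _ vw'') in_set2.
  by case/orP=> /eqP/edv H; [move: n | move: n']; rewrite H eqxx.
move=> e [e' [f [eS]]]; rewrite in_setD inE => /andP[eS' /andP[/is_edgeP[y dy Ey] ve']] fF ef ef'.
have [u' vu' Eu'] : exists2 u, adj v u & e' = ed (v, u).
  by move: ve'; rewrite Ey => /ed_at /(_ dy).
have [u Su Eu] : exists2 u, u = w \/ u = w' & e = ed (v, u).
  by move: eS; rewrite in_set2 => /orP[] /eqP->; [exists w|exists w']; auto.
have vu : adj v u by case: Su => ->.
have inv r : r = p \/ r = q -> involutive (partner r v).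
  by move=> /partner_matching[].
have S r : r = p \/ r = q -> partner r v w = w' -> partner r v u = w \/ partner r v u = w'.
  by move=> rpq E'; case: Su => ->; [right | left; rewrite -E' inv].
case/negP: eS'; rewrite in_set2 Eu'.
have fin : u' = w \/ u' = w' -> (ed (v, u') == ed (v, w)) || (ed (v, u') == ed (v, w')).
  by case=> ->; rewrite eqxx ?orbT.
rewrite Eu in ef; rewrite Eu' in ef'; apply: fin.
case: (orbit_face_cover (vu : dart (v, u)) fF ef) ef' => -> ef'.
  have [_ _ _ /(_ _ ef')[->|->]] := Hp _ _ vu => //.
  by apply: S; auto.
have [_ _ _ /(_ _ ef')[->|->]] := Hq _ _ vu => //.
by apply: S; auto.
Qed.

End FromClass2.

(** The matchings are the [partner] functions of the two orbits. An automorphism exchanging them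
    would preserve [F], hence each orbit and each matching, so [mA] and [mB] would agree on some
    dart. *)
Theorem class2_matchings F : class2_01 adj F -> exists mA mB,
  [/\ matching mA, matching mB, forall v w, adj v w -> mA v w != mB v w,
      F = faces mA :|: faces mB & dart_transitive mA mB /\
      forall s, graph_aut adj s -> comm s mA mB -> comm s mB mA -> False].
Proof.
move=> CF; have [MF [[p [q [fp fq Np Opq]]] _]] := CF.
have rp : p = p \/ p = q by left.
have rq : q = p \/ q = q by right.
exists (partner F p), (partner F q).
have Mp := partner_matching CF Np Opq rp; have Mq := partner_matching CF Np Opq rq.
have EF : F = faces (partner F p) :|: faces (partner F q).
  apply/setP=> f; rewrite in_setU; apply/idP/orP=> [fF|].
    have [/set0Pn[e ef] Fe _ _] := (let: And3 H _ _ := MF in H _ fF).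
    have /is_edgeP[x dx Ex] := Fe _ ef; rewrite Ex in ef.
    case: (orbit_face_cover CF Np Opq dx fF ef) => ->; [left|right]; apply/imsetP; exists x => //.
      by rewrite (face_partner CF Np Opq rp).
    by rewrite (face_partner CF Np Opq rq).
  case=> /imsetP[x dx ->].
    by rewrite (face_partner CF Np Opq rp) //; case: (orbit_face_spec CF Np Opq rp dx).
  by rewrite (face_partner CF Np Opq rq) //; case: (orbit_face_spec CF Np Opq rq dx).
have C s r : map_aut adj F s -> r = p \/ r = q -> comm s (partner F r) (partner F r).
  by move=> As rpq; apply: (map_aut_comm CF Np Opq rpq).
split=> //; first exact: (partner_neq CF Np Opq).
split.
  move=> x y dx dy.
  have [xF xx ox _] := orbit_face_spec CF Np Opq rp dx.
  have [yF yy oy _] := orbit_face_spec CF Np Opq rp dy.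
  have /orbP[s [As [E1 E2 _]]] := orb_trans (orb_sym ox) oy.
  exists s; split; [by case: As | exact: C | exact: C |].
  move: E2; rewrite /fe /= edge_img_ed => /ed_inj[]; rewrite /dmap // => E3.
  by case: y dy {yF yy oy} E1 E3 => a b d; rewrite /fv /= => E1 [E3 E4]; rewrite E4 -E3 E1.
move=> s Gs AB BA.
have As : map_aut adj F s.
  split=> //; rewrite {2}EF {1}EF /faces_img imsetU -!/(faces_img _ _).
  by rewrite (faces_img_faces Gs Mp AB) (faces_img_faces Gs Mq BA) setUC.
have [x dx] : exists x, dart x.
  case: fp => fF ef _; have [_ Fe _ _] := (let: And3 H _ _ := MF in H _ fF).
  by have /is_edgeP[x dx _] := Fe _ ef; exists x.
have dsx : adj (s x.1) (s x.2) by rewrite graph_autE.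
have := partner_neq CF Np Opq dsx.
by rewrite -(C s p As rp x.1 x.2 dx) -(AB x.1 x.2 dx) eqxx.
Qed.

Lemma commM s s' m : graph_aut adj s -> comm s m m -> comm s' m m -> comm (s * s')%g m m.
Proof. by move=> /graph_autE G C C' v w vw; rewrite !permM C // C' // G. Qed.

Lemma commV s m : graph_aut adj s -> comm s m m -> comm s^-1%g m m.
Proof.
move=> /graph_autE G C v w vw; apply: (perm_inj (s := s)).
by rewrite C ?permKV // -G !permKV.
Qed.

Lemma dart_transitive_base mA mB x0 :
  (forall y, dart y -> exists s,
     [/\ graph_aut adj s, comm s mA mA, comm s mB mB & (s x0.1, s x0.2) = y]) ->
  dart_transitive mA mB.
Proof.
move=> H x y /H[s [G CA CB <-]] /H[s' [G' CA' CB' <-]]; exists (s^-1 * s')%g.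
have GV := graph_autV G.
by split; [exact: graph_autM | apply: commM => //; exact: commV
  | apply: commM => //; exact: commV | rewrite !permM !permK].
Qed.

End Corners.

(** * Praeger-Xu graphs *)

Section PraegerXu.
Variables (V : finType) (adj : rel V) (N : nat).
Hypothesis N3 : 3 <= N.
Implicit Types (mk : nat -> bool -> bool -> V) (m : V -> V -> V) (u a b c z : bool).

(* [mk i a b] is the arc from [(i, a)] to [(i + 1, b)]; the level [i] ranges over the
   natural numbers, and going once around adds [u] to the second coordinate. *)
Definition PX u mk :=
  [/\ forall i a b, mk (i + N) a b = mk i (a (+) u) (b (+) u),
      forall v, exists i a b, v = mk i a b,
      forall i j a b a' b', mk i a b = mk j a' b' -> i = j %[mod N],
      forall i a b a' b', mk i a b = mk i a' b' -> a = a' /\ b = b'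
    & forall i a b v, adj (mk i.+1 a b) v <->
        (exists c, v = mk i.+2 b c) \/ (exists z, v = mk i z a)].

Section Coordinates.
Variables (u : bool) (mk : nat -> bool -> bool -> V).
Hypothesis P : PX u mk.

Lemma px_shiftn k i a b :
  mk (i + k * N) a b = mk i (a (+) (u && odd k)) (b (+) (u && odd k)).
Proof.
case: P => H1 _ _ _ _; elim: k a b => [|k IH] a b; first by rewrite addn0 andbF !addbF.
rewrite mulSn addnCA addnC H1 IH /=.
by case: (u) (odd k) a b => [] [] [] [].
Qed.

(** An even number of turns cancels the twist, so multiples of [2 * N] may be added freely, which
    replaces subtraction on natural-number levels. *)
Lemma px_even k i a b : mk (i + 2 * k * N) a b = mk i a b.
Proof. by rewrite px_shiftn oddM andbF !addbF. Qed.

Lemma px_mod i j a b a' b' : mk i a b = mk j a' b' -> i = j %[mod N].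
Proof. by case: P => _ _ H _ _; apply: H. Qed.

Lemma px_lev_neq d i a b a' b' : 0 < d < N -> mk i a b <> mk (i + d) a' b'.
Proof.
move=> /andP[d0 dN] /px_mod/eqP; rewrite -{1}[i]addn0 eqn_modDl mod0n modn_small //.
by rewrite eq_sym -leqn0 leqNgt d0.
Qed.

Lemma px_bits i a b a' b' : mk i a b = mk i a' b' -> a = a' /\ b = b'.
Proof. by case: P => _ _ _ H _; apply: H. Qed.

Lemma px_canon v : exists i a b, i < N /\ v = mk i.+1 a b.
Proof.
have [H1 H2 _ _ _] := P; have [i [a [b ->]]] := H2 v.
(* [(i + N).-1] stands for the level before [i], at the cost of one turn and hence of a translation
   by [u]. *)
pose j := (i + N).-1; exists (j %% N).
have -> : mk i a b = mk j.+1 (a (+) u) (b (+) u).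
  by rewrite -[j.+1]/((i + N).-1.+1) prednK ?H1; [case: (u) a b => [] [] [] | lia].
have -> : j.+1 = (j %% N).+1 + j %/ N * N by rewrite addSn addnC -divn_eq.
rewrite px_shiftn; by do 2!eexists; split; last reflexivity; rewrite ltn_mod; lia.
Qed.

Lemma px_adj_next i a b c : adj (mk i a b) (mk i.+1 b c).
Proof.
case: P => H1 _ _ _ H5.
have E a' b' : mk i a' b' = mk (i + N).-1.+1 (a' (+) u) (b' (+) u).
  by rewrite prednK ?H1; [case: (u) a' b' => [] [] [] | lia].
rewrite E; apply/H5; left; exists (c (+) u).
have -> : (i + N).-1.+2 = i.+1 + N by lia.
by rewrite H1; congr mk; case: (u) b c => [] [] [].
Qed.

Lemma px_adj_prev i a b z : adj (mk i.+1 a b) (mk i z a).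
Proof. by case: P => _ _ _ _ H5; apply/H5; right; exists z. Qed.

Lemma px_nbr i a b v : adj (mk i.+1 a b) v ->
  (exists c, v = mk i.+2 b c) \/ (exists z, v = mk i z a).
Proof. by case: P => _ _ _ _ H5 /H5. Qed.

Lemma px_dart v w : adj v w -> exists i a b,
  v = mk i.+1 a b /\ ((exists c, w = mk i.+2 b c) \/ (exists z, w = mk i z a)).
Proof.
have [i [a [b [_ ->]]]] := px_canon v.
by move=> /px_nbr H; exists i, a, b.
Qed.

Lemma px_sym : symmetric adj.
Proof.
suff H v w : adj v w -> adj w v by move=> v w; apply/idP/idP => /H.
move/px_dart=> [i [a [b [-> []]]]] [c ->]; first exact: px_adj_prev.
exact: px_adj_next.
Qed.

Lemma px_irr : irreflexive adj.
Proof.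
move=> v; apply/negP=> /px_dart[i [a [b [-> []]]]] [c]; last move=> /esym.
  by rewrite -[i.+2]addn1; apply: px_lev_neq; lia.
by rewrite -[i.+1]addn1; apply: px_lev_neq; lia.
Qed.

Lemma px_degree v w w' : exists w'', [/\ adj v w'', w'' != w & w'' != w'].
Proof.
have [i [a [b [_ ->]]]] := px_canon v.
have d01 c z : mk i.+2 b c != mk i z a.
  by apply/eqP=> /esym; rewrite -[i.+2]addn2; apply: px_lev_neq; lia.
have d00 : mk i.+2 b false != mk i.+2 b true by apply/eqP=> /px_bits[].
have n0 c := px_adj_next i.+1 a b c; have n1 := px_adj_prev i a b false.
have := d01 false false; have := d01 true false.
case: (eqVneq (mk i.+2 b false) w) (eqVneq (mk i.+2 b false) w') => [<-|N0] [E'|N0'] d1 d0;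
  last by exists (mk i.+2 b false).
- by exists (mk i.+2 b true); rewrite -E' n0 eq_sym d00.
- case: (eqVneq (mk i.+2 b true) w') d1 => [<- d1|N1 _].
    by exists (mk i false a); rewrite n1 eq_sym d0 eq_sym d1.
  by exists (mk i.+2 b true); rewrite n0 N1 eq_sym d00.
- case: (eqVneq (mk i.+2 b true) w) d1 => [<- d1|N1 _].
    by exists (mk i false a); rewrite n1 -E' eq_sym d1 eq_sym d0.
  by exists (mk i.+2 b true); rewrite -E' n0 N1 eq_sym d00.
Qed.

(** A vertex has one name for each turn. A value chosen for its name in the first turn serves all
    the others as soon as [Q] is compatible with one turn. *)
Lemma px_lift (T : Type) (Q : nat -> bool -> bool -> T -> Prop) :
  (forall i a b, exists t, Q i a b t) ->
  (forall i a b t, Q i (a (+) u) (b (+) u) t -> Q (i + N) a b t) ->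
  exists f : V -> T, forall i a b, Q i a b (f (mk i.+1 a b)).
Proof.
move=> ex per.
suff H v : exists t, forall i a b, v = mk i.+1 a b -> Q i a b t.
  have [f Hf] := fin_all_exists H; exists f => i a b; exact: Hf.
have [j [a [b [jN ->]]]] := px_canon v; have [t Qt] := ex j a b.
exists t => i a' b' E.
have Eij : i = j + (i %/ N) * N.
  have /eqP := px_mod E; rewrite -[j.+1]addn1 -[i.+1]addn1 eqn_modDr => /eqP.
  by rewrite [LHS]modn_small // => ->; rewrite addnC -divn_eq.
have pern k a1 b1 : Q j (a1 (+) (u && odd k)) (b1 (+) (u && odd k)) t ->
    Q (j + k * N) a1 b1 t.
  elim: k a1 b1 => [|k IH] a1 b1; first by rewrite addn0 andbF !addbF.
  have E2 x : x (+) u (+) (u && odd k) = x (+) (u && odd k.+1).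
    by rewrite /=; case: (u) x (odd k) => [] [] [].
  by move=> H; rewrite mulSn addnCA addnC; apply/per/IH; rewrite !E2.
rewrite Eij; apply: pern; move: E; rewrite {1}Eij -addSn px_shiftn.
by move=> /px_bits[<- <-].
Qed.

End Coordinates.

(** Adjacency obeys the same rule in every coordinate system, so exhibiting a second system with the
    same twist produces an automorphism. *)
Lemma px_iso u mk mk' : PX u mk -> PX u mk' ->
  exists s : {perm V}, graph_aut adj s /\ forall i a b, s (mk i a b) = mk' i a b.
Proof.
have lift mk1 mk2 : PX u mk1 -> PX u mk2 ->
    exists f : V -> V, forall i a b, f (mk1 i a b) = mk2 i a b.
  move=> P1 P2.
  have [||f Hf] := px_lift P1 (Q := fun i a b t => t = mk2 i.+1 a b).
  - by move=> i a b; eexists.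
  - by move=> i a b t ->; case: P2 => <- _ _ _ _; rewrite addSn.
  exists f => i a b; have := Hf (i + N).-1 (a (+) u) (b (+) u).
  rewrite prednK; last by lia.
  case: P1 => -> _ _ _ _; case: P2 => -> _ _ _ _.
  by case: (u) a b => [] [] [].
move=> P1 P2; have [f Hf] := lift _ _ P1 P2; have [f' Hf'] := lift _ _ P2 P1.
have fK : cancel f f'.
  by move=> v; have [i [a [b [_ ->]]]] := px_canon P1 v; rewrite Hf Hf'.
have fK' : cancel f' f.
  by move=> v; have [i [a [b [_ ->]]]] := px_canon P2 v; rewrite Hf' Hf.
have hom mk1 mk2 (h : V -> V) : PX u mk1 -> PX u mk2 ->
    (forall i a b, h (mk1 i a b) = mk2 i a b) -> forall v w, adj v w -> adj (h v) (h w).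
  move=> Q1 Q2 Hh v w /(px_dart Q1)[i [a [b [-> []]]]] [c ->]; rewrite !Hh.
    exact: px_adj_next Q2 _ _ _ _.
  exact: px_adj_prev Q2 _ _ _ _.
exists (perm (can_inj fK)); split=> [|i a b]; last by rewrite permE.
apply/forallP=> v; apply/forallP=> w; rewrite !permE; apply/eqP; apply/idP/idP.
  by move/(hom _ _ _ P2 P1 Hf'); rewrite !fK.
exact: hom P1 P2 Hf _ _.
Qed.

(* [tr] and [shift] translate the coordinates, [rv] reverses all arcs:
   [(2 * N).-1 * i.+1] stands for [- (i + 1)] modulo [2 * N]. *)
Definition tr (X : nat -> bool) mk i a b := mk i (a (+) X i) (b (+) X i.+1).
Definition shift k mk i : bool -> bool -> V := mk (k + i).
Definition rv mk i a b : V := mk ((2 * N).-1 * i.+1) b a.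

Lemma PX_tr u (w : bool) X mk :
  (forall i, X (i + N) = X i (+) w) -> PX u mk -> PX (u (+) w) (tr X mk).
Proof.
move=> HX P; have [H1 H2 H3 H4 H5] := P; split; rewrite /tr.
- move=> i a b; rewrite HX -addSn HX H1.
  by congr mk; case: (u) (w) (X i) (X i.+1) a b => [] [] [] [] [] [].
- move=> v; have [i [a [b ->]]] := H2 v; exists i, (a (+) X i), (b (+) X i.+1).
  by rewrite !addbK.
- by move=> i j a b a' b' /H3.
- by move=> i a b a' b' /H4[/addIb -> /addIb ->].
- move=> i a b v; split.
    case/H5=> -[c ->]; [left; exists (c (+) X i.+3)|right; exists (c (+) X i)];
    by rewrite addbK.
  by case=> -[c ->]; apply/H5; [left|right]; eexists.
Qed.

Lemma PX_shift u k mk : PX u mk -> PX u (shift k mk).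
Proof.
move=> P; have [H1 H2 H3 H4 H5] := P; split; rewrite /shift.
- by move=> i a b; rewrite addnA H1.
- move=> v; have [i [a [b ->]]] := H2 v; exists (i + 2 * k * N - k), a, b.
  by rewrite subnKC ?(px_even P) //; nia.
- by move=> i j a b a' b' /H3/eqP; rewrite eqn_modDl => /eqP.
- by move=> i a b a' b' /H4.
- by move=> i a b v; rewrite !addnS; apply: H5.
Qed.

Lemma PX_rv u mk : PX u mk -> PX u (rv mk).
Proof.
move=> P; have [H1 H2 H3 H4 H5] := P; split; rewrite /rv.
- move=> i a b; have -> : (2 * N).-1 * (i + N).+1 = (2 * N).-1 * i.+1 + (2 * N).-1 * N.
    by rewrite -mulnDr addSn.
  rewrite (px_shiftn P); have -> : odd (2 * N).-1 by lia.
  by rewrite andbT.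
- move=> v; have [i [a [b [_ ->]]]] := px_canon P v.
  exists ((2 * N).-1 * i.+1).-1, b, a; rewrite prednK; last by nia.
  have -> : (2 * N).-1 * ((2 * N).-1 * i.+1) = i.+1 + 2 * (2 * N.-1 * i.+1) * N.
    by case: N N3 => // n _; rewrite /=; nia.
  by rewrite (px_even P).
- move=> i j a b a' b' /H3/eqP; rewrite -(eqn_modDr (i.+1 + j.+1)).
  have -> : (2 * N).-1 * i.+1 + (i.+1 + j.+1) = (2 * i.+1) * N + j.+1 by nia.
  have -> : (2 * N).-1 * j.+1 + (i.+1 + j.+1) = (2 * j.+1) * N + i.+1 by nia.
  by rewrite !modnMDl -(addn1 j) -(addn1 i) eqn_modDr => /eqP.
- by move=> i a b a' b' /H4[].
- move=> i a b v.
  set k := ((2 * N).-1 * i.+2).-1.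
  have -> : (2 * N).-1 * i.+2 = k.+1 by rewrite prednK //; nia.
  have E1 c : mk ((2 * N).-1 * i.+3) c b = mk k c b.
    by rewrite -[RHS](px_even P 1); congr mk; rewrite /k; nia.
  have E2 z : mk ((2 * N).-1 * i.+1) a z = mk k.+2 a z.
    by rewrite -[LHS](px_even P 1); congr mk; rewrite /k; nia.
  rewrite H5; split; case=> -[c ->]; [right | left | right | left]; exists c;
    by rewrite ?E1 ?E2.
Qed.

(* The straight walk through (i, a0), (i+1, a1), (i+2, a2) goes on to (i+3, a0 + g i a1 a2). *)
Definition gstraight (g : nat -> bool -> bool -> bool) mk m := forall i a b c,
  m (mk i.+1 a b) (mk i.+2 b c) = mk i (c (+) g i a b) a /\
  m (mk i.+1 a b) (mk i c a) = mk i.+2 b (c (+) g i a b).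

Definition gturn mk m := forall i a b c,
  m (mk i.+1 a b) (mk i.+2 b c) = mk i.+2 b (~~ c) /\
  m (mk i.+1 a b) (mk i c a) = mk i (~~ c) a.

Lemma gstraight_ext g g' mk m : (forall i a b, g i a b = g' i a b) ->
  gstraight g mk m -> gstraight g' mk m.
Proof. by move=> E H i a b c; rewrite -!E; apply: H. Qed.

(** The added term [X i (+) X i.+3] later serves to remove inhomogeneities from the recurrence. *)
Lemma gstraight_tr X g mk m : gstraight g mk m ->
  gstraight (fun i a b => g i (a (+) X i.+1) (b (+) X i.+2) (+) X i (+) X i.+3)
    (tr X mk) m.
Proof.
move=> H i a b c; rewrite /tr.
have [-> _] := H i (a (+) X i.+1) (b (+) X i.+2) (c (+) X i.+3).
have [_ ->] := H i (a (+) X i.+1) (b (+) X i.+2) (c (+) X i).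
by split; congr mk; case: (g _ _ _) (X i) (X i.+3) c => [] [] [] [].
Qed.

Lemma gstraight_shift k g mk m : gstraight g mk m ->
  gstraight (fun i => g (k + i)) (shift k mk) m.
Proof. by move=> H i a b c; rewrite /shift !addnS; apply: H. Qed.

(** The equation x_i + x_{i+3} = g_i(x_{i+1}, x_{i+2}) reads the same backwards, with the arguments
    of g_i exchanged. *)
Lemma gstraight_rv u g mk m : PX u mk -> gstraight g mk m ->
  gstraight (fun i a b => g ((2 * N).-1 * i.+3) b a) (rv mk) m.
Proof.
move=> P H i a b c; rewrite /rv; set k := (_ * i.+3).
have -> : mk ((2 * N).-1 * i.+2) b a = mk k.+1 b a.
  by rewrite -[LHS](px_even P 1); congr mk; rewrite /k; nia.
have E c' : mk ((2 * N).-1 * i.+1) a c' = mk k.+2 a c'.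
  by rewrite -[LHS](px_even P 2); congr mk; rewrite /k; nia.
by rewrite !E; have [-> ->] := H k b a c.
Qed.

Lemma gturn_tr X mk m : gturn mk m -> gturn (tr X mk) m.
Proof.
move=> H i a b c; rewrite /tr.
have [-> _] := H i (a (+) X i.+1) (b (+) X i.+2) (c (+) X i.+3).
have [_ ->] := H i (a (+) X i.+1) (b (+) X i.+2) (c (+) X i).
by split; congr mk; case: (X i) (X i.+3) c => [] [] [].
Qed.

Lemma gturn_shift k mk m : gturn mk m -> gturn (shift k mk) m.
Proof. by move=> H i a b c; rewrite /shift !addnS; apply: H. Qed.

Lemma gturn_rv u mk m : PX u mk -> gturn mk m -> gturn (rv mk) m.
Proof.
move=> P H i a b c; rewrite /rv; set k := (_ * i.+3).
have -> : mk ((2 * N).-1 * i.+2) b a = mk k.+1 b a.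
  by rewrite -[LHS](px_even P 1); congr mk; rewrite /k; nia.
have E c' : mk ((2 * N).-1 * i.+1) a c' = mk k.+2 a c'.
  by rewrite -[LHS](px_even P 2); congr mk; rewrite /k; nia.
by rewrite !E; have [-> ->] := H k b a c.
Qed.

Lemma gstraight_uniq u g g' mk m : PX u mk -> gstraight g mk m -> gstraight g' mk m ->
  forall i a b, g i a b = g' i a b.
Proof.
move=> P H H' i a b; have [E _] := H i a b false; have [E' _] := H' i a b false.
by move: E; rewrite E' => /(px_bits P)[].
Qed.

Lemma gstraight_comm u g mk mk' m m' (s : {perm V}) : PX u mk ->
  (forall i a b, s (mk i a b) = mk' i a b) ->
  gstraight g mk m -> gstraight g mk' m' -> comm adj s m m'.
Proof.
move=> P E H H' v w /(px_dart P)[i [a [b [-> []]]]] [c ->]; rewrite !E.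
  by rewrite !(H _ _ _ _).1 E !(H' _ _ _ _).1.
by rewrite !(H _ _ _ _).2 E !(H' _ _ _ _).2.
Qed.

Lemma gturn_comm u mk mk' m m' (s : {perm V}) : PX u mk ->
  (forall i a b, s (mk i a b) = mk' i a b) ->
  gturn mk m -> gturn mk' m' -> comm adj s m m'.
Proof.
move=> P E H H' v w /(px_dart P)[i [a [b [-> []]]]] [c ->]; rewrite !E.
  by rewrite !(H _ _ _ _).1 E !(H' _ _ _ _).1.
by rewrite !(H _ _ _ _).2 E !(H' _ _ _ _).2.
Qed.

Lemma gstraight_push u g mk m m' (s : {perm V}) : PX u mk -> comm adj s m m' ->
  gstraight g mk m -> gstraight g (fun i a b => s (mk i a b)) m'.
Proof.
move=> P C H i a b c; rewrite -!C; [|exact: px_adj_prev P _ _ _ _|exact: px_adj_next P _ _ _ _].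
by have [-> ->] := H i a b c.
Qed.

Lemma PX_push u mk (s : {perm V}) : graph_aut adj s -> PX u mk ->
  PX u (fun i a b => s (mk i a b)).
Proof.
move=> /graph_autE G [H1 H2 H3 H4 H5]; split.
- by move=> i a b; rewrite H1.
- move=> v; have [i [a [b E]]] := H2 (s^-1%g v).
  by exists i, a, b; rewrite -E permKV.
- by move=> i j a b a' b' /perm_inj/H3.
- by move=> i a b a' b' /perm_inj/H4.
- move=> i a b v; rewrite -{1}[v](permKV s) G H5.
  by split=> -[] [c E]; [left|right|left|right]; exists c; rewrite ?E ?permK // -E permKV.
Qed.

Lemma involution_swap (x y x' y' : V) :
  x != y -> x != x' -> x != y' -> y != x' -> y != y' -> x' != y' ->
  exists t : V -> V, [/\ involutive t, t x = x', t y = y', t x' = x & t y' = y].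
Proof.
move=> xy xx' xy' yx' yy' x'y'; pose t := (tperm x x' * tperm y y')%g.
have T1 : t x = x' by rewrite /t permM tpermL tpermD // 1?eq_sym.
have T2 : t y = y' by rewrite /t permM [tperm x x' y]tpermD ?tpermL // 1?eq_sym.
have T3 : t x' = x by rewrite /t permM tpermR tpermD // 1?eq_sym.
have T4 : t y' = y by rewrite /t permM [tperm x x' y']tpermD ?tpermR // 1?eq_sym.
exists t; split=> // v.
have [->|vx] := eqVneq v x; first by rewrite T1 T3.
have [->|vy] := eqVneq v y; first by rewrite T2 T4.
have [->|vx'] := eqVneq v x'; first by rewrite T3 T1.
have [->|vy'] := eqVneq v y'; first by rewrite T4 T2.
by have T5 : t v = v; [rewrite /t permM [tperm x x' v]tpermD ?tpermD // eq_sym | rewrite !T5].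
Qed.

(** The normal forms x_{i+3} = x_i + be (x_{i+1} + x_{i+2}) + ka. A single matching is brought to
    [ka = false]; [ka = true] then describes a second straight matching in the same coordinates. *)
Definition straight be ka := gstraight (fun _ a b => (be && (a (+) b)) (+) ka).

(** * Existence of turning and straight matchings *)

Section Existence.
Variables (u : bool) (mk : nat -> bool -> bool -> V).
Hypothesis P : PX u mk.

Lemma px_fb i b c z a : mk i.+2 b c != mk i z a.
Proof. by apply/eqP=> /esym; rewrite -[i.+2]addn2; apply: px_lev_neq P _ _ _ _ _ _ _; lia. Qed.

Lemma ex_matching (Q : nat -> bool -> bool -> (V -> V) -> Prop) :
  (forall i a b, exists t, [/\ involutive t, Q i a b t
     & forall v, adj (mk i.+1 a b) v -> adj (mk i.+1 a b) (t v) /\ t v != v]) ->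
  (forall i a b t, Q i (a (+) u) (b (+) u) t -> Q (i + N) a b t) ->
  exists m, matching adj m /\ forall i a b, Q i a b (m (mk i.+1 a b)).
Proof.
move=> ex per.
have [||m Hm] := px_lift P (Q := fun i a b t => [/\ involutive t, Q i a b t &
    forall v, adj (mk i.+1 a b) v -> adj (mk i.+1 a b) (t v) /\ t v != v]).
- by move=> i a b; have [t [? ? ?]] := ex i a b; exists t.
- move=> i a b t [It Qt Ht]; split=> //; first exact: per.
  by have [H1 _ _ _ _] := P; rewrite -addSn H1.
exists m; split=> [|i a b]; last by have [] := Hm i a b.
split=> [v|v w|v w].
- by have [i [a [b [_ ->]]]] := px_canon P v; have [] := Hm i a b.
- have [i [a [b [_ ->]]]] := px_canon P v; have [It _ Ht] := Hm i a b.
  by apply/idP/idP=> /Ht[] //; rewrite It.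
- by have [i [a [b [_ ->]]]] := px_canon P v; have [_ _ Ht] := Hm i a b; case/Ht.
Qed.

Lemma ex_straight be ka : exists m, matching adj m /\ straight be ka mk m.
Proof.
pose g a b := (be && (a (+) b)) (+) ka.
have [||m [Mm Hm]] := @ex_matching (fun i a b t => forall c,
    t (mk i.+2 b c) = mk i (c (+) g a b) a /\ t (mk i c a) = mk i.+2 b (c (+) g a b)).
- move=> i a b.
  have [|||||| t [It T1 T2 T3 T4]] := @involution_swap (mk i.+2 b false) (mk i.+2 b true)
      (mk i (g a b) a) (mk i (~~ g a b) a); rewrite ?px_fb //.
  + by apply/eqP=> /(px_bits P)[].
  + by apply/eqP=> /(px_bits P)[]; case: (g a b).
  have F c : t (mk i.+2 b c) = mk i (c (+) g a b) a by case: c.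
  have B c : t (mk i c a) = mk i.+2 b (c (+) g a b).
    by move: T3 T4; case: (g a b); case: c.
  exists t; split=> // v /(px_nbr P)[] [c ->]; rewrite ?F ?B.
    by rewrite (px_adj_prev P) // eq_sym px_fb.
  by rewrite (px_adj_next P) // px_fb.
- move=> i a b t H c; have [H1 _ _ _ _] := P.
  have := H (c (+) u); rewrite -!addSn !H1 => -[-> ->].
  have -> : g (a (+) u) (b (+) u) = g a b by rewrite /g; move: (u) (a) (b) => [] [] [].
  by split; congr mk; case: (u) c (g a b) => [] [] [].
by exists m; split=> // i a b c; have [-> ->] := Hm i a b c.
Qed.

Lemma ex_turn : exists m, matching adj m /\ gturn mk m.
Proof.
have [||m [Mm Hm]] := @ex_matching (fun i a b t => forall c,
    t (mk i.+2 b c) = mk i.+2 b (~~ c) /\ t (mk i c a) = mk i (~~ c) a).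
- move=> i a b.
  have [|||||| t [It T1 T2 T3 T4]] := @involution_swap (mk i.+2 b false) (mk i false a)
      (mk i.+2 b true) (mk i true a); rewrite ?px_fb // 1?eq_sym ?px_fb //.
  + by apply/eqP=> /(px_bits P)[].
  + by apply/eqP=> /(px_bits P)[].
  have F c : t (mk i.+2 b c) = mk i.+2 b (~~ c) by case: c.
  have B c : t (mk i c a) = mk i (~~ c) a by case: c.
  exists t; split=> // v /(px_nbr P)[] [c ->]; rewrite ?F ?B.
    by rewrite (px_adj_next P) //; split=> //; apply/eqP=> /(px_bits P)[_]; case: c.
  by rewrite (px_adj_prev P) //; split=> //; apply/eqP=> /(px_bits P)[]; case: c.
- move=> i a b t H c; have [H1 _ _ _ _] := P.
  have := H (c (+) u); rewrite -!addSn !H1 => -[-> ->].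
  by split; congr mk; case: (u) c => [] [].
by exists m; split=> // i a b c; have [-> ->] := Hm i a b c.
Qed.

End Existence.

Definition recur be (Z : nat -> bool) :=
  forall i, Z i.+3 = Z i (+) (be && (Z i.+1 (+) Z i.+2)).

(** Periods of the two shift registers over F_2: x^3 + 1 gives 3, and x^3 + x^2 + x + 1 = (x + 1)^3
    divides (x + 1)^4 = x^4 + 1, which gives 4. *)
Definition period be := if be then 4 else 3.

Lemma recur_period be Z i : recur be Z -> period be %| N -> Z (i + N) = Z i.
Proof.
move=> R /dvdnP[k ->]; elim: k i => [|k IH] i; first by rewrite mul0n addn0.
rewrite mulSn addnA IH {IH}; case: be R => R; rewrite /period.
  rewrite !addnS addn0 2!R /=.
  by case: (Z i) (Z i.+1) (Z i.+2) (Z i.+3) => [] [] [] [].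
by rewrite !addnS addn0 R /= addbF.
Qed.

Lemma ex_recur be x y z : exists Z, [/\ recur be Z, Z 0 = x, Z 1 = y & Z 2 = z].
Proof.
pose st (p : bool * bool * bool) := (p.1.2, p.2, p.1.1 (+) (be && (p.1.2 (+) p.2))).
by exists (fun i => (iter i st (x, y, z)).1.1).
Qed.

(** * Faces of straight matchings *)

Section StraightFaces.
Variables (u be : bool) (mk : nat -> bool -> bool -> V) (m : V -> V -> V).
Hypotheses (P : PX u mk) (Mm : matching adj m) (Sm : straight be false mk m).
Hypothesis perN : period be %| N.

Lemma iter_straight Z i k : recur be Z ->
  iter k (step m) (mk i.+1 (Z 0) (Z 1), mk i.+2 (Z 1) (Z 2)) =
  (mk (i + k).+1 (Z k) (Z k.+1), mk (i + k).+2 (Z k.+1) (Z k.+2)).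
Proof.
move=> R; elim: k => [|k IH]; first by rewrite addn0.
rewrite iterS IH /step /= !addnS; congr (_, _).
by have [_ ->] := Sm (i + k).+1 (Z k.+1) (Z k.+2) (Z k); rewrite addbF -R.
Qed.

(** The level forces [k] to be a multiple of [N], and [Z] has period [N]; only the twist can prevent
    the return, so [u] times the number of turns is even. The next vertex then agrees too, which
    yields simplicity. *)
Lemma straight_return Z i k : recur be Z ->
  mk (i + k).+1 (Z k) (Z k.+1) = mk i.+1 (Z 0) (Z 1) ->
  exists q, [/\ k = q * N, u && odd q = false &
    mk (i + k).+2 (Z k.+1) (Z k.+2) = mk i.+2 (Z 1) (Z 2)].
Proof.
move=> R E; have /dvdnP[q kE] : N %| k.
  have /eqP := px_mod P E; rewrite -addSn -[X in _ == X %[mod _]]addn0 eqn_modDl.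
  by rewrite mod0n.
have Zq j l : Z (l + j * N) = Z l.
  elim: j l => [|j IH] l; first by rewrite addn0.
  by rewrite mulSn addnA IH (recur_period _ R).
have Z0 : Z k = Z 0 by rewrite kE -[q * N]add0n Zq.
have Z1 : Z k.+1 = Z 1 by rewrite kE -add1n Zq.
have Z2 : Z k.+2 = Z 2 by rewrite kE -add2n Zq.
exists q; move: E; rewrite Z0 Z1 Z2 -!addSn kE !(px_shiftn P) => /(px_bits P)[].
by case: (u && odd q) (Z 0) (Z 1) => [] [] [] // _ _; rewrite !addbF.
Qed.

Lemma px_forward v w : adj v w ->
  (exists Z i, recur be Z /\ (v, w) = (mk i.+1 (Z 0) (Z 1), mk i.+2 (Z 1) (Z 2))) \/
  (exists Z i, recur be Z /\ (w, v) = (mk i.+1 (Z 0) (Z 1), mk i.+2 (Z 1) (Z 2))).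
Proof.
move=> /(px_dart P)[i [a [b [-> []]]]] [c ->].
  by left; have [Z [R <- <- <-]] := ex_recur be a b c; exists Z, i.
right; have [Z [R E0 E1 E2]] := ex_recur be (c (+) u) (a (+) u) (b (+) u).
exists Z, (i + N).-1; split=> //; rewrite E0 E1 E2.
have [H1 _ _ _ _] := P.
have -> : (i + N).-1.+2 = i.+1 + N by lia.
have -> : (i + N).-1.+1 = i + N by lia.
by rewrite !H1 -!addbA addbb !addbF.
Qed.

Lemma straight_simple : simple adj m.
Proof.
have fwd Z i y : recur be Z ->
    let x := (mk i.+1 (Z 0) (Z 1), mk i.+2 (Z 1) (Z 2)) in
    fconnect (step m) x y -> y.1 = x.1 -> y = x.
  move=> R x /iter_findex <-; rewrite iter_straight //= => E.
  by have [q [_ _ ->]] := straight_return R E; rewrite E.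
move=> [v w] y vw xy E; case: (px_forward vw) => -[Z [i [R Ex]]].
  by move: xy E; rewrite Ex; apply: fwd.
have xy' := fconnect_flip Mm xy; rewrite /flip /= Ex in xy'.
(* Flipping turns equal sources into equal targets. One further step makes these targets sources
   again, and the shifted solution [Z'] describes the walk from there. *)
pose Z' k := Z k.+1; have R' : recur be Z' by move=> k; apply: R.
have Es : step m (w, v) = (mk i.+2 (Z' 0) (Z' 1), mk i.+3 (Z' 1) (Z' 2)).
  by rewrite Ex -[LHS]/(iter 1 _ _) iter_straight // addn1.
suff : step m (flip y) = step m (w, v).
  by move/(step_inj Mm); case: (y) => ? ? [-> ->].
rewrite Es; apply: (fwd Z' i.+1 _ R'); rewrite -Es; last first.
  by case: Ex => _ Ev; rewrite /= E.
rewrite -(same_fconnect1 (step_inj Mm)) [(w, v)]Ex.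
exact: connect_trans xy' (fconnect1 _ _).
Qed.

Lemma order_eq (T : finType) (f : T -> T) x L : injective f -> 0 < L -> iter L f x = x ->
  (forall k, 0 < k < L -> iter k f x != x) -> fingraph.order f x = L.
Proof.
move=> If L0 EL H; apply/eqP; rewrite eqn_leq; apply/andP; split; rewrite leqNgt.
  by apply/negP=> /findex_iter; rewrite EL findex0 => E; rewrite -E in L0.
apply/negP=> lt; have := H (fingraph.order f x).
by rewrite fingraph.order_gt0 lt iter_order // eqxx => /(_ isT).
Qed.

Lemma straight_card x : dart adj x -> #|face m x| = if u then 2 * N else N.
Proof.
have sym := px_sym P; have irr := px_irr P.
have fwd Z i : recur be Z ->
    let x := (mk i.+1 (Z 0) (Z 1), mk i.+2 (Z 1) (Z 2)) in
    #|face m x| = if u then 2 * N else N.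
  move=> R y; have dy : dart adj y by exact: px_adj_next P _ _ _ _.
  rewrite (card_face sym Mm straight_simple dy); apply: order_eq.
  - exact: step_inj Mm.
  - by case: (u); lia.
  - set L := (if u then _ else _); have ZN k : Z (k + N) = Z k by apply: recur_period.
    have ZL k : Z (k + L) = Z k.
      by rewrite /L; case: (u); rewrite // mul2n -addnn addnA !ZN.
    have mkL k a b : mk (k + L) a b = mk k a b.
      rewrite /L; case Eu : u; first by rewrite -[2]/(2 * 1) (px_even P).
      by have [H1 _ _ _ _] := P; rewrite H1 Eu !addbF.
    rewrite iter_straight // -!addSn !mkL.
    have Z0 : Z L = Z 0 by rewrite -(ZL 0).
    by rewrite -[L.+1]add1n -[L.+2]add2n !ZL Z0.
  - move=> k /andP[k0 kL]; apply/eqP; rewrite iter_straight // => -[E _].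
    have [q [kE uq _]] := straight_return R E.
    by move: kL uq k0; rewrite kE; case: (u) => /=; case: q {kE} => [|[|q]] //; nia.
case: x => v w /[dup] vw /px_forward[] [Z [i [R E]]]; first by rewrite E fwd.
by rewrite -(face_flip Mm) /flip /= E fwd.
Qed.

End StraightFaces.

(** * Faces of turning matchings *)

Section TurnFaces.
Variables (u : bool) (mk : nat -> bool -> bool -> V) (m : V -> V -> V).
Hypotheses (P : PX u mk) (Mm : matching adj m) (Tm : gturn mk m).

Lemma turn_iter i a b c : let x := (mk i.+1 a b, mk i.+2 b c) in
  [/\ step m x = (mk i.+2 b c, mk i.+1 (~~ a) b),
      iter 2 (step m) x = (mk i.+1 (~~ a) b, mk i.+2 b (~~ c)),
      iter 3 (step m) x = (mk i.+2 b (~~ c), mk i.+1 a b) & iter 4 (step m) x = x].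
Proof.
have F i' a' b' c' := (Tm i' a' b' c').1; have B i' a' b' c' := (Tm i' a' b' c').2.
by rewrite /= /step /= !(F, B, negbK).
Qed.

Lemma turn_orbit i a b c k : let x := (mk i.+1 a b, mk i.+2 b c) in
  (iter k (step m) x).1 = x.1 -> k = 0 %[mod 4].
Proof.
move=> x; have [E1 E2 E3 E4] := turn_iter i a b c.
have -> : iter k (step m) x = iter (k %% 4) (step m) x.
  rewrite {1}(divn_eq k 4) addnC iterD iterM; congr iter.
  by elim: (k %/ 4) => // j IH; rewrite iterS IH; exact: E4.
have fb a' b' c' : mk i.+2 b' c' <> mk i.+1 a b.
  by move/esym; rewrite -[i.+2]addn1; apply: px_lev_neq P _ _ _ _ _ _ _; lia.
have : k %% 4 < 4 by rewrite ltn_mod.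
case: (k %% 4) => [|[|[|[|]]]] // _; rewrite -/x in E1 E2 E3 E4.
- by rewrite -[iter 1 _ _]/(step m x) E1 => /fb.
- by rewrite E2 => /(px_bits P)[]; case: (a).
- by rewrite E3 => /fb.
Qed.

Lemma turn_start x : dart adj x -> exists i a b c r,
  r < 2 /\ x = iter r (step m) (mk i.+1 a b, mk i.+2 b c).
Proof.
case: x => v w; rewrite /dart /= => /(px_dart P)[i [a [b [-> []]]]] [c ->].
  by exists i, a, b, c, 0.
(* A backward dart is the second dart of the 4-cycle that starts from the vertex [mk i (~~ c) a];
   the translations by [u] pay for the extra turn. *)
exists (i + N).-1, (~~ c (+) u), (a (+) u), (b (+) u), 1; split=> //.
have [E1 _ _ _] := turn_iter (i + N).-1 (~~ c (+) u) (a (+) u) (b (+) u).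
rewrite [iter 1 _ _]E1; have [H1 _ _ _ _] := P.
have -> : (i + N).-1.+2 = i.+1 + N by lia.
have -> : (i + N).-1.+1 = i + N by lia.
by rewrite !H1; congr (mk _ _ _, mk _ _ _); case: (u) (a) (b) (c) => [] [] [] [].
Qed.

Lemma turn_simple : simple adj m.
Proof.
move=> x y /turn_start[i [a [b [c [r [r2 ->]]]]]]; set x0 := (_, _).
move=> /iter_findex <-; move: (findex _ _ _) => l; rewrite -iterD.
have [E1 E2 E3 E4] := turn_iter i a b c; rewrite -/x0 in E1 E2 E3 E4.
have red k : iter k (step m) x0 = iter (k %% 4) (step m) x0.
  rewrite {1}(divn_eq k 4) addnC iterD iterM; congr iter.
  by elim: (k %/ 4) => // j IH; rewrite iterS IH; exact: E4.
case: r r2 => [|[|//]] _.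
  by rewrite addn0 => /(@turn_orbit i a b c) E; rewrite (red l) E.
rewrite addn1 (red l.+1).
have : l.+1 %% 4 < 4 by rewrite ltn_mod.
case: (l.+1 %% 4) => [|[|[|[|]]]] // _; rewrite [iter 1 (step m) x0]E1.
- by rewrite /= -[i.+2]addn1 => /(px_lev_neq P); case; lia.
- by rewrite E2 /= -[i.+2]addn1 => /(px_lev_neq P); case; lia.
- by rewrite E3 => /(px_bits P)[_]; case: (c).
Qed.

Lemma turn_card x : dart adj x -> #|face m x| = 4.
Proof.
have sym := px_sym P; have irr := px_irr P.
move=> /[dup] dx /turn_start[i [a [b [c [r [r2 E]]]]]].
rewrite E (face_eq Mm (fconnect_iter _ _ _)).
rewrite (card_face sym Mm turn_simple); last exact: px_adj_next P _ _ _ _.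
apply: order_eq; [exact: step_inj Mm | by [] | by case: (turn_iter i a b c) |].
move=> k /andP[k0 k4]; apply/eqP=> E'.
have := @turn_orbit i a b c k (congr1 fst E').
by rewrite modn_small // => k00; rewrite k00 in k0.
Qed.

End TurnFaces.

(** * Dart-transitivity from changes of coordinates *)

Section DartTransitive.
Variables (u be : bool) (mA mB : V -> V -> V) (G : (nat -> bool -> bool -> V) -> Prop).
Hypotheses (GP : forall mk, G mk -> PX u mk)
  (Gshift : forall k mk, G mk -> G (shift k mk))
  (Grv : forall mk, G mk -> G (rv mk))
  (Gtr : forall Z mk, recur be Z -> G mk -> G (tr Z mk))
  (Gcomm : forall mk mk' (s : {perm V}), G mk -> G mk' ->
     (forall i a b, s (mk i a b) = mk' i a b) -> comm adj s mA mA /\ comm adj s mB mB).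

(** [G] collects coordinate systems in which both matchings keep their formulas. From the base dart,
    a shift reaches any level, [rv] the backward darts, and a solution of the recurrence with three
    prescribed initial values any bits. *)
Lemma px_dart_transitive mk : G mk -> dart_transitive adj mA mB.
Proof.
move=> G0; have P := GP G0.
apply: (dart_transitive_base (x0 := (mk 0 false false, mk 1 false false))) => y dy.
have [mk1 [i [a [b [c [G1 ->]]]]]] : exists mk1 i a b c,
    G mk1 /\ y = (mk1 i a b, mk1 i.+1 b c).
  case: y dy => v w; rewrite /dart /= => /(px_dart P)[i [a [b [-> []]]]] [c ->].
    by exists mk, i.+1, a, b, c.
  exists (rv mk), ((2 * N).-1 * i.+1).-1, b, a, c; split; first exact: Grv.
  rewrite /rv prednK; last by nia.
  have E1 : (2 * N).-1 * ((2 * N).-1 * i.+1) = i.+1 + 2 * (2 * N.-1 * i.+1) * N.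
    by case: N N3 => // n _; rewrite /=; nia.
  have E2 : (2 * N).-1 * ((2 * N).-1 * i.+1).+1 = i + 2 * (2 * N.-1 * i.+1 + 1) * N.
    by rewrite mulnS E1; lia.
  by rewrite E1 E2 !(px_even P).
have [Z [R <- <- <-]] := ex_recur be a b c.
have G2 : G (tr Z (shift i mk1)) by apply/Gtr/Gshift.
have [s [Gs Es]] := px_iso P (GP G2).
have [CA CB] := Gcomm G0 G2 Es.
by exists s; split; rewrite //= !Es /tr /shift addn0 addn1.
Qed.

End DartTransitive.

Lemma straight_tr be ka Z mk m : recur be Z -> straight be ka mk m ->
  straight be ka (tr Z mk) m.
Proof.
move=> R /(gstraight_tr Z); apply: gstraight_ext => i a b; rewrite R.
by case: be ka a b (Z i) (Z i.+1) (Z i.+2) {R} => [] [] [] [] [] [] [].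
Qed.

Lemma straight_shift be ka k mk m : straight be ka mk m -> straight be ka (shift k mk) m.
Proof. exact: gstraight_shift. Qed.

Lemma straight_rv u be ka mk m : PX u mk -> straight be ka mk m -> straight be ka (rv mk) m.
Proof. by move=> P /(gstraight_rv P); apply: gstraight_ext => i a b; rewrite [b (+) a]addbC. Qed.

Lemma PX_tr_recur u be Z mk : period be %| N -> recur be Z -> PX u mk -> PX u (tr Z mk).
Proof.
move=> pN R P; rewrite -[u]addbF; apply: PX_tr P => i.
by rewrite addbF (recur_period _ R).
Qed.

(** * The two types of maps *)

Definition turn_type u be mk mA mB :=
  [/\ PX u mk, gturn mk mA & straight be false mk mB].

Definition straight_type u be ka mk mA mB :=
  [/\ PX u mk, straight be false mk mA & straight be ka mk mB].

Lemma turn_type_comm u be mk mk' mA mB mA' mB' (s : {perm V}) :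
  turn_type u be mk mA mB -> turn_type u be mk' mA' mB' ->
  (forall i a b, s (mk i a b) = mk' i a b) -> comm adj s mA mA' /\ comm adj s mB mB'.
Proof.
by move=> [P T S] [P' T' S'] E; split;
  [apply: gturn_comm P E T T' | apply: gstraight_comm P E S S'].
Qed.

Lemma straight_type_comm u be ka mk mk' mA mB mA' mB' (s : {perm V}) :
  straight_type u be ka mk mA mB -> straight_type u be ka mk' mA' mB' ->
  (forall i a b, s (mk i a b) = mk' i a b) -> comm adj s mA mA' /\ comm adj s mB mB'.
Proof.
by move=> [P T S] [P' T' S'] E; split;
  [apply: gstraight_comm P E T T' | apply: gstraight_comm P E S S'].
Qed.

Lemma turn_type_iso u be mk mk' mA mB mA' mB' :
  matching adj mA -> matching adj mB ->
  turn_type u be mk mA mB -> turn_type u be mk' mA' mB' ->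
  map_iso adj (faces adj mA :|: faces adj mB) (faces adj mA' :|: faces adj mB').
Proof.
move=> MA MB T T'; have [P _ _] := T; have [P' _ _] := T'.
have [s [Gs Es]] := px_iso P P'; have [CA CB] := turn_type_comm T T' Es.
exact: (comm_map_iso (px_sym P) Gs MA MB CA CB).
Qed.

Lemma straight_type_iso u be ka mk mk' mA mB mA' mB' :
  matching adj mA -> matching adj mB ->
  straight_type u be ka mk mA mB -> straight_type u be ka mk' mA' mB' ->
  map_iso adj (faces adj mA :|: faces adj mB) (faces adj mA' :|: faces adj mB').
Proof.
move=> MA MB T T'; have [P _ _] := T; have [P' _ _] := T'.
have [s [Gs Es]] := px_iso P P'; have [CA CB] := straight_type_comm T T' Es.
exact: (comm_map_iso (px_sym P) Gs MA MB CA CB).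
Qed.

Lemma px_inhabited u mk : PX u mk -> exists x, dart adj x.
Proof.
by move=> P; exists (mk 0 false false, mk 1 false false); apply: px_adj_next P _ _ _ _.
Qed.

Lemma turn_type_class2 u be mk mA mB :
  matching adj mA -> matching adj mB -> turn_type u be mk mA mB ->
  period be %| N -> 4 != (if u then 2 * N else N) ->
  class2_01 adj (faces adj mA :|: faces adj mB) /\
  has_face_lengths (faces adj mA :|: faces adj mB) 4 (if u then 2 * N else N).
Proof.
move=> MA MB T pN N4; have [P TA SB] := T.
have cA := turn_card P MA TA; have cB := straight_card P MB SB pN.
have inh := px_inhabited P.
split; last exact: matchings_lengths cA cB inh.
apply: (matchings_class2 (px_sym P) (px_irr P) MA MB (turn_simple P TA)
  (straight_simple P MB SB pN) _ cA cB N4 _ inh) => [v w w'|].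
  move=> /(px_dart P)[i [a [b [-> ww]]]] /(px_nbr P) ww'; rewrite !inE.
  by case: ww => -[c ->]; rewrite ?(SB _ _ _ _).1 ?(SB _ _ _ _).2 ?(TA _ _ _ _).1 ?(TA _ _ _ _).2;
    case: ww' => -[c' ->]; case: c c' (be && _) => [] [] []; rewrite ?eqxx ?orbT.
apply: (px_dart_transitive (u := u) (be := be) (G := fun mk' => turn_type u be mk' mA mB)) T.
- by move=> mk' [].
- by move=> k mk' [? ? ?]; split; [exact: PX_shift | exact: gturn_shift | exact: straight_shift].
- by move=> mk' [Q ? ?]; split; [exact: PX_rv | exact: gturn_rv Q _ | exact: straight_rv Q _].
- move=> Z mk' R [Q ? ?]; split; [exact: PX_tr_recur R Q | exact: gturn_tr | exact: straight_tr].
- by move=> mk1 mk2 s T1 T2; apply: turn_type_comm T1 T2.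
Qed.

Lemma straight_type_class2 mk mA mB :
  matching adj mA -> matching adj mB -> straight_type false false true mk mA mB ->
  3 %| N -> odd N ->
  class2_01 adj (faces adj mA :|: faces adj mB) /\
  has_face_lengths (faces adj mA :|: faces adj mB) N (2 * N).
Proof.
move=> MA MB T pN oN; have [P SA SB] := T.
(* X_{i+3} = X_i + 1, so [X] absorbs the constant in [mB]. As [N / 3] is odd it also changes the
   twist, which gives [mB] faces of length [2 * N] against [N] for [mA]. *)
pose X i := odd (i %/ 3).
have XN i : X (i + N) = X i (+) true.
  by rewrite /X divnDr // oddD; move: oN; rewrite -{1}(divnK pN) oddM andbT => ->.
have PX' : PX true (tr X mk) by rewrite -[true]addFb; apply: PX_tr XN P.
have SB' : straight false false (tr X mk) mB.
  move: (gstraight_tr X SB); apply: gstraight_ext => i a b.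
  by rewrite /X -[i.+3]addn3 divnDr // oddD /=; case: odd.
have cA := straight_card P MA SA pN; have cB := straight_card PX' MB SB' pN.
have inh := px_inhabited P.
split; last exact: matchings_lengths cA cB inh.
have N2 : N != 2 * N by lia.
apply: (matchings_class2 (px_sym P) (px_irr P) MA MB (straight_simple P MA SA pN)
  (straight_simple PX' MB SB' pN) _ cA cB N2 _ inh) => [v w w'|].
  move=> /(px_dart P)[i [a [b [-> ww]]]] /(px_nbr P) ww'; rewrite !inE.
  by case: ww => -[c ->]; rewrite ?(SA _ _ _ _).1 ?(SA _ _ _ _).2 ?(SB _ _ _ _).1 ?(SB _ _ _ _).2
     ?(SA _ _ _ _).1 ?(SA _ _ _ _).2;
    case: ww' => -[c' ->]; case: c c' => [] [] /=; rewrite ?eqxx ?orbT.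
apply: (px_dart_transitive (u := false) (be := false)
  (G := fun mk' => straight_type false false true mk' mA mB)) T.
- by move=> mk' [].
- by move=> k mk' [? ? ?]; split;
  [exact: PX_shift | exact: straight_shift | exact: straight_shift].
- by move=> mk' [Q ? ?]; split; [exact: PX_rv | exact: straight_rv Q _ | exact: straight_rv Q _].
- move=> Z mk' R [Q ? ?]; split;
  [exact: PX_tr_recur R Q | exact: straight_tr | exact: straight_tr].
- by move=> mk1 mk2 s T1 T2; apply: straight_type_comm T1 T2.
Qed.

(** * Rigidity of Praeger-Xu coordinates *)

Section Rigidity.
Variables (u : bool) (mk : nat -> bool -> bool -> V).
Hypothesis P : PX u mk.

Lemma ex_lev : exists lev : V -> nat, forall i a b, lev (mk i a b) = i %% N.
Proof.
have [||lev H] := px_lift P (Q := fun i a b t => t = i.+1 %% N).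
- by move=> i _ _; eexists.
- by move=> i _ _ t ->; rewrite -addSn modnDr.
exists lev => i a b; have [H1 _ _ _ _] := P.
have E : mk i a b = mk (i + N).-1.+1 (a (+) u) (b (+) u).
  by rewrite prednK ?H1 -?addbA ?addbb ?addbF //; lia.
by rewrite E H prednK ?modnDr //; lia.
Qed.

Lemma px_eqmod i j a b : i = j %[mod N] -> exists a' b', mk i a b = mk j a' b'.
Proof.
move=> E; rewrite {1}(divn_eq i N) E addnC (px_shiftn P).
set x := u && _; pose y := u && odd (j %/ N).
exists (a (+) x (+) y), (b (+) x (+) y).
rewrite {2}(divn_eq j N) addnC (px_shiftn P) -/y.
by rewrite -!addbA !addbb !addbF.
Qed.

Lemma mod_addn_neq d i : 0 < d < N -> i + d <> i %[mod N].
Proof.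
move=> /andP[d0 dN] /eqP; rewrite -{2}[i]addn0 eqn_modDl mod0n modn_small //.
by case: d d0 {dN}.
Qed.

Lemma px_adj_bits k a b a' c : adj (mk k a b) (mk k.+1 a' c) -> b = a'.
Proof.
rewrite (px_sym P) => /(px_nbr P)[] [d]; last by move/(px_bits P)=> [].
by rewrite -[k.+2]addn2 => /(px_lev_neq P); case; lia.
Qed.

Variable lev : V -> nat.
Hypothesis levE : forall i a b, lev (mk i a b) = i %% N.

Hypothesis N4 : N != 4.

(* For [N = 4] arcs two levels apart also have two common neighbours. *)
Lemma twin_lev v w x y : x <> y -> adj v x -> adj v y -> adj w x -> adj w y -> lev v = lev w.
Proof.
have [i [a [b ->]]] : exists i a b, v = mk i.+3 a b.
  have [i [a [b [_ ->]]]] := px_canon P v; have [H1 _ _ _ _] := P.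
  exists (i + N).-2, (a (+) u), (b (+) u).
  have -> : (i + N).-2.+3 = i.+1 + N by lia.
  by rewrite H1 -!addbA !addbb !addbF.
rewrite ![adj w _](px_sym P) => xy.
(* Through [x'] one returns to the level of [v], or moves two levels up, or two down. In the last
   two cases [v] and [w] determine [x'], and up differs from down modulo [N], so two distinct common
   neighbours leave only the first case. *)
have step x' : adj (mk i.+3 a b) x' -> adj x' w ->
    lev (mk i.+3 a b) = lev w \/
    (exists c d, x' = mk i.+4 b c /\ w = mk i.+4.+1 c d) \/
    (exists c d, x' = mk i.+2 c a /\ w = mk i.+1 d c).
  move=> /(px_nbr P)[] [c ->] /(px_nbr P)[] [d ->]; rewrite !levE; auto.
    by right; left; exists c, d.
  by right; right; exists c, d.
move=> vx vy xw yw; have far c d c' d' : mk i.+4.+1 c d <> mk i.+1 c' d'.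
  move=> /(px_mod P)/eqP; have -> : i.+4.+1 = i.+1 + 4 by lia.
  rewrite -{2}[i.+1]addn0 eqn_modDl mod0n.
  have [N5|N4'] := ltnP 4 N; first by rewrite modn_small.
  have -> : N = 3 by move: N3 N4 N4'; lia.
  by [].
case: (step x vx xw) => [//|[] [c [d [Ex Ew]]]];
  case: (step y vy yw) => [//|[] [c' [d' [Ey Ew']]]].
- by case: xy; rewrite Ex Ey; move: Ew; rewrite Ew' => /(px_bits P)[-> _].
- by case: (far c d d' c'); rewrite -Ew -Ew'.
- by case: (far c' d' d c); rewrite -Ew -Ew'.
- by case: xy; rewrite Ex Ey; move: Ew; rewrite Ew' => /(px_bits P)[_ ->].
Qed.

Lemma mod_succ i : (i %% N).+1 = i.+1 %[mod N].
Proof. by rewrite -addn1 modnDml addn1. Qed.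

Lemma adj_lev v w : adj v w -> lev w = (lev v).+1 %[mod N] \/ lev v = (lev w).+1 %[mod N].
Proof.
move=> /(px_dart P)[i [a [b [-> []]]]] [c ->]; rewrite !levE !mod_succ !modn_mod.
  by left.
by right.
Qed.

Lemma next_lev v : exists2 w, adj v w & lev w = (lev v).+1 %[mod N].
Proof.
have [i [a [b [_ ->]]]] := px_canon P v; exists (mk i.+2 b false).
  exact: px_adj_next P _ _ _ _.
by rewrite !levE mod_succ modn_mod.
Qed.

Lemma prev_lev v : exists2 w, adj v w & lev v = (lev w).+1 %[mod N].
Proof.
have [i [a [b [_ ->]]]] := px_canon P v; exists (mk i false a).
  exact: px_adj_prev P _ _ _ _.
by rewrite !levE mod_succ modn_mod.
Qed.

Section TwoSystems.
Variable mk' : nat -> bool -> bool -> V.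
Hypothesis P' : PX u mk'.

(** Arcs with the same head, or with the same tail, have two common neighbours, so [twin_lev]
    applies; each level of [mk'] thus lies inside one level of [mk]. *)
Lemma coord_lev i a b : lev (mk' i a b) = lev (mk' i false false).
Proof.
have next j a1 a2 b1 : lev (mk' j a1 b1) = lev (mk' j a2 b1).
  apply: (@twin_lev _ _ (mk' j.+1 b1 false) (mk' j.+1 b1 true));
    try exact: px_adj_next P' _ _ _ _.
  by move/(px_bits P')=> [].
have prev j a1 b1 b2 : lev (mk' j.+1 a1 b1) = lev (mk' j.+1 a1 b2).
  apply: (@twin_lev _ _ (mk' j false a1) (mk' j true a1));
    try exact: px_adj_prev P' _ _ _ _.
  by move/(px_bits P')=> [].
rewrite (next i a false b); have [H1 _ _ _ _] := P'.
have E b1 : mk' i false b1 = mk' (i + N).-1.+1 (false (+) u) (b1 (+) u).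
  by rewrite prednK ?H1 -?addbA ?addbb ?addbF //; lia.
by rewrite !E; apply: prev.
Qed.

Let L i := lev (mk' i false false).

(** A vertex has neighbours one level up and one level down, and these levels differ because [N] is
    at least 3; so the levels along [mk'] cannot change direction. *)
Lemma coord_lev_step i :
  (L i.+1 = (L i).+1 %[mod N] -> L i.+2 = (L i.+1).+1 %[mod N]) /\
  (L i = (L i.+1).+1 %[mod N] -> L i.+1 = (L i.+2).+1 %[mod N]).
Proof.
have nb w : adj (mk' i.+1 false false) w -> lev w = L i.+2 \/ lev w = L i.
  by move=> /(px_nbr P')[] [c ->]; rewrite coord_lev; auto.
have two k l : k = l.+1 %[mod N] -> l = k.+1 %[mod N] -> False.
  move=> E1 E2; apply: (@mod_addn_neq 2 k); first by lia.
  by rewrite addn2 -mod_succ -E2 mod_succ.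
split=> H.
  have [w /nb[] E] := next_lev (mk' i.+1 false false); rewrite E // -/(L _) => H'.
  by case: (two _ _ H H').
have [w /nb[] E] := prev_lev (mk' i.+1 false false); rewrite E // -/(L _) => H'.
by case: (two _ _ H H').
Qed.

Lemma coord_lev_mono :
  (forall i, L i.+1 = (L i).+1 %[mod N]) \/ (forall i, L i = (L i.+1).+1 %[mod N]).
Proof.
have [H|H] := adj_lev (px_adj_next P' 0 false false false); [left|right];
  by elim=> [|i IH] //; case: (coord_lev_step i) => H1 H2; auto.
Qed.

End TwoSystems.

(** Consecutive arcs share a point, so the second bit of [mk' i a b] is the first bit of the next
    arc and depends on [b] alone; injectivity leaves only [b] plus a constant [t] of the level. *)
Lemma coord_bits mk1 mk' l : PX u mk1 -> PX u mk' ->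
  (forall k a b a' d, adj (mk1 k a b) (mk1 k.+1 a' d) -> b = a') ->
  (forall i a b, exists a' b', mk' i a b = mk1 (l + i) a' b') ->
  exists t, (forall i, t (i + N) = t i) /\ forall i a b, mk' i a b = tr t (shift l mk1) i a b.
Proof.
move=> P1 P' bits H.
pose A i a b := [exists d : bool, mk' i a b == mk1 (l + i) true d].
pose B i a b := [exists d : bool, mk' i a b == mk1 (l + i) d true].
have E i a b : mk' i a b = mk1 (l + i) (A i a b) (B i a b).
  have [a' [b' E]] := H i a b; rewrite E; congr mk1.
    by apply/idP/existsP=> [aT|[d]]; [exists b'; rewrite E aT | rewrite E => /eqP/(px_bits P1)[]].
  by apply/idP/existsP=> [bT|[d]]; [exists a'; rewrite E bT | rewrite E => /eqP/(px_bits P1)[]].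
have BA i a b d : B i a b = A i.+1 b d.
  have := px_adj_next P' i a b d; rewrite !E addnS; apply: bits.
have A2 i a b : A (i + 2 * 1 * N) a b = A i a b.
  by rewrite /A addnA (px_even P'); apply: eq_existsb => d; rewrite (px_even P1).
pose t i := A i false false.
have AS i b d : A i.+1 b d = b (+) t i.+1.
  rewrite -(BA i false b d) (BA i false b false) /t; case: b; last by rewrite addFb.
  have : A i.+1 true false != A i.+1 false false.
    apply/eqP=> EA; suff : mk' i.+1 true false = mk' i.+1 false false by move/(px_bits P')=> [].
    by rewrite !E EA (BA _ true _ false) (BA _ false _ false).
  by case: (A _ true _) (A _ false _) => [] [].
(* Two turns turn any level into a successor, as [AS] requires. The period [N] is derived last, from
   the equality of the twists. *)
have t2 i : t (i + 2 * 1 * N) = t i by rewrite /t A2.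
have At i b d : A i b d = b (+) t i.
  rewrite -A2 -(t2 i); have -> : i + 2 * 1 * N = (i + 2 * 1 * N).-1.+1 by lia.
  exact: AS.
exists t; split=> [i|i a b]; last by rewrite E At (BA _ _ _ false) At.
have [H1 _ _ _ _] := P1; have [H1' _ _ _ _] := P'.
have := E (i + N) u u; rewrite H1' addbb E addnA H1 !At => /(px_bits P1)[].
by case: (u) (t i) (t (i + N)) => [] [] [].
Qed.

(** The levels of [mk'] run monotonically, so a shift, preceded by a reversal if they decrease,
    makes them those of [mk]; [coord_bits] then leaves only a translation. *)
Lemma coord_rigid mk' : PX u mk' -> exists l t, [/\ l < N, forall i, t (i + N) = t i &
  (forall i a b, mk' i a b = tr t (shift l mk) i a b) \/
  (forall i a b, mk' i a b = tr t (shift l (rv mk)) i a b)].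
Proof.
move=> P'; pose L i := lev (mk' i false false).
have at_lev v k : lev v = k %[mod N] -> exists a b, v = mk k a b.
  have [j [a [b [_ ->]]]] := px_canon P v; rewrite levE modn_mod => E.
  exact: px_eqmod.
have levN v : lev v < N.
  by have [j [a [b [_ ->]]]] := px_canon P v; rewrite levE ltn_mod; lia.
case: (coord_lev_mono P') => mono.
  have Li i : L i = L 0 + i %[mod N].
    elim: i => [|i IH]; first by rewrite addn0.
    by rewrite mono -addn1 -modnDml IH modnDml addn1 addnS.
  have [|t [tN Et]] := @coord_bits mk mk' (L 0) P P' px_adj_bits.
    by move=> i a b; apply: at_lev; rewrite coord_lev // -/(L i) Li.
  by exists (L 0), t; split; [exact: levN | | left].
have Li i : L i + i = L 0 %[mod N].
  elim: i => [|i IH]; first by rewrite addn0.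
  by rewrite -IH addnS -addSn -modnDml -mono modnDml.
have PR := PX_rv P.
(* [rv mk k] lies on level -(k + 1), so the shift by [N.-1 - L 0] starts on level [L 0] modulo
   [N]. *)
have [||t [tN Et]] := @coord_bits (rv mk) mk' (N.-1 - L 0) PR P'.
- move=> k a b a' d; rewrite (px_sym P) => /(px_nbr PR)[] [e]; last by move/(px_bits PR)=> [].
  rewrite -[k.+2]addn2 => /(px_mod PR)/esym; case/mod_addn_neq; lia.
- move=> i a b; rewrite /rv.
  have [|a' [b' E]] := at_lev (mk' i a b) ((2 * N).-1 * (N.-1 - L 0 + i).+1).
    rewrite coord_lev // -/(L i); apply/eqP.
    have L0 := levN (mk' 0 false false); rewrite -/(L 0) in L0.
    rewrite -(eqn_modDr (N.-1 - L 0 + i).+1).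
    have -> : (2 * N).-1 * (N.-1 - L 0 + i).+1 + (N.-1 - L 0 + i).+1 =
      2 * (N.-1 - L 0 + i).+1 * N by nia.
    have -> : L i + (N.-1 - L 0 + i).+1 = (L i + i) + (N - L 0) by lia.
    by rewrite -modnDml Li modnDml modnMl subnKC ?modnn // ltnW.
  by exists b', a'.
exists (N.-1 - L 0), t; split=> //; last by right.
by have := levN (mk' 0 false false); rewrite -/(L 0); lia.
Qed.

End Rigidity.

Lemma gstraight_coord g mk mk' m : (forall i a b, mk i a b = mk' i a b) ->
  gstraight g mk m -> gstraight g mk' m.
Proof. by move=> E H i a b c; rewrite -!E; apply: H. Qed.

Lemma recur_periodn be Z k i : recur be Z -> Z (i + k * period be) = Z i.
Proof.
move=> R; elim: k i => [|k IH] i; first by rewrite mul0n addn0.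
rewrite mulSn addnA IH {IH}; case: be R => R; rewrite /period.
  rewrite !addnS addn0 2!R /=.
  by case: (Z i) (Z i.+1) (Z i.+2) (Z i.+3) => [] [] [] [].
by rewrite !addnS addn0 R /= addbF.
Qed.

(** The solution that starts with 1, 0, 0 has the full period of the register. *)
Lemma recur_period_dvd be Z : recur be Z -> (forall i, Z (i + N) = Z i) ->
  Z 0 -> ~~ Z 1 -> ~~ Z 2 -> period be %| N.
Proof.
move=> R ZN Z0 /negbTE Z1 /negbTE Z2.
have red i : Z (i + N %% period be) = Z i.
  by rewrite -(recur_periodn (N %/ period be) _ R) -addnA [_ %% _ + _]addnC -divn_eq ZN.
have Z3 := R 0; have Z4 := R 1; rewrite Z0 Z1 Z2 in Z3 Z4.
have := red 0; have := red 1; have : N %% period be < period be by rewrite ltn_mod; case: (be).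
rewrite /dvdn; case: (N %% _) => [|[|[|[|r]]]] //; rewrite ?add0n ?addn1 ?add1n ?Z0 ?Z1 ?Z2 //.
  by rewrite Z4 Z3 andbF; case: (be).
by case: (be).
Qed.

(** * Classification for n <> 4 *)

Section StraightNormal.
Hypothesis N4 : N != 4.
Variables (mk : nat -> bool -> bool -> V) (m : V -> V -> V) (g : nat -> bool -> bool -> bool).
Hypotheses (P : PX false mk) (Sm : gstraight g mk m).
Hypothesis DT : forall x y, dart adj x -> dart adj y ->
  exists s : {perm V}, [/\ graph_aut adj s, comm adj s m m & (s x.1, s x.2) = y].

Let H1 i a b : mk (i + N) a b = mk i a b.
Proof. by case: P => -> _ _ _ _; rewrite !addbF. Qed.

(** Rigidity writes the automorphism as a shift, possibly a reversal, and a translation; since [m]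
    determines [g], the invariance of [m] becomes a functional equation for [g]. *)
Lemma straight_aut (s : {perm V}) : graph_aut adj s -> comm adj s m m ->
  exists l t, [/\ l < N, forall i, t (i + N) = t i &
    ((forall i a b, s (mk i a b) = tr t (shift l mk) i a b) /\
     forall i a b, g i a b =
       g (l + i) (a (+) t i.+1) (b (+) t i.+2) (+) t i (+) t i.+3) \/
    ((forall i a b, s (mk i a b) = tr t (shift l (rv mk)) i a b) /\
     forall i a b, g i a b =
       g ((2 * N).-1 * (l + i).+3) (b (+) t i.+2) (a (+) t i.+1) (+) t i (+) t i.+3)].
Proof.
move=> Gs Cs; have P' := PX_push Gs P; have S' := gstraight_push P Cs Sm.
have [lev Hlev] := ex_lev P; have [l [t [lN tN H]]] := coord_rigid P Hlev N4 P'.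
exists l, t; split=> //; case: H => E; [left|right]; split=> //;
  apply: (gstraight_uniq P' S'); apply: (gstraight_coord (fun i a b => esym (E i a b))).
  exact: (gstraight_tr t (gstraight_shift l Sm)).
exact: (gstraight_tr t (gstraight_shift l (gstraight_rv P Sm))).
Qed.

Lemma rv_backward l a b a' b' i : rv mk l a b = mk i a' b' ->
  forall a b a' b', rv mk l.+1 a b <> mk i.+1 a' b'.
Proof.
move=> /(px_mod P) E a1 b1 a2 b2 /(px_mod P); rewrite mulnS.
have -> : (2 * N).-1 + (2 * N).-1 * l.+1 = (2 * N).-1 * l.+1 + (2 * N).-1 by rewrite addnC.
rewrite -modnDml E modnDml => E'; apply: (@mod_addn_neq 2 i); first by lia.
rewrite addn2 -mod_succ -E' mod_succ; have -> : (i + (2 * N).-1).+1 = 2 * N + i by lia.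
by rewrite modnMDl.
Qed.

(** An automorphism between darts that leave the same level in the same direction involves neither
    rotation nor reversal; the remaining translation has prescribed values at three levels. *)
Lemma straight_shear j x y z : exists t, [/\ forall i, t (i + N) = t i,
  [/\ t j = x, t j.+1 = y & t j.+2 = z] &
  forall i a b, g i a b = g i (a (+) t i.+1) (b (+) t i.+2) (+) t i (+) t i.+3].
Proof.
have [s [Gs Cs]] := DT (px_adj_next P j false false false : dart adj (_, _))
  (px_adj_next P j x y z : dart adj (_, _)).
have [l [t [lN tN [] [E Eg]]]] := straight_aut Gs Cs; rewrite /= !E /tr /shift !addFb => -[E1 E2].
  have l0 : l = 0.
    have /eqP := px_mod P E1; rewrite -{2}[j]add0n eqn_modDr mod0n modn_small //.
    by move/eqP.
  rewrite l0 !add0n in E1 E2; exists t; split=> //.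
    by case/(px_bits P): E1 => -> ->; case/(px_bits P): E2 => _ ->.
  by move=> i a b; rewrite {1}Eg l0.
by rewrite addnS in E2; case: (rv_backward E1 E2).
Qed.

Lemma straight_rot : exists t, (forall i, t (i + N) = t i) /\
  forall i a b, g i a b = g i.+1 (a (+) t i.+1) (b (+) t i.+2) (+) t i (+) t i.+3.
Proof.
have [s [Gs Cs]] := DT (px_adj_next P 0 false false false : dart adj (_, _))
  (px_adj_next P 1 false false false : dart adj (_, _)).
have [l [t [lN tN [] [E Eg]]]] := straight_aut Gs Cs; rewrite /= !E /tr /shift !addFb => -[E1 E2].
  have l1 : l = 1.
    have /eqP := px_mod P E1; rewrite addn0 !modn_small //; last by lia.
    by move/eqP.
  by exists t; split=> // i a b; rewrite {1}Eg l1.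
by rewrite addnS in E2; case: (rv_backward E1 E2).
Qed.

Lemma straight_refl : exists l t, forall i a b, g i a b =
  g ((2 * N).-1 * (l + i).+3) (b (+) t i.+2) (a (+) t i.+1) (+) t i (+) t i.+3.
Proof.
have [s [Gs Cs]] := DT (px_adj_next P 0 false false false : dart adj (_, _))
  (px_adj_prev P 0 false false false : dart adj (_, _)).
have [l [t [lN tN [] [E Eg]]]] := straight_aut Gs Cs; rewrite /= !E /tr /shift !addFb => -[E1 E2].
  have F1 := px_mod P E1; have F2 := px_mod P E2.
  case: (@mod_addn_neq 2 0); first by lia.
  by rewrite addn2 -mod_succ -F1 mod_succ addn0 -addn1 F2.
by exists l, t.
Qed.

Let al i := g i false false.

(** The shear with [t i.+1 = true] and [t i.+2 = false] makes the derivative of [g i] in its first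
    argument constant, so there is no product term. The rotation makes the linear coefficients
    independent of [i], and the reflection makes them equal. *)
Lemma straight_affine : exists be, forall i a b, g i a b = al i (+) (be && (a (+) b)).
Proof.
pose ba i := g i true false (+) al i; pose ga i := g i false true (+) al i.
have form i a b : g i a b = al i (+) (ba i && a) (+) (ga i && b).
  have [t1 [_ [_ t11 t12] E1]] := straight_shear i false true false.
  have := E1 i false false; have := E1 i false true; rewrite /ba /ga /al t11 t12 /=.
  by case: a; case: b => /=; move: (g i true true) (g i true false) (g i false true)
    (g i false false) (t1 i) (t1 i.+3) => [] [] [] [] [] [].
have [t [_ rot]] := straight_rot.
have baS i : ba i.+1 = ba i.
  have := rot i true false; have := rot i false false; rewrite !form !andbT !andbF /=.
  by case: (ba i) (ba i.+1) (ga i.+1) (al i) (al i.+1) (t i) (t i.+1) (t i.+2) (t i.+3)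
    => [] [] [] [] [] [] [] [] [].
have gaS i : ga i.+1 = ga i.
  have := rot i false true; have := rot i false false; rewrite !form !andbT !andbF /=.
  by case: (ga i) (ba i.+1) (ga i.+1) (al i) (al i.+1) (t i) (t i.+1) (t i.+2) (t i.+3)
    => [] [] [] [] [] [] [] [] [].
have ba0 i : ba i = ba 0 by elim: i => // i <-; apply: baS.
have ga0 i : ga i = ga 0 by elim: i => // i <-; apply: gaS.
have [l [t' refl]] := straight_refl.
have bg : ba 0 = ga 0.
  have := refl 0 true false; have := refl 0 false false; move: (_ * _) => k.
  rewrite !form (ba0 k) (ga0 k) !andbT !andbF /=.
  by case: (ga 0) (ba 0) (al 0) (al k) (t' 0) (t' 1) (t' 2) (t' 3)
    => [] [] [] [] [] [] [] [].
exists (ba 0) => i a b; rewrite form (ba0 i) (ga0 i) bg.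
by case: (ga 0) a b (al i) => [] [] [] [].
Qed.

Theorem straight_normal : exists u be X,
  [/\ period be %| N, forall i, X (i + N) = X i (+) u & straight be false (tr X mk) m].
Proof.
have [be form] := straight_affine.
have gN i a b : g (i + N) a b = g i a b.
  have SN : gstraight (fun i => g (N + i)) mk m.
    apply: gstraight_coord (gstraight_shift N Sm) => j a1 b1.
    by rewrite /shift addnC H1.
  by rewrite (gstraight_uniq P Sm SN i) addnC.
have shear_recur t : (forall i a b,
    g i a b = g i (a (+) t i.+1) (b (+) t i.+2) (+) t i (+) t i.+3) -> recur be t.
  move=> E i; have := E i false false; rewrite !form /=.
  by case: (be) (al i) (t i) (t i.+1) (t i.+2) (t i.+3) => [] [] [] [] [] [].
(* The shear starting with 1, 0, 0 is an N-periodic solution of the homogeneous recurrence. *)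
have pN : period be %| N.
  have [t [tN [t0 t1 t2] /shear_recur R]] := straight_shear 0 true false false.
  by apply: (recur_period_dvd R tN); rewrite ?t0 ?t1 ?t2.
(* [X] solves the recurrence with inhomogeneity [al]; [W] measures its failure to be
   compatible with the rotation, so [W] solves the homogeneous recurrence and is
   [N]-periodic, which makes [X (i + N) (+) X i] independent of [i]. *)
pose st i (p : bool * bool * bool) :=
  (p.1.2, p.2, p.1.1 (+) (be && (p.1.2 (+) p.2)) (+) al i).
pose S i := iteri i st (false, false, false).
pose X i := (S i).1.1.
have XE i : X i.+3 = X i (+) (be && (X i.+1 (+) X i.+2)) (+) al i by [].
have [t [tN rot]] := straight_rot.
pose W i := X i.+1 (+) X i (+) t i.
have RW : recur be W.
  move=> i; have := rot i false false; rewrite !form /W !XE /=.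
  by case: (be) (X i) (X i.+1) (X i.+2) (X i.+3) (al i) (al i.+1) (t i) (t i.+1) (t i.+2)
    (t i.+3) => [] [] [] [] [] [] [] [] [] [] [].
pose Y i := X (i + N) (+) X i.
have YS i : Y i.+1 = Y i.
  have := recur_period i RW pN; rewrite /W /Y tN -addSn.
  by case: (X (i + N)) (X (i.+1 + N)) (X i) (X i.+1) (t i) => [] [] [] [] [].
have Y0 i : Y i = Y 0 by elim: i => // i <-.
exists (Y 0), be, X; split=> // [i|].
  by rewrite -(Y0 i) /Y addbC addbK.
apply: gstraight_ext (gstraight_tr X Sm) => i a b; rewrite form XE.
by case: (be) a b (X i) (X i.+1) (X i.+2) (al i) => [] [] [] [] [] [] [].
Qed.

End StraightNormal.

(** * Turning or going straight at all vertices *)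

Section Dichotomy.
Variables (mk : nat -> bool -> bool -> V) (m : V -> V -> V).
Hypotheses (P : PX false mk) (Mm : matching adj m).

(** Four neighbours have three perfect matchings: one pairs forward with forward, and the other two,
    indexed by [g], pair forward with backward. *)
Lemma turn_or_straight i a b :
  (forall c, m (mk i.+1 a b) (mk i.+2 b c) = mk i.+2 b (~~ c) /\
     m (mk i.+1 a b) (mk i c a) = mk i (~~ c) a) \/
  exists g, forall c, m (mk i.+1 a b) (mk i.+2 b c) = mk i (c (+) g) a /\
     m (mk i.+1 a b) (mk i c a) = mk i.+2 b (c (+) g).
Proof.
have [inv madj mneq] := Mm; set v := mk i.+1 a b; have iv := inv v.
have fw c : adj v (mk i.+2 b c) := px_adj_next P i.+1 a b c.
have bw c : adj v (mk i c a) := px_adj_prev P i a b c.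
have nbr w : adj v w -> (exists c, m v w = mk i.+2 b c) \/ (exists z, m v w = mk i z a).
  by rewrite -madj => /(px_nbr P).
have fN c : m v (mk i.+2 b c) <> mk i.+2 b c by apply/eqP/mneq.
have bN c : m v (mk i c a) <> mk i c a by apply/eqP/mneq.
have mI := can_inj iv.
case: (nbr _ (fw false)) => -[z E]; [left|right].
  have Ez : z = true by case: z E => // /fN.
  rewrite {z}Ez in E; have E' : m v (mk i.+2 b true) = mk i.+2 b false by rewrite -E iv.
  have F c : m v (mk i.+2 b c) = mk i.+2 b (~~ c) by case: c; rewrite ?E ?E'.
  have B c : m v (mk i c a) = mk i (~~ c) a.
    case: (nbr _ (bw c)) => -[d Ed]; last by case: c d Ed => [] [] // /bN.
    by have := px_fb P i b (~~ d) c a; rewrite -F -Ed iv eqxx.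
  by move=> c; rewrite F B.
have Ez : m v (mk i z a) = mk i.+2 b false by rewrite -E iv.
have E' : m v (mk i.+2 b true) = mk i (~~ z) a.
  case: (nbr _ (fw true)) => -[d Ed].
    case: d Ed => [/fN //|Ed]; have : mk i z a = mk i.+2 b true by rewrite -E -Ed iv.
    by move/esym/eqP; rewrite (negbTE (px_fb P _ _ _ _ _)).
  rewrite Ed; congr mk; case: (eqVneq d z) => [dz|]; last by case: (d) (z) => [] [].
  by move: Ed; rewrite dz -E => /mI/(px_bits P)[].
have Ez' : m v (mk i (~~ z) a) = mk i.+2 b true by rewrite -E' iv.
by exists z; case; case: (z) E E' Ez Ez' => /= E E' Ez Ez'; rewrite ?E ?E' ?Ez ?Ez'.
Qed.

(** By rigidity automorphisms preserve equality of levels, and turning means keeping the level of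
    the neighbour; dart-transitivity thus spreads the type of one vertex to all. *)
Lemma turn_or_straight_all mA mB : N != 4 -> dart_transitive adj mA mB ->
  m = mA \/ m = mB -> gturn mk m \/ exists g, gstraight g mk m.
Proof.
move=> N4 DT mAB; have [lev Hlev] := ex_lev P.
pose turnAt v := forall w, adj v w -> lev (m v w) = lev w.
have turnN v w : turnAt v -> turnAt w.
  move=> T; have [w0 [vw0 _ _]] := px_degree P v v v.
  have [w1 [ww1 _ _]] := px_degree P w w w.
  have [s [Gs CA CB [Ev _]]] := DT (v, w0) (w, w1) vw0 ww1.
  have Cs : comm adj s m m by case: mAB => ->.
  have G := graph_autE Gs; have P' := PX_push Gs P.
  have slev x y : lev x = lev y -> lev (s x) = lev (s y).
    have [i [a [b [_ ->]]]] := px_canon P x; have [j [a' [b' [_ ->]]]] := px_canon P y.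
    rewrite !Hlev => E; have [a2 [b2 ->]] := px_eqmod P a b E.
    rewrite (coord_lev P Hlev N4 P') [RHS](coord_lev P Hlev N4 P'); reflexivity.
  move=> x; rewrite -Ev -{1 2 3}[x](permKV s) G => vx.
  by rewrite -Cs //; apply/slev/T.
have notT i a b : (exists g, forall c, m (mk i.+1 a b) (mk i.+2 b c) = mk i (c (+) g) a /\
     m (mk i.+1 a b) (mk i c a) = mk i.+2 b (c (+) g)) -> ~ turnAt (mk i.+1 a b).
  move=> [g S] /(_ _ (px_adj_next P i.+1 a b false)); rewrite (S false).1 !Hlev.
  by move/esym; rewrite -addn2; apply: mod_addn_neq; lia.
case: (turn_or_straight 0 false false) => [T0|S0].
  left=> i a b; case: (turn_or_straight i a b) => // /notT; case;
    apply: (turnN (mk 1 false false)) => w.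
  by move=> /(px_nbr P)[] [c ->]; rewrite ?(T0 c).1 ?(T0 c).2 !Hlev.
right; exists (fun i a b => m (mk i.+1 a b) (mk i.+2 b false) == mk i true a) => i a b c.
case: (turn_or_straight i a b) => [T|[g S]].
  case/notT: S0; apply: (turnN (mk i.+1 a b)) => w.
  by move=> /(px_nbr P)[] [d ->]; rewrite ?(T d).1 ?(T d).2 !Hlev.
have -> : (m (mk i.+1 a b) (mk i.+2 b false) == mk i true a) = g.
  rewrite (S false).1; case: (g); first by rewrite eqxx.
  by apply/eqP=> /(px_bits P)[].
exact: S.
Qed.

End Dichotomy.

(** A translation by [Y] with Y_i + Y_{i+3} + be (Y_{i+1} + Y_{i+2}) = 1 exchanges the formulas of
    the two matchings. If [Y] is N-periodic, it keeps the twist and gives a forbidden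
    automorphism. *)
Lemma both_straight u be mk mA mB : PX u mk -> period be %| N ->
  straight be false mk mA -> straight be true mk mB ->
  (forall s, graph_aut adj s -> comm adj s mA mB -> comm adj s mB mA -> False) ->
  [/\ be = false, odd N & exists mk', straight_type false false true mk' mA mB \/
    straight_type false false true mk' mB mA].
Proof.
move=> P pN SA SB noswap.
have flip Y : (forall i, Y i (+) Y i.+3 (+) (be && (Y i.+1 (+) Y i.+2)) = true) ->
    straight be true (tr Y mk) mA /\ straight be false (tr Y mk) mB.
  move=> HY; split; [have S := gstraight_tr Y SA | have S := gstraight_tr Y SB];
    apply: gstraight_ext S => i a b; have := HY i;
    by case: (be) a b (Y i) (Y i.+1) (Y i.+2) (Y i.+3) => [] [] [] [] [] [] [].
have swap Y : (forall i, Y i (+) Y i.+3 (+) (be && (Y i.+1 (+) Y i.+2)) = true) ->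
    (forall i, Y (i + N) = Y i) -> False.
  move=> /flip[SA' SB'] YN.
  have P' : PX u (tr Y mk) by rewrite -[u]addbF; apply: PX_tr P => i; rewrite YN addbF.
  have [s [Gs Es]] := px_iso P P'; apply: (noswap s Gs).
    exact: gstraight_comm P Es SA SB'.
  exact: gstraight_comm P Es SB SA'.
case: be pN SA SB flip swap => pN SA SB flip swap.
  (* For be = 1 any four consecutive values must sum to 1; the indicator of one residue modulo 4
     does this, and 4 divides [N]. *)
  case: (swap (fun i => i %% 4 == 3)) => i.
    have : i %% 4 < 4 by rewrite ltn_mod.
    have E k : (k + i) %% 4 = (k + i %% 4) %% 4 by rewrite modnDmr.
    rewrite /= -[i.+1]add1n -[i.+2]add2n -[i.+3]add3n (E 1) (E 2) (E 3).
    by case: (i %% 4) => [|[|[|[|]]]].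
  by rewrite -modnDmr (eqP pN) addn0.
pose Y i := odd (i %/ 3).
have HY i : Y i (+) Y i.+3 (+) (false && (Y i.+1 (+) Y i.+2)) = true.
  by rewrite /Y -[i.+3]addn3 divnDr // oddD /=; case: odd.
have YN i : Y (i + N) = Y i (+) odd (N %/ 3) by rewrite /Y divnDr // oddD.
have EN : odd N = odd (N %/ 3) by rewrite -{1}(divnK pN) oddM andbT.
case oN : (odd (N %/ 3)) EN => EN; last first.
  by case: (swap Y HY) => i; rewrite YN oN addbF.
(* For [N / 3] odd, [Y] changes the twist, so a twisted system becomes an untwisted one with the
   roles of [mA] and [mB] exchanged. *)
split=> //; case: u P {swap} => P; last by exists mk; left.
have [SA' SB'] := flip Y HY; exists (tr Y mk); right; split=> //.
by rewrite -[false]/(true (+) true); apply: PX_tr P => i; rewrite YN oN.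
Qed.

Theorem class2_types u mk F : N != 4 -> PX u mk -> class2_01 adj F ->
  exists mA mB mk', [/\ matching adj mA, matching adj mB, F = faces adj mA :|: faces adj mB &
   (exists u' be, period be %| N /\ turn_type u' be mk' mA mB) \/
   [/\ odd N, 3 %| N & straight_type false false true mk' mA mB]].
Proof.
move=> N4 P0 CF.
have [mk0 P] : exists mk0, PX false mk0.
  case: u P0 => P0; last by exists mk.
  (* Translating by the parity of the number of turns removes the twist. *)
  exists (tr (fun i => odd (i %/ N)) mk); rewrite -[false]/(true (+) true).
  by apply: PX_tr P0 => i; rewrite divnDr // divnn oddD; case: N N3.
have [mA [mB [MA MB neq EF [DT noswap]]]] :=
  class2_matchings (px_sym P) (px_degree P) CF.
have DT' m : m = mA \/ m = mB -> forall x y, dart adj x -> dart adj y ->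
    exists s : {perm V}, [/\ graph_aut adj s, comm adj s m m & (s x.1, s x.2) = y].
  move=> mAB x y dx dy; have [s [Gs CA CB E]] := DT x y dx dy; exists s; split=> //.
  by case: mAB => ->.
have finish m m' g : m = mA \/ m = mB -> gturn mk0 m' -> gstraight g mk0 m ->
    exists mk' u' be, period be %| N /\ turn_type u' be mk' m' m.
  move=> mAB T S; have [u' [be [X [pN XN S']]]] := straight_normal N4 P S (DT' m mAB).
  exists (tr X mk0), u', be; split=> //; split=> //; last exact: gturn_tr.
  by rewrite -[u']addFb; apply: PX_tr P.
case: (turn_or_straight_all P MA N4 DT (or_introl erefl)) => [TA|[gA SA]];
  case: (turn_or_straight_all P MB N4 DT (or_intror erefl)) => [TB|[gB SB]].
- have := neq _ _ (px_adj_next P 1 false false false).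
  by rewrite (TA 0 false false false).1 (TB 0 false false false).1 eqxx.
- have [mk' H] := finish mB mA gB (or_intror erefl) TA SB.
  by exists mA, mB, mk'; split=> //; left.
- have [mk' H] := finish mA mB gA (or_introl erefl) TB SA.
  by exists mB, mA, mk'; split=> //; [rewrite EF setUC | left].
have [u' [be [X [pN XN SA']]]] := straight_normal N4 P SA (DT' mA (or_introl erefl)).
have P' : PX u' (tr X mk0) by rewrite -[u']addFb; apply: PX_tr P.
(* A straight matching has two possible values at each vertex; [mB] differs from [mA], so it takes
   the complementary one. *)
have SB' : straight be true (tr X mk0) mB.
  have S := gstraight_tr X SB; apply: gstraight_ext S => i a b /=.
  have := neq _ _ (px_adj_next P i.+1 (a (+) X i.+1) (b (+) X i.+2) false).
  rewrite (SA _ _ _ _).1 (SB _ _ _ _).1.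
  have := gstraight_uniq P' (gstraight_tr X SA) SA' i a b => /=.
  case: (gA _ _ _) (gB _ _ _) (X i) (X i.+3) (be && _) => [] [] [] [] [] //=;
    by rewrite eqxx.
have [be0 oN [mk' H]] := both_straight P' pN SA' SB' noswap.
rewrite be0 in pN; case: H => H.
  by exists mA, mB, mk'; split=> //; right.
by exists mB, mA, mk'; split=> //; [rewrite EF setUC | right].
Qed.

(** The straight faces do not have length 4, so an isomorphism maps them to straight faces; by
    rigidity it acts on the recurrence by shift, reversal and translation, none of which affects the
    linear coefficient. *)
Lemma turn_type_noniso u be be' mk mk' mA mB mA' mB' : N != 4 ->
  4 != (if u then 2 * N else N) -> period be %| N -> period be' %| N ->
  matching adj mA -> matching adj mB -> matching adj mA' -> matching adj mB' ->
  turn_type u be mk mA mB -> turn_type u be' mk' mA' mB' ->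
  map_iso adj (faces adj mA :|: faces adj mB) (faces adj mA' :|: faces adj mB') ->
  be = be'.
Proof.
move=> N4 card4 pN pN' MA MB MA' MB' [P TA SB] [P' TA' SB'] [s [Gs Fs]].
have CB : comm adj s mB mB'.
  apply: (img_comm (px_irr P) Gs MB MB' (straight_simple P' MB' SB' pN')) => x dx.
  have : face_img s (face mB x) \in faces adj mA' :|: faces adj mB'.
    by rewrite -Fs; apply: imset_f; rewrite inE orbC imset_f.
  rewrite inE => /orP[] /imsetP[y dy E]; last by exists y.
  case/eqP: card4; rewrite -(straight_card P MB SB pN dx) -(turn_card P' MA' TA' dy).
  by rewrite -E card_face_img.
have Q := PX_push Gs P; have S := gstraight_push P CB SB.
have [lev Hlev] := ex_lev P'; have [l [t [_ _ H]]] := coord_rigid P' Hlev N4 Q.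
suff H' : forall i a b, (be && (a (+) b)) (+) false =
    ((be' && ((a (+) t i.+1) (+) (b (+) t i.+2))) (+) false) (+) t i (+) t i.+3.
  have := H' 0 false false; have := H' 0 true false.
  by case: (be) (be') (t 0) (t 1) (t 2) (t 3) => [] [] [] [] [] [].
case: H => E; apply: (gstraight_uniq Q S); apply: (gstraight_coord (fun i a b => esym (E i a b))).
  exact: (gstraight_tr t (straight_shift l SB')).
exact: (gstraight_tr t (straight_shift l (straight_rv P' SB'))).
Qed.

Lemma has_face_lengths_iso F F' (x y x' y' : nat) : map_iso adj F F' ->
  has_face_lengths F x y -> has_face_lengths F' x' y' -> x = x' \/ x = y'.
Proof.
move=> [s [_ <-]] [_ [f fF <-] _] [H _ _].
by have := H (face_img s f) (imset_f _ fF); rewrite card_face_img.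
Qed.

Lemma has_face_lengths_iso2 F F' (x y x' y' : nat) : map_iso adj F F' ->
  has_face_lengths F x y -> has_face_lengths F' x' y' -> y = x' \/ y = y'.
Proof.
move=> [s [_ <-]] [_ _ [f fF <-]] [H _ _].
by have := H (face_img s f) (imset_f _ fF); rewrite card_face_img.
Qed.

End PraegerXu.

(** * The 4-cube *)

(** The directions of the 4-cube are labelled by F_2^2, so that the three fixed-point-free
    involutions of the directions are the translations by nonzero vectors. *)
Notation dir := (bool * bool)%type.
Notation corner := (bool * bool * bool * bool)%type.

Definition dirs : seq dir := [:: (false, false); (true, false); (false, true); (true, true)].
Definition corners : seq corner :=
  [seq (x.1, x.2, y.1, y.2) | x <- dirs, y <- dirs].

Lemma dir_all (Q : pred dir) : all Q dirs -> forall d, Q d.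
Proof. by move=> /allP H [[] []]; apply: H. Qed.

Lemma corner_all (Q : pred corner) : all Q corners -> forall x, Q x.
Proof. by move=> /allP H [[[[] []] []] []]; apply: H. Qed.

Definition dadd (d e : dir) : dir := (d.1 (+) e.1, d.2 (+) e.2).

Definition coord (x : corner) (d : dir) : bool :=
  let: (x1, x2, x3, x4) := x in
  if d.2 then (if d.1 then x4 else x3) else (if d.1 then x2 else x1).

Definition of_coord (f : dir -> bool) : corner :=
  (f (false, false), f (true, false), f (false, true), f (true, true)).

Definition flipc (d : dir) (x : corner) : corner :=
  of_coord (fun e => coord x e (+) (e == d)).

Definition par (x : corner) : bool := let: (x1, x2, x3, x4) := x in x1 (+) x2 (+) x3 (+) x4.

Lemma dadd_inj d : injective (dadd d).
Proof. by case: d => [[] []] [[] []] [[] []]. Qed.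

Lemma daddC d e : dadd d e = dadd e d.
Proof. by rewrite /dadd addbC (addbC d.2). Qed.

Lemma flipcK d : involutive (flipc d).
Proof. by case: d => [[] []] [[[[] []] []] []]. Qed.

Lemma flipcC d e x : flipc d (flipc e x) = flipc e (flipc d x).
Proof. by case: d e x => [[] []] [[] []] [[[[] []] []] []]. Qed.

Lemma flipc_inj d e x : flipc d x = flipc e x -> d = e.
Proof. by case: d e x => [[] []] [[] []] [[[[] []] []] []]. Qed.

Lemma par_flipc d x : par (flipc d x) = ~~ par x.
Proof. by case: d x => [[] []] [[[[] []] []] []]. Qed.

Lemma flipc2_eq a b c e x : flipc a (flipc b x) = flipc c (flipc e x) ->
  a != b -> b != e -> a = e.
Proof.
move=> /eqP E ab be; apply/eqP; move: a b c e x E ab be.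
have H : all (fun a => all (fun b => all (fun c => all (fun e => all (fun x =>
    (flipc a (flipc b x) == flipc c (flipc e x)) ==> (a != b) ==> (b != e) ==> (a == e))
    corners) dirs) dirs) dirs) dirs by vm_compute.
move=> a b c e x E ab be.
have := corner_all (dir_all (dir_all (dir_all (dir_all H a) b) c) e) x.
by rewrite E ab be.
Qed.

Lemma flipc_invariant (T : Type) (f : corner -> T) :
  (forall x d, f (flipc d x) = f x) -> forall x, f x = f (false, false, false, false).
Proof.
move=> H [[[x1 x2] x3] x4].
have -> : f (x1, x2, x3, x4) = f (false, x2, x3, x4).
  by case: x1 => //; rewrite -(H _ (false, false)); case: x2 x3 x4 => [] [] [].
have -> : f (false, x2, x3, x4) = f (false, false, x3, x4).
  by case: x2 => //; rewrite -(H _ (true, false)); case: x3 x4 => [] [].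
have -> : f (false, false, x3, x4) = f (false, false, false, x4).
  by case: x3 => //; rewrite -(H _ (false, true)); case: x4.
by case: x4 => //; rewrite -(H _ (true, true)).
Qed.

(** The values of [f] on the neighbours of [x] agree; [h] pairs this value with [f x], in an order
    given by the parity of [x], and is invariant under every flip. *)
Lemma flipc_two_valued (T : Type) (f : corner -> T) :
  (forall x d e, f (flipc d x) = f (flipc e x)) ->
  exists t0 t1, forall x, f x = if par x then t1 else t0.
Proof.
move=> H; pose g x := f (flipc (false, false) x).
pose h x := if par x then (g x, f x) else (f x, g x).
have gf x d : g (flipc d x) = f x by rewrite /g (H _ _ d) flipcK.
have fg x d : f (flipc d x) = g x by apply: H.
have hI x d : h (flipc d x) = h x.
  by rewrite /h par_flipc gf fg; case: (par x).
exists (h (false, false, false, false)).1, (h (false, false, false, false)).2 => x.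
by rewrite -(flipc_invariant hI x) /h; case: (par x).
Qed.

Lemma dir_involution (k : dir -> dir) : involutive k -> (forall d, k d != d) ->
  exists2 a, a != (false, false) & forall d, k d = dadd d a.
Proof.
move=> kK kN; exists (k (false, false)); first exact: kN.
have K1 := kK (false, false); have K2 := kK (true, false).
have K3 := kK (false, true); have K4 := kK (true, true).
have N1 := kN (false, false); have N2 := kN (true, false).
have N3 := kN (false, true); have N4 := kN (true, true).
move: K1 K2 K3 K4 N1 N2 N3 N4.
case E1 : (k (false, false)) => [[] []]; case E2 : (k (true, false)) => [[] []];
  case E3 : (k (false, true)) => [[] []]; case E4 : (k (true, true)) => [[] []];
  rewrite ?E1 ?E2 ?E3 ?E4 //= => _ _ _ _ _ _ _ _ [[] []]; by rewrite ?E1 ?E2 ?E3 ?E4.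
Qed.

Lemma dir_span a b d e : a != (false, false) -> b != (false, false) -> a != b ->
  e \in [:: d; dadd d a; dadd d b; dadd (dadd d a) b].
Proof. by case: a b d e => [[] []] [[] []] [[] []] [[] []]. Qed.

(** The linear map of F_2^2 sending the standard basis to [a] and [b]; relabelling directions by it
    brings two independent translations to standard form. *)
Definition lin (a b d : dir) : dir :=
  dadd (if d.1 then a else (false, false)) (if d.2 then b else (false, false)).

Definition lin_inv (a b e : dir) : dir :=
  if e == (false, false) then (false, false) else
  if e == a then (true, false) else if e == b then (false, true) else (true, true).

Definition relabel a b x := of_coord (fun e => coord x (lin_inv a b e)).
Definition relabel_inv a b x := of_coord (fun e => coord x (lin a b e)).

Definition indep (a b : dir) := [&& a != (false, false), b != (false, false) & a != b].

Section Relabel.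
Variables (a b : dir).
Hypothesis ab : indep a b.

Lemma lin_invK d : lin a b (lin_inv a b d) = d.
Proof. by case: a b d ab => [[] []] [[] []] [[] []]. Qed.

Lemma lin_dadd d e : lin a b (dadd d e) = dadd (lin a b d) (lin a b e).
Proof. by case: a b d e => [[] []] [[] []] [[] []] [[] []]. Qed.

Lemma relabel_flipc d x : relabel a b (flipc d x) = flipc (lin a b d) (relabel a b x).
Proof. by case: a b d x ab => [[] []] [[] []] [[] []] [[[[] []] []] []]. Qed.

Lemma relabelK x : relabel_inv a b (relabel a b x) = x.
Proof. by case: a b x ab => [[] []] [[] []] [[[[] []] []] []]. Qed.

Lemma relabel_invK x : relabel a b (relabel_inv a b x) = x.
Proof. by case: a b x ab => [[] []] [[] []] [[[[] []] []] []]. Qed.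

Lemma par_relabel x : par (relabel a b x) = par x.
Proof. by case: a b x ab => [[] []] [[] []] [[[[] []] []] []]. Qed.

End Relabel.

(** * Symmetric matchings of the 4-cube *)

Section Tesseract.
Variables (V : finType) (adj : rel V).
Implicit Types (p : corner -> V) (m : V -> V -> V).

Definition cube p :=
  [/\ injective p, forall v, exists x, v = p x
    & forall x v, adj (p x) v <-> exists d, v = p (flipc d x)].

Definition pattern p m a0 a1 := forall x d,
  m (p x) (p (flipc d x)) = p (flipc (dadd d (if par x then a1 else a0)) x).

Lemma cube_adj p x d : cube p -> adj (p x) (p (flipc d x)).
Proof. by case=> _ _ H; apply/H; exists d. Qed.

Lemma cube_iso p p' : cube p -> cube p' ->
  exists s : {perm V}, graph_aut adj s /\ forall x, s (p x) = p' x.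
Proof.
move=> [pI pS pA] [pI' pS' pA'].
have [inv Hinv] := fin_all_exists pS.
have invE x : inv (p x) = x by apply: pI; rewrite -Hinv.
have sI : injective (fun v => p' (inv v)).
  by move=> v w /pI' E; rewrite (Hinv v) (Hinv w) E.
exists (perm sI); split=> [|x]; last by rewrite permE invE.
apply/forallP=> v; apply/forallP=> w; rewrite !permE (Hinv v) (Hinv w) !invE.
apply/eqP; apply/idP/idP.
  by move/pA'=> [d /pI' ->]; apply/pA; exists d.
by move/pA=> [d /pI ->]; apply/pA'; exists d.
Qed.

Lemma pattern_comm p p' m m' a0 a1 (s : {perm V}) : cube p ->
  (forall x, s (p x) = p' x) -> pattern p m a0 a1 -> pattern p' m' a0 a1 -> comm adj s m m'.
Proof.
move=> [_ pS pA] E H H' v w; have [x ->] := pS v; move/pA=> [d ->].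
by rewrite H !E H'.
Qed.

Lemma cube_relabel p a b : indep a b -> cube p -> cube (fun x => p (relabel a b x)).
Proof.
move=> ab [pI pS pA]; split.
- by move=> x y /pI E; rewrite -(relabelK ab x) E relabelK.
- by move=> v; have [x ->] := pS v; exists (relabel_inv a b x); rewrite relabel_invK.
move=> x v; rewrite pA; split=> -[d ->].
  by exists (lin_inv a b d); rewrite relabel_flipc // lin_invK.
by exists (lin a b d); rewrite relabel_flipc.
Qed.

Lemma pattern_relabel p m a b c0 c1 : indep a b ->
  pattern p m (lin a b c0) (lin a b c1) -> pattern (fun x => p (relabel a b x)) m c0 c1.
Proof.
move=> ab H x d; rewrite relabel_flipc // H par_relabel // relabel_flipc // lin_dadd.
by case: (par x).
Qed.

Lemma cube_flip p d : cube p -> cube (fun x => p (flipc d x)).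
Proof.
move=> [pI pS pA]; split.
- by move=> x y /pI /(can_inj (flipcK d)).
- by move=> v; have [x ->] := pS v; exists (flipc d x); rewrite flipcK.
by move=> x v; rewrite pA; split=> -[e ->]; exists e; rewrite flipcC.
Qed.

Lemma pattern_flip p m d a0 a1 : pattern p m a0 a1 ->
  pattern (fun x => p (flipc d x)) m a1 a0.
Proof. by move=> H x e; rewrite flipcC H par_flipc if_neg flipcC. Qed.

(** Two flips span a square, and its image is a square with parallel opposite edges; so the
    permutation of the directions is the same at adjacent vertices, hence at all. *)
Lemma cube_aut p (s : {perm V}) : cube p -> graph_aut adj s ->
  exists pi : dir -> dir, injective pi /\
  forall x y d, s (p x) = p y -> s (p (flipc d x)) = p (flipc (pi d) y).
Proof.
move=> Cp /graph_autE G; have [pI pS pA] := Cp.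
have [T HT] : exists T : corner -> corner, forall x, s (p x) = p (T x).
  exact: (fin_all_exists (P := fun x y => s (p x) = p y) (fun x => pS _)).
have TI : injective T by move=> x y E; apply/pI/(perm_inj (s := s)); rewrite !HT E.
have [K HK] : exists K : corner * dir -> dir,
    forall z, T (flipc z.2 z.1) = flipc (K z) (T z.1).
  apply: (fin_all_exists (P := fun z e => T (flipc z.2 z.1) = flipc e (T z.1))) => -[x d] /=.
  have : adj (p (T x)) (p (T (flipc d x))) by rewrite -!HT G; apply: cube_adj.
  by move/pA=> [e /pI E]; exists e.
have {}HK x d : T (flipc d x) = flipc (K (x, d)) (T x) := HK (x, d).
have KI x d e : K (x, d) = K (x, e) -> d = e.
  by move=> E; apply: (@flipc_inj _ _ x); apply: TI; rewrite !HK E.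
have Kflip d x e : K (flipc e x, d) = K (x, d).
  case: (eqVneq d e) => [<-|de].
    have := HK (flipc d x) d; rewrite flipcK HK => /(congr1 (flipc (K (flipc d x, d)))).
    by rewrite flipcK => /flipc_inj.
  apply: (@flipc2_eq _ (K (x, e)) (K (flipc d x, e)) _ (T x)).
  - by rewrite -!HK flipcC.
  - apply: contraNneq de => E; have := HK (flipc e x) d.
    by rewrite E [T (flipc e x)]HK flipcK => /TI; rewrite -{2}[x](flipcK e) => /flipc_inj ->.
  - by apply: contraNneq de => /KI ->.
pose pi d := K ((false, false, false, false), d).
have Kpi x d : K (x, d) = pi d.
  exact: (@flipc_invariant _ (fun x => K (x, d)) (fun x e => Kflip d x e) x).
exists pi; split; first by move=> d e; apply: KI.
by move=> x y d; rewrite HT => /pI <-; rewrite HT HK Kpi.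
Qed.

Lemma matching_pattern p m : cube p -> matching adj m ->
  exists a : corner -> dir, forall x, a x != (false, false) /\
    forall d, m (p x) (p (flipc d x)) = p (flipc (dadd d (a x)) x).
Proof.
move=> Cp [inv madj mN]; have [pI pS pA] := Cp.
apply: (fin_all_exists (P := fun x a => a != (false, false) /\
    forall d, m (p x) (p (flipc d x)) = p (flipc (dadd d a) x))) => x.
have [k Hk] : exists k : dir -> dir, forall d, m (p x) (p (flipc d x)) = p (flipc (k d) x).
  apply: (fin_all_exists (P := fun d e => m (p x) (p (flipc d x)) = p (flipc e x))) => d.
  by apply/pA; rewrite madj; apply: cube_adj.
have [||a a0 Ha] := @dir_involution k.
- by move=> d; apply: (@flipc_inj _ _ x); apply: pI; rewrite -!Hk inv.
- move=> d; apply: contraNneq (mN _ _ (cube_adj x d Cp)) => E.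
  by rewrite Hk E.
by exists a; split=> // d; rewrite Hk Ha.
Qed.

Section Classification.
Variables (p : corner -> V) (mA mB : V -> V -> V).
Hypotheses (Cp : cube p) (MA : matching adj mA) (MB : matching adj mB)
  (neq : forall v w, adj v w -> mA v w != mB v w)
  (DT : dart_transitive adj mA mB).

Let pI : injective p. Proof. by case: Cp. Qed.

Lemma cube_patterns : exists a0 a1 b0 b1,
  [/\ indep a0 b0, indep a1 b1, pattern p mA a0 a1, pattern p mB b0 b1 &
      (a1 = b0 -> b1 = a0) /\ (b1 = a0 -> a1 = b0)].
Proof.
have [a Ha] := matching_pattern Cp MA; have [b Hb] := matching_pattern Cp MB.
have ab x : indep (a x) (b x).
  rewrite /indep (Ha x).1 (Hb x).1 /=.
  apply: contraNneq (neq (cube_adj x (false, false) Cp)) => E.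
  by rewrite (Ha x).2 (Hb x).2 E.
have tA (s : {perm V}) pi (x y : corner) :
    (forall x y d, s (p x) = p y -> s (p (flipc d x)) = p (flipc (pi d) y)) ->
    comm adj s mA mA -> s (p x) = p y -> forall e, pi (dadd e (a x)) = dadd (pi e) (a y).
  move=> Hs C E e; have := C _ _ (cube_adj x e Cp).
  by rewrite (Ha x).2 !(Hs _ _ _ E) E (Ha y).2 => /pI/flipc_inj.
have tB (s : {perm V}) pi (x y : corner) :
    (forall x y d, s (p x) = p y -> s (p (flipc d x)) = p (flipc (pi d) y)) ->
    comm adj s mB mB -> s (p x) = p y -> forall e, pi (dadd e (b x)) = dadd (pi e) (b y).
  move=> Hs C E e; have := C _ _ (cube_adj x e Cp).
  by rewrite (Hb x).2 !(Hs _ _ _ E) E (Hb y).2 => /pI/flipc_inj.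
have same x d d' : a (flipc d x) = a (flipc d' x) /\ b (flipc d x) = b (flipc d' x).
  have [s [Gs CA CB [E1 E2]]] := DT (cube_adj x d Cp : dart adj (_, _))
    (cube_adj x d' Cp : dart adj (_, _)).
  have [pi [_ Hs]] := cube_aut Cp Gs.
  have pid : pi d = d' by move: E2; rewrite /= (Hs _ _ _ E1) => /pI/flipc_inj.
  have pia := tA s pi x x Hs CA E1; have pib := tB s pi x x Hs CB E1.
  (* [pi] commutes with the translations by [a x] and [b x], which span F_2^2, so it is itself a
     translation. *)
  have piE e : pi e = dadd e (dadd d d').
    have /and3P[a0 b0 ab0] := ab x.
    have := dir_span d e a0 b0 ab0; rewrite !inE.
    by case/or4P => /eqP ->; rewrite ?pib ?pia pid;
      case: d d' (a x) (b x) {E1 E2 Hs pia pib pid ab0 a0 b0} => [[] []] [[] []] [[] []] [[] []].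
  have := tA s pi _ _ Hs CA E2 (false, false); have := tB s pi _ _ Hs CB E2 (false, false).
  rewrite !piE; move: (dadd d d') => c; have cancel (f g : dir) :
      dadd (dadd (false, false) f) c = dadd (dadd (false, false) c) g -> f = g.
    by case: c f g {E1 E2} => [[] []] [[] []] [[] []].
  by move=> /cancel -> /cancel ->.
have [a0 [a1 Ea]] := flipc_two_valued (fun x d e => (same x d e).1).
have [b0 [b1 Eb]] := flipc_two_valued (fun x d e => (same x d e).2).
pose x0 : corner := (false, false, false, false); pose d0 : dir := (false, false).
have ab0 := ab x0; have ab1 := ab (flipc d0 x0); rewrite !Ea !Eb /= in ab0 ab1.
exists a0, a1, b0, b1; split=> //.
- by move=> x d; rewrite (Ha x).2 Ea.
- by move=> x d; rewrite (Hb x).2 Eb.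
(* Reversing an edge exchanges the parities, so up to the translation by [pi d0] the map [pi]
   exchanges [a0] with [a1] and [b0] with [b1]; hence [a1 = b0] exactly when [b1 = a0]. *)
have [s [Gs CA CB [E1 E2]]] := DT (cube_adj x0 d0 Cp : dart adj (_, _))
  (cube_adj (flipc d0 x0) d0 Cp : dart adj (_, _)).
rewrite flipcK in E2; have [pi [_ Hs]] := cube_aut Cp Gs.
have A01 := tA s pi _ _ Hs CA E1 d0; have A10 := tA s pi _ _ Hs CA E2 d0.
have B01 := tB s pi _ _ Hs CB E1 d0; have B10 := tB s pi _ _ Hs CB E2 d0.
rewrite !Ea !Eb /= in A01 A10 B01 B10; split=> E; apply: (@dadd_inj (pi d0)).
  by rewrite -B01 -A10 E.
by rewrite -A01 -B10 E.
Qed.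

End Classification.

(* The points of the wreath digraph are the squares of the 4-cube parallel to the
   first two or to the last two directions. *)
Definition cube_px p (i : nat) (a b : bool) : V :=
  match i %% 4 with
  | 0 => p (b, b, a, a)
  | 1 => p (a, a, b, ~~ b)
  | 2 => p (b, ~~ b, a, ~~ a)
  | _ => p (a, ~~ a, b, b)
  end.

Definition px_cube (mk : nat -> bool -> bool -> V) (x : corner) : V :=
  let: (x1, x2, x3, x4) := x in
  match x1 (+) x2, x3 (+) x4 with
  | false, false => mk 0 x3 x1
  | false, true => mk 1 x1 x3
  | true, true => mk 2 x3 x1
  | true, false => mk 3 x1 x3
  end.

Ltac some_dir := first [by exists (false, false) | by exists (true, false)
  | by exists (false, true) | by exists (true, true)].

Ltac some_bit := first [by left; exists true | by left; exists false
  | by right; exists true | by right; exists false].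

Lemma cube_px_PX p : cube p -> PX adj 4 false (cube_px p).
Proof.
move=> [pI pS pA]; have per i a b : cube_px p (i + 4) a b = cube_px p i a b.
  by rewrite /cube_px modnDr.
split.
- by move=> i a b; rewrite per !addbF.
- move=> v; have [[[[x1 x2] x3] x4] ->] := pS v.
  exists (if x1 (+) x2 then (if x3 (+) x4 then 2 else 3) else (if x3 (+) x4 then 1 else 0)),
    (if x1 (+) x2 == x3 (+) x4 then x3 else x1), (if x1 (+) x2 == x3 (+) x4 then x1 else x3).
  by case: x1 x2 x3 x4 => [] [] [] [].
- move=> i j a b a' b'; rewrite /cube_px.
  have := ltn_pmod j (isT : 0 < 4); have := ltn_pmod i (isT : 0 < 4).
  case: (i %% 4) => [|[|[|[|]]]] // _; case: (j %% 4) => [|[|[|[|]]]] // _ /pI //;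
  by case: a b a' b' => [] [] [] [].
- move=> i a b a' b'; rewrite /cube_px.
  have := ltn_pmod i (isT : 0 < 4).
  case: (i %% 4) => [|[|[|[|]]]] // _ /pI //;
  by case: a b a' b' => [] [] [] [].
move=> i a b v; have E k : cube_px p (k + i) = cube_px p (k + i %% 4).
  by rewrite /cube_px modnDmr.
rewrite (E 1) (E 2) (E 0); have := ltn_pmod i (isT : 0 < 4).
case: (i %% 4) => [|[|[|[|]]]] // _; rewrite /cube_px pA;
  by split=> [[[[] []] ->]|[] [[] ->]]; case: a b {E} => [] []; (some_dir || some_bit).
Qed.

Lemma px_cube_cube mk : PX adj 4 false mk -> cube (px_cube mk).
Proof.
move=> P; have [H1 H2 H3 H4 H5] := P; split.
- move=> [[[x1 x2] x3] x4] [[[y1 y2] y3] y4].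
  by case: x1; case: x2; case: x3; case: x4; case: y1; case: y2; case: y3; case: y4 => //= E;
    by [have := H3 _ _ _ _ _ _ E | have := H4 _ _ _ _ _ E; case].
- move=> v; have [i [a [b [i4 E]]]] := px_canon (isT : 3 <= 4) P v.
  have {}E : v = mk (i.+1 %% 4) a b.
    by rewrite E; case: i i4 {E} => [|[|[|[|]]]] // _; rewrite -[4]/(0 + 4) H1 !addbF.
  rewrite E; have := ltn_pmod i.+1 (isT : 0 < 4).
  case: (i.+1 %% 4) => [|[|[|[|]]]] // _.
  + by exists (b, b, a, a); case: a b {E} => [] [].
  + by exists (a, a, b, ~~ b); case: a b {E} => [] [].
  + by exists (b, ~~ b, a, ~~ a); case: a b {E} => [] [].
  + by exists (a, ~~ a, b, b); case: a b {E} => [] [].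
have E0 a b : mk 0 a b = mk 4 a b by rewrite -[4]/(0 + 4) H1 !addbF.
have E5 a b : mk 5 a b = mk 1 a b by rewrite -[5]/(1 + 4) H1 !addbF.
have A0 a b v : adj (mk 0 a b) v <-> (exists c, v = mk 1 b c) \/ (exists z, v = mk 3 z a).
  rewrite E0 H5; split=> -[] [c ->]; [left|right|left|right]; exists c; by rewrite ?E5.
have A3 a b v : adj (mk 3 a b) v <-> (exists c, v = mk 0 b c) \/ (exists z, v = mk 2 z a).
  rewrite H5; split=> -[] [c ->]; [left|right|left|right]; exists c; by rewrite ?E0.
move=> [[[x1 x2] x3] x4] v; case: x1; case: x2; case: x3; case: x4;
  rewrite /px_cube /= ?A0 ?A3 ?H5;
  by split=> [[] [[] ->]|[[[] []] ->]]; (some_dir || some_bit).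
Qed.

Lemma pattern_turn p m : cube p -> pattern p m (true, false) (true, false) ->
  gturn (cube_px p) m.
Proof.
move=> Cp H i a b c; have E k : cube_px p (k + i) = cube_px p (k + i %% 4).
  by rewrite /cube_px modnDmr.
rewrite (E 1) (E 2) (E 0); have := ltn_pmod i (isT : 0 < 4).
have Hd x d y y' : y = flipc d x -> y' = flipc (dadd d (true, false)) x ->
  m (p x) (p y) = p y' by move=> -> ->; rewrite H if_same.
case: (i %% 4) => [|[|[|[|]]]] // _; rewrite /cube_px /=; split; case: a b c => [] [] [];
  ((by apply: (Hd _ (false, false))) || (by apply: (Hd _ (true, false))) ||
   (by apply: (Hd _ (false, true))) || (by apply: (Hd _ (true, true)))).
Qed.

(** The parity of a corner is the parity of its level, so the alternation between two translations
    becomes the term [~~ odd i]. *)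
Lemma pattern_straight p m : cube p -> pattern p m (false, true) (true, true) ->
  gstraight (fun i a b => a (+) b (+) ~~ odd i) (cube_px p) m.
Proof.
move=> Cp H i a b c; have E k : cube_px p (k + i) = cube_px p (k + i %% 4).
  by rewrite /cube_px modnDmr.
have -> : odd i = odd (i %% 4) by rewrite {1}(divn_eq i 4) oddD oddM andbF.
rewrite (E 1) (E 2) (E 0); have := ltn_pmod i (isT : 0 < 4).
have Hd x d y y' : y = flipc d x ->
  y' = flipc (dadd d (if par x then (true, true) else (false, true))) x ->
  m (p x) (p y) = p y' by move=> -> ->; rewrite H.
case: (i %% 4) => [|[|[|[|]]]] // _; rewrite /cube_px /=; split; case: a b c => [] [] [];
  ((by apply: (Hd _ (false, false))) || (by apply: (Hd _ (true, false))) ||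
   (by apply: (Hd _ (false, true))) || (by apply: (Hd _ (true, true)))).
Qed.

Lemma pattern_turn_type p mA mB a b : cube p -> indep a b ->
  pattern p mA a a -> pattern p mB b (dadd a b) ->
  exists mk, turn_type adj 4 true true mk mA mB.
Proof.
move=> Cp ab HA HB; have Cq := cube_relabel ab Cp.
have TA : pattern (fun x => p (relabel a b x)) mA (true, false) (true, false).
  by apply: pattern_relabel => //; move: HA; rewrite /lin /= daddC; case: (a) => [[] []].
have SB : pattern (fun x => p (relabel a b x)) mB (false, true) (true, true).
  by apply: pattern_relabel => //; move: HB; rewrite /lin /=; case: (b) => [[] []].
(* Four consecutive values of [X] sum to 1 exactly at even [i], which cancels the alternating term;
   [X (i + 4)] is the negation of [X i], which makes the twist 1. *)
pose X i := odd (i.+1 %/ 4); have P := cube_px_PX Cq.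
exists (tr X (cube_px (fun x => p (relabel a b x)))); split.
- rewrite -[true]addFb; apply: PX_tr P => i.
  by rewrite /X -addSn divnDr // oddD.
- exact/gturn_tr/pattern_turn.
have S := gstraight_tr X (pattern_straight Cq SB); apply: gstraight_ext S => i c d.
have E : X i (+) X i.+1 (+) X i.+2 (+) X i.+3 = ~~ odd i.
  rewrite (divn_eq i 4) /X -!addnS !divnMDl // !oddD oddM andbF.
  have := ltn_pmod i (isT : 0 < 4).
  by case: (i %% 4) => [|[|[|[|]]]] // _; case: (odd _).
by move: E; case: (odd i) (X i) (X i.+1) (X i.+2) (X i.+3) c d => [] [] [] [] [] [] [].
Qed.

Theorem class2_types4 N u mk F : N = 4 -> PX adj N u mk -> class2_01 adj F ->
  exists mA mB mk', [/\ matching adj mA, matching adj mB, F = faces adj mA :|: faces adj mB &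
    turn_type adj N true true mk' mA mB].
Proof.
move=> -> P0 CF; have N3 : 2 < 4 by [].
have [mk0 P] : exists mk0, PX adj 4 false mk0.
  case: u P0 => P0; last by exists mk.
  exists (tr (fun i => odd (i %/ 4)) mk); rewrite -[false]/(true (+) true).
  by apply: PX_tr P0 => i; rewrite divnDr // oddD.
have [mA [mB [MA MB neq EF [DT noswap]]]] :=
  class2_matchings (px_sym N3 P) (px_degree N3 P) CF.
have Cp := px_cube_cube P; set p := px_cube mk0 in Cp.
have [a0 [a1 [b0 [b1 [ab0 ab1 HA HB [swap1 swap2]]]]]] := cube_patterns Cp MA MB neq DT.
have ba0 : indep b0 a0 by have /and3P[? ? ?] := ab0; apply/and3P; split; rewrite // eq_sym.
(* Of the six pairs [(a1, b1)] of distinct nonzero vectors, [swap1] and [swap2] leave four. If both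
   matchings are constant a relabelling exchanges them, and if [(a1, b1) = (b0, a0)] a flip does.
   Otherwise just one is constant, and it becomes the turning one. *)
case: (eqVneq a1 a0) => [Ea|Na].
  case: (eqVneq b1 b0) => [Eb|Nb].
    rewrite Ea Eb in HA HB.
    have [s [Gs Es]] := cube_iso (cube_relabel ab0 Cp) (cube_relabel ba0 Cp).
    have lin1 a b : lin a b (true, false) = a by case: a => [[] []].
    have lin2 a b : lin a b (false, true) = b by case: b => [[] []].
    case: (noswap s Gs).
      by apply: (pattern_comm (a0 := (true, false))
        (a1 := (true, false)) (cube_relabel ab0 Cp) Es);
        apply: pattern_relabel; rewrite ?lin1.
    by apply: (pattern_comm (a0 := (false, true)) (a1 := (false, true)) (cube_relabel ab0 Cp) Es);
      apply: pattern_relabel; rewrite ?lin2.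
  have Eb : b1 = dadd a0 b0.
    by move: ab0 ab1 Nb; rewrite Ea; case: a0 b0 b1 {HA HB swap1 swap2 ba0 Ea}
      => [[] []] [[] []] [[] []].
  rewrite Ea in HA; rewrite Eb in HB; have [mk' T] := pattern_turn_type Cp ab0 HA HB.
  by exists mA, mB, mk'.
case: (eqVneq a1 b0) => [Ea|Na'].
  rewrite Ea in HA; rewrite (swap1 Ea) in HB.
  have [s [Gs Es]] := cube_iso Cp (cube_flip (false, false) Cp).
  case: (noswap s Gs).
    exact: (pattern_comm Cp Es HA (@pattern_flip _ _ (false, false) _ _ HB)).
  exact: (pattern_comm Cp Es HB (@pattern_flip _ _ (false, false) _ _ HA)).
have [Ea Eb] : a1 = dadd b0 a0 /\ b1 = b0.
  have Nb : b1 != a0 by apply: contraNneq Na' => /swap2 ->.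
  by move: ab0 ab1 Na Na' Nb; case: a0 b0 a1 b1 {HA HB swap1 swap2 ba0}
    => [[] []] [[] []] [[] []] [[] []].
rewrite Ea in HA; rewrite Eb in HB; have [mk' T] := pattern_turn_type Cp ba0 HB HA.
by exists mB, mA, mk'; rewrite setUC.
Qed.

End Tesseract.

(** * Rose window graphs *)

Section Rose.
Variable n : nat.
Hypothesis n3 : 3 <= n.
Local Notation adj := (rose_adj (2 * n) (n + 2) (n + 1)).

Lemma double_gt0 : 0 < 2 * n. Proof. by lia. Qed.

Definition res k : 'I_(2 * n) := Ordinal (ltn_pmod k double_gt0).

Lemma res_eq k l : k = l %[mod 2 * n] -> res k = res l.
Proof. by move=> E; apply: val_inj. Qed.

Lemma res_val (k : 'I_(2 * n)) : k = res k.
Proof. by apply: val_inj; rewrite /= modn_small. Qed.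

Lemma near_mod k l : k = l \/ k = l + 2 * n \/ l = k + 2 * n -> k = l %[mod 2 * n].
Proof. by case=> [->|[]->]; rewrite ?modnDr. Qed.

Lemma near_mod_cancel l t k r : l + r = k %[mod 2 * n] ->
  t + r = k \/ t + r = k + 2 * n \/ k = t + r + 2 * n -> l = t %[mod 2 * n].
Proof. by move=> E /near_mod E'; apply/eqP; rewrite -(eqn_modDr r) E E'. Qed.

Lemma rose_xx k l : adj (false, res k) (false, res l) =
  (k + 1 == l %[mod 2 * n]) || (l + 1 == k %[mod 2 * n]).
Proof. by rewrite /= !modnDml. Qed.

Lemma rose_yy k l : adj (true, res k) (true, res l) =
  (k + (n + 1) == l %[mod 2 * n]) || (l + (n + 1) == k %[mod 2 * n]).
Proof. by rewrite /= !modnDml. Qed.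

Lemma rose_xy k l : adj (false, res k) (true, res l) =
  (l == k %[mod 2 * n]) || (l + (n + 2) == k %[mod 2 * n]).
Proof. by rewrite /= !modnDml. Qed.

Lemma rose_yx k l : adj (true, res k) (false, res l) =
  (k == l %[mod 2 * n]) || (k + (n + 2) == l %[mod 2 * n]).
Proof. by rewrite /= !modnDml. Qed.

(* Write p = i + n a and q = i + 1 + n b: the vertex is the arc from p to q of
   the wreath graph on Z_{2n}, so x_j is the arc from j - 1 to j and y_j the
   arc from j to j + n + 1. *)
Definition rose_mk (i : nat) (a b : bool) : bool * 'I_(2 * n) :=
  if a == b then (false, res (i + n * a + 1)) else (true, res (i + n * a)).

(** The two points of a level differ by [n], so replacing [i] by [i + n] exchanges them: the natural
    coordinates are twisted. *)
Lemma rose_PX : PX adj n true rose_mk.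
Proof.
have dv : n %| 2 * n by rewrite dvdn_mull.
have toN k l : k = l %[mod 2 * n] -> k = l %[mod n].
  by move=> E; rewrite -(modn_dvdm k dv) E modn_dvdm.
split.
- move=> i a b; rewrite /rose_mk; case: a b => [] [] /=; congr (_, _);
    by apply/res_eq/near_mod; lia.
- case=> [[] k]; rewrite (res_val k).
    by exists k, false, true; rewrite /rose_mk /= muln0 addn0.
  exists (k + 2 * n - 1), false, false; rewrite /rose_mk /=; congr (_, _).
  by apply/res_eq/near_mod; lia.
- move=> i j a b a' b'; rewrite /rose_mk.
  have red c k : k + n * c = k %[mod n] by rewrite addnC mulnC modnMDl.
  case: (a == b); case: (a' == b') => // -[/toN]; last by rewrite !red.
  by move=> /eqP; rewrite eqn_modDr !red => /eqP.
- move=> i a b a' b'; rewrite /rose_mk.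
  have bit (c d : bool) k : (k + n * c == k + n * d %[mod 2 * n]) = (c == d).
    rewrite eqn_modDl; case: c d => [] []; rewrite ?muln1 ?muln0 ?eqxx // mod0n;
      rewrite modn_small; lia.
  case: (eqVneq a b) => [<-|ab]; case: (eqVneq a' b') => [<-|ab'] // -[] /eqP.
    by rewrite eqn_modDr bit => /eqP ->.
  by rewrite bit => /eqP E; split=> //; move: ab ab'; rewrite E; case: a' b b' {E} => [] [] [].
have negE1 (c : bool) : (c == ~~ c) = false by case: c.
have negE2 (c : bool) : (~~ c == c) = false by case: c.
move=> i a b [vb k]; rewrite (res_val k); move: (val k) => {k} l; split.
  rewrite /rose_mk; case: (eqVneq a b) => [<-{b}|ab]; case: vb.
  - rewrite rose_xy => /orP[] /eqP E.
      left; exists (~~ a); rewrite negE1.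
      by congr (_, _); apply/res_eq; rewrite E; apply: near_mod; lia.
    right; exists (~~ a); rewrite negE2.
    by congr (_, _); apply/res_eq/(near_mod_cancel E); case: (a); lia.
  - rewrite rose_xx => /orP[] /eqP E.
      left; exists a; rewrite eqxx.
      by congr (_, _); apply/res_eq; rewrite -E; apply: near_mod; lia.
    right; exists a; rewrite eqxx.
    by congr (_, _); apply/res_eq/(near_mod_cancel E); case: (a); lia.
  - have {ab} -> : b = ~~ a by case: a b ab => [] [].
    rewrite rose_yy => /orP[] /eqP E.
      left; exists a; rewrite negE2.
      by congr (_, _); apply/res_eq; rewrite -E; apply: near_mod; case: (a); lia.
    right; exists (~~ a); rewrite negE2.
    by congr (_, _); apply/res_eq/(near_mod_cancel E); case: (a); lia.
  have {ab} -> : b = ~~ a by case: a b ab => [] [].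
  rewrite rose_yx => /orP[] /eqP E.
    right; exists a; rewrite eqxx.
    by congr (_, _); apply/res_eq; rewrite -E; apply: near_mod; lia.
  left; exists (~~ a); rewrite eqxx.
  by congr (_, _); apply/res_eq; rewrite -E; apply: near_mod; case: (a); lia.
rewrite /rose_mk; case: (eqVneq a b) => [<-{b}|ab].
  case=> -[c ->]; (have [->|->] : c = a \/ c = ~~ a by case: (a) c => [] []; auto);
    rewrite ?eqxx ?negE1 ?negE2 ?rose_xx ?rose_xy.
  - by apply/orP; left; apply/eqP/near_mod; lia.
  - by apply/orP; left; apply/eqP/near_mod; lia.
  - by apply/orP; right; apply/eqP/near_mod; lia.
  - by apply/orP; right; apply/eqP/near_mod; case: (a); lia.
have {ab} -> : b = ~~ a by case: a b ab => [] [].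
case=> -[c ->]; (have [->|->] : c = a \/ c = ~~ a by case: (a) c => [] []; auto);
  rewrite ?eqxx ?negE1 ?negE2 ?rose_yx ?rose_yy.
- by apply/orP; left; apply/eqP/near_mod; case: (a); lia.
- by apply/orP; right; apply/eqP/near_mod; case: (a); lia.
- by apply/orP; left; apply/eqP/near_mod; case: (a); lia.
- by apply/orP; right; apply/eqP/near_mod; case: (a); lia.
Qed.

Definition len (u : bool) := if u then 2 * n else n.

Lemma rose_coord u : exists mk, PX adj n u mk.
Proof.
case: u; first by exists rose_mk; exact: rose_PX.
exists (tr (fun i => odd (i %/ n)) rose_mk); rewrite -[false]/(true (+) true).
apply: PX_tr rose_PX => i; rewrite divnDr // divnn oddD; have -> : 0 < n by lia.
by [].
Qed.

Definition turn_map u be F := exists mA mB mk,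
  [/\ matching adj mA, matching adj mB, F = faces adj mA :|: faces adj mB
    & turn_type adj n u be mk mA mB].

Definition straight_map F := exists mA mB mk,
  [/\ matching adj mA, matching adj mB, F = faces adj mA :|: faces adj mB
    & straight_type adj n false false true mk mA mB].

Lemma turn_map_exists u be : exists F, turn_map u be F.
Proof.
have [mk P] := rose_coord u; have [mA [MA TA]] := ex_turn n3 P.
have [mB [MB SB]] := ex_straight n3 P be false.
by exists (faces adj mA :|: faces adj mB), mA, mB, mk.
Qed.

Lemma straight_map_exists : exists F, straight_map F.
Proof.
have [mk P] := rose_coord false; have [mA [MA SA]] := ex_straight n3 P false false.
have [mB [MB SB]] := ex_straight n3 P false true.
by exists (faces adj mA :|: faces adj mB), mA, mB, mk.
Qed.

Lemma turn_map_class2 u be F : turn_map u be F -> period be %| n -> 4 != len u ->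
  class2_01 adj F /\ has_face_lengths F 4 (len u).
Proof. by move=> [mA [mB [mk [MA MB -> T]]]] pn n4; apply: (turn_type_class2 n3 MA MB T). Qed.

Lemma straight_map_class2 F : straight_map F -> 3 %| n -> odd n ->
  class2_01 adj F /\ has_face_lengths F n (2 * n).
Proof. by move=> [mA [mB [mk [MA MB -> T]]]] pn on; apply: (straight_type_class2 n3 MA MB T). Qed.

Lemma turn_map_iso u be F F' : turn_map u be F -> turn_map u be F' -> map_iso adj F F'.
Proof.
move=> [mA [mB [mk [MA MB -> T]]]] [mA' [mB' [mk' [_ _ -> T']]]].
exact: (turn_type_iso n3 MA MB T T').
Qed.

Lemma straight_map_iso F F' : straight_map F -> straight_map F' -> map_iso adj F F'.
Proof.
move=> [mA [mB [mk [MA MB -> T]]]] [mA' [mB' [mk' [_ _ -> T']]]].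
exact: (straight_type_iso n3 MA MB T T').
Qed.

Lemma turn_map_noniso u be be' F F' : n != 4 -> 4 != len u ->
  period be %| n -> period be' %| n -> turn_map u be F -> turn_map u be' F' ->
  map_iso adj F F' -> be = be'.
Proof.
move=> n4 l4 pn pn' [mA [mB [mk [MA MB -> T]]]] [mA' [mB' [mk' [MA' MB' -> T']]]].
exact: (turn_type_noniso n3 n4 l4 pn pn' MA MB MA' MB' T T').
Qed.

Lemma class2_maps F : class2_01 adj F ->
  (exists u be, [/\ period be %| n, turn_map u be F & n = 4 -> u = true /\ be = true]) \/
  [/\ odd n, 3 %| n & straight_map F].
Proof.
move=> CF; case: (eqVneq n 4) => [E|N4].
  have [mA [mB [mk [MA MB EF T]]]] := class2_types4 E rose_PX CF.
  left; exists true, true; split=> //; first by rewrite E.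
  by exists mA, mB, mk.
have [mA [mB [mk [MA MB EF T]]]] := class2_types n3 N4 rose_PX CF.
case: T => [[u [be [pN T]]]|[on pn T]]; [left|right].
  exists u, be; split=> // [|E]; first by exists mA, mB, mk.
  by rewrite E in N4.
by split=> //; exists mA, mB, mk.
Qed.

End Rose.

(** * Arithmetic of n modulo 12 and the count of maps *)

Lemma face_lengths_neq n : 3 <= n -> n <> 4 ->
  [/\ ~ (n = 4 \/ n = 2 * n), ~ (2 * n = 4 \/ 2 * n = n) & ~ (4 = n \/ 4 = 2 * n)].
Proof. by move=> n3 n4; split; lia. Qed.

Lemma mod12_odd n : n %% 12 \in [:: 3; 9] -> [/\ 3 %| n, ~~ (4 %| n) & odd n].
Proof. by rewrite !inE => /orP[] /eqP H; split; lia. Qed.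

Lemma mod12_even n : n %% 12 \in [:: 4; 6; 8] ->
  ~~ odd n /\ exists2 be, period be %| n & ~~ (period (~~ be) %| n).
Proof.
rewrite !inE => /or3P[] /eqP H; split; try lia; [exists true|exists false|exists true];
  rewrite /period /=; lia.
Qed.

Lemma mod12_zero n : n %% 12 = 0 -> [/\ 3 %| n, 4 %| n & ~~ odd n].
Proof. by move=> H; split; lia. Qed.

Theorem theorem3p6 (n : nat) : 3 <= n ->
  ((exists F, class2_01 (rose_adj (2 * n) (n + 2) (n + 1)) F) <-> 2 < gcdn n 12) /\
  (n = 4 ->
     class2_01_maps_are (rose_adj (2 * n) (n + 2) (n + 1)) [:: (4, 8)]) /\
  (n %% 12 \in [:: 3; 9] ->
     class2_01_maps_are (rose_adj (2 * n) (n + 2) (n + 1))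
       [:: (4, n); (4, 2 * n); (n, 2 * n)]) /\
  (n %% 12 \in [:: 4; 6; 8] -> n <> 4 ->
     class2_01_maps_are (rose_adj (2 * n) (n + 2) (n + 1))
       [:: (4, n); (4, 2 * n)]) /\
  (n %% 12 = 0 ->
     class2_01_maps_are (rose_adj (2 * n) (n + 2) (n + 1))
       [:: (4, n); (4, n); (4, 2 * n); (4, 2 * n)]).
Proof.
(* The digits in the names [F11], [F10], [F01], [F00] are the twist [u], which decides between face
   lengths [n] and [2 * n], and the coefficient [be]. *)
move=> n3; have [F11 T11] := turn_map_exists n3 true true.
have [F10 T10] := turn_map_exists n3 true false.
have [F01 T01] := turn_map_exists n3 false true.
have [F00 T00] := turn_map_exists n3 false false.
have l1 : 4 != len n true by rewrite /len; lia.
have l0 : n <> 4 -> 4 != len n false by rewrite /len; lia.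
split; [|split; [|split; [|split]]].
- split=> [[F /(class2_maps n3)]|].
    have g12 : 0 < gcdn n 12 by rewrite gcdn_gt0 orbT.
    case=> [[u [[] [pn _ _]]]|[_ pn _]].
    + by have : 4 %| gcdn n 12; [rewrite dvdn_gcd pn | move/(dvdn_leq g12); lia].
    + by have : 3 %| gcdn n 12; [rewrite dvdn_gcd pn | move/(dvdn_leq g12); lia].
    + by have : 3 %| gcdn n 12; [rewrite dvdn_gcd pn | move/(dvdn_leq g12); lia].
  (* [gcdn n 12] depends only on [n %% 12], and it is at most 2 unless 3 or 4 divides this
     residue. *)
  move=> g; have [p3|p4] : 3 %| n \/ 4 %| n.
    have : (n %% 12 %% 3 == 0) || (n %% 12 %% 4 == 0).
      move: g; rewrite gcdnC -gcdn_modr; have := ltn_pmod n (isT : 0 < 12).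
      by case: (n %% 12) => [|[|[|[|[|[|[|[|[|[|[|[|r]]]]]]]]]]]].
    by rewrite !modn_dvdm // => /orP[]; [left | right].
    by exists F10; case: (turn_map_class2 n3 T10 p3 l1).
  by exists F11; case: (turn_map_class2 n3 T11 p4 l1).
- move=> n4; have p4 : period true %| n by rewrite n4.
  have [C11 L11] := turn_map_class2 n3 T11 p4 l1.
  exists [:: F11]; split=> //.
  + have E8 : len n true = 8 by rewrite /len n4.
    by case=> // _; split=> //; move: L11; rewrite E8.
  + by case=> [|i] [|j].
  + move=> F /(class2_maps n3)[[u [be [_ T /(_ n4)[Eu Eb]]]]|[on _ _]]; last by rewrite n4 in on.
    by exists 0 => //; rewrite Eu Eb in T; apply: (turn_map_iso n3 T T11).
- move=> n39; have n4 : n <> 4 by move=> E; rewrite E in n39.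
  have [p3 p4 on] := mod12_odd n39; have [neA neB neC] := face_lengths_neq n3 n4.
  have [G TG] := straight_map_exists n3.
  have [C00 L00] := turn_map_class2 n3 T00 p3 (l0 n4).
  have [C10 L10] := turn_map_class2 n3 T10 p3 l1.
  have [CG LG] := straight_map_class2 n3 TG p3 on.
  exists [:: F00; F10; G]; split=> //.
  + by case=> [|[|[|]]].
  + case=> [|[|[|//]]] [|[|[|//]]] // _ _ _ I.
    * case: (neA (has_face_lengths_iso2 I L00 L10)).
    * case: (neC (has_face_lengths_iso I L00 LG)).
    * case: (neB (has_face_lengths_iso2 I L10 L00)).
    * case: (neC (has_face_lengths_iso I L10 LG)).
    * case: (neB (has_face_lengths_iso2 I LG L00)).
    * case: (neA (has_face_lengths_iso I LG L10)).
  move=> F /(class2_maps n3)[[u [[] [pn T _]]]|[_ _ T]].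
  + by rewrite pn in p4.
  + case: u T => T; [exists 1 | exists 0] => //=.
      exact: (turn_map_iso n3 T T10).
    exact: (turn_map_iso n3 T T00).
  + by exists 2 => //=; apply: (straight_map_iso n3 T TG).
- move=> n468 n4; have [on [be pb pN]] := mod12_even n468.
  have [neA neB _] := face_lengths_neq n3 n4.
  have [F0 T0] := turn_map_exists n3 false be.
  have [F1 T1] := turn_map_exists n3 true be.
  have [C0 L0] := turn_map_class2 n3 T0 pb (l0 n4).
  have [C1 L1] := turn_map_class2 n3 T1 pb l1.
  exists [:: F0; F1]; split=> //.
  + by case=> [|[|]].
  + case=> [|[|//]] [|[|//]] // _ _ _ I.
    * case: (neA (has_face_lengths_iso2 I L0 L1)).
    * case: (neB (has_face_lengths_iso2 I L1 L0)).
  move=> F /(class2_maps n3)[[u [be' [pn T _]]]|[on' _ _]]; last by rewrite on' in on.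
  (* Exactly one of 3 and 4 divides [n], so the coefficient is determined. *)
  have Eb : be' = be by case: (eqVneq be' be) pN => // N; move: pn N;
    case: (be) (be') => [] [] //= ->.
  rewrite Eb in T; case: u T => T; [exists 1 | exists 0] => //=.
    exact: (turn_map_iso n3 T T1).
  exact: (turn_map_iso n3 T T0).
move=> n12; have n4 : n <> 4 by move=> E; rewrite E in n12.
have [p3 p4 on] : [/\ period false %| n, period true %| n & ~~ odd n] := mod12_zero n12.
have [neA neB _] := face_lengths_neq n3 n4.
have n4' : n != 4 by apply/eqP.
have [C00 L00] := turn_map_class2 n3 T00 p3 (l0 n4).
have [C01 L01] := turn_map_class2 n3 T01 p4 (l0 n4).
have [C10 L10] := turn_map_class2 n3 T10 p3 l1.
have [C11 L11] := turn_map_class2 n3 T11 p4 l1.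
(* For each twist the two maps have the same face lengths and are told apart by [be]. *)
have nonA := turn_map_noniso n3 n4' (l0 n4) p3 p4 T00 T01.
have nonA' := turn_map_noniso n3 n4' (l0 n4) p4 p3 T01 T00.
have nonB := turn_map_noniso n3 n4' l1 p3 p4 T10 T11.
have nonB' := turn_map_noniso n3 n4' l1 p4 p3 T11 T10.
exists [:: F00; F01; F10; F11]; split=> //.
- by case=> [|[|[|[|]]]].
- case=> [|[|[|[|//]]]] [|[|[|[|//]]]] // _ _ _ I.
  + by have := nonA I.
  + case: (neA (has_face_lengths_iso2 I L00 L10)).
  + case: (neA (has_face_lengths_iso2 I L00 L11)).
  + by have := nonA' I.
  + case: (neA (has_face_lengths_iso2 I L01 L10)).
  + case: (neA (has_face_lengths_iso2 I L01 L11)).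
  + case: (neB (has_face_lengths_iso2 I L10 L00)).
  + case: (neB (has_face_lengths_iso2 I L10 L01)).
  + by have := nonB I.
  + case: (neB (has_face_lengths_iso2 I L11 L00)).
  + case: (neB (has_face_lengths_iso2 I L11 L01)).
  + by have := nonB' I.
move=> F /(class2_maps n3)[[u [be [_ T _]]]|[on' _ _]]; last by rewrite on' in on.
case: u be T => [] [] T; [exists 3 | exists 2 | exists 1 | exists 0] => //=.
- exact: (turn_map_iso n3 T T11).
- exact: (turn_map_iso n3 T T10).
- exact: (turn_map_iso n3 T T01).
- exact: (turn_map_iso n3 T T00).
Qed.
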